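(* Let $M\ge1$, let $d\rho_1,\dots,d\rho_M$ be compactly supported probability measures on $\mathbb{R}$, and let $d\rho$ be the measure whose pushforward under the exponential map is $d\tilde\rho=d\tilde\rho_1\boxtimes\cdots\boxtimes d\tilde\rho_M$. Suppose that $d\rho=p(s)\,ds$ is absolutely continuous with Hölder continuous density $p$. Define $$K(t,s)=-\frac{1}{2\pi^2}L(t,s)-\frac{1}{2\pi^2}\sum_{i=1}^M\left[\log\left|\frac{\omega_i^+(t)-\omega_i^+(s)}{\omega_i^+(t)-\omega_i^-(s)}\right|-L(t,s)\right],$$ $$L(t,s):=\log\left|\frac{M_{\tilde\rho}(e^{-t})-M_{\tilde\rho}(e^{-s})+\mathbf{i}\pi(p(t)-p(s))}{M_{\tilde\rho}(e^{-t})-M_{\tilde\rho}(e^{-s})+\mathbf{i}\pi(p(t)+p(s))}\right|,\qquad\omega_i^\pm(t):=M^{-1}_{\tilde\rho_i}\big(M_{\tilde\rho}(e^{-t})\pm\mathbf{i}\pi p(t)\big).$$ Suppose further that the density $p$ is $C^{1+\alpha}$ for some $\alpha>0$ on the interior of $\operatorname{supp}d\rho$ and that no $d\tilde\rho_i$ contains a point mass. Then for $s$ in the interior of $\operatorname{supp}d\rho$, $$K(t,s)=-\frac{1}{2\pi^2}\log|t-s|-\frac{1}{2\pi^2}\log\left|\frac{\partial_t[M_{\tilde\rho}(e^{-t})]+\mathbf{i}\pi p'(t)}{2\pi p(t)}\right|+\frac{1}{2\pi^2}\sum_{i=1}^M\log\left|\frac{(\omega_i^+(t)-\omega_i^-(t))\,M'_{\tilde\rho_i}(\omega_i^+(t))}{2\pi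 p(t)}\right|+o(t-s)$$ as $(t-s)\to0$, meaning that the covariance $K$ matches that of a log-correlated Gaussian field along the diagonal.
   Context: For a compactly supported probability measure $\rho$ on $\mathbb{R}$, $\tilde\rho$ is its pushforward under $x\mapsto e^x$; $M_{\tilde\rho}(z):=\int\frac{e^xz}{1-e^xz}d\rho(x)$; $M_{\tilde\rho}^{-1}$ is its functional inverse, and $S_{\tilde\rho}(z):=\frac{1+z}{z}M^{-1}_{\tilde\rho}(z)$ is the $S$-transform. The free multiplicative convolution $\boxtimes$ is the operation on probability measures with $S_{\tilde\rho_1\boxtimes\tilde\rho_2}=S_{\tilde\rho_1}S_{\tilde\rho_2}$. $\alpha$-Hölder continuity of $p$: there are $\alpha>0,\delta>0,C>0$ with $|p(x)-p(y)|<C|x-y|^\alpha$ for $0<|x-y|<\delta$. For real $t$, $M_{\tilde\rho}(e^{-t})$ denotes the Cauchy principal value $\mathrm{p.v.}\int\frac{e^{s-t}}{1-e^{s-t}}d\rho(s)$, which satisfies $\lim_{\varepsilon\to0^\pm}M_{\tilde\rho}(e^{-t+\mathbf{i}\varepsilon})=M_{\tilde\rho}(e^{-t})\pm\mathbf{i}\pi p(t)$. The expression $M_{\tilde\rho_i}^{-1}(M_{\tilde\rho}(e^{-t})\pm\mathbf{i}\pi p(t))$ means $\lim_{\varepsilon\to0^\pm}M_{\tilde\rho_i}^{-1}(M_{\tilde\rho}(e^{-t+\mathbf{i}\varepsilon}))$, where $\omega_i:=M^{-1}_{\tilde\rho_i}\circ M_{\tilde\rho}$ on $\mathbb{C}\setminus[0,\infty)$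 is the subordination function for multiplicative convolution. ($K$ is the covariance kernel of the Gaussian limit, as $N\to\infty$ with $M$ fixed, of the centered height function of the log-spectrum of $(Y^1\cdots Y^M)^*(Y^1\cdots Y^M)$, where the $Y^i$ are $N\times N$ right unitarily invariant and $(Y^i)^*Y^i$ has deterministic spectrum with limiting log-distribution $d\rho_i$.)
   Formalization: The error o(t-s) is read as a remainder tending to 0 as t→s, since the literal bound fails (K is symmetric, the constant term at t is not locally constant); M≥2 replaces M≥1 (for M=1, K=0 and the formula contains log 0); p(s)>0 is added, as the formula divides by p and fails where p(s)=0. *)

(* Defs.v *)
(* MathComp-Analysis, with the complex numbers R[i] of mathcomp-real-closed. *)
From HB Require Import structures.
From mathcomp Require Import all_boot all_order all_algebra.
From mathcomp Require Import all_classical all_reals all_analysis.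
From mathcomp Require Import complex.
Set Implicit Arguments.
Unset Strict Implicit.
Unset Printing Implicit Defensive.
Import Order.TTheory GRing.Theory Num.Theory.
Import numFieldNormedType.Exports.
Local Open Scope classical_set_scope.
Local Open Scope ring_scope.
Local Open Scope complex_scope.

(* Conventions.  A measure rho on R stands for the logarithm of a measure on
   (0, +oo), namely its pushforward by expR, written ~rho in the comments.
   The norm topology of R[i] is the one of its alias R[i]^o.  The order of
   R[i] satisfies: 0 <= z iff z is real and nonnegative. *)

Section Measures.
Context {R : realType}.
Implicit Types (rho : probability R R) (p : R -> R).

Definition msupport rho : set R :=
  [set x | forall e : R, 0 < e -> (0 < rho (ball x e))%E].

Definition has_density rho p : Prop :=
  [/\ measurable_fun setT p, forall x, 0 <= p x &
      forall A : set R, measurable A ->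
        rho A = (\int[lebesgue_measure]_(x in A) (p x)%:E)%E].

Definition exp_no_point_mass rho : Prop :=
  forall y : R, pushforward rho expR [set y] = 0%E.

Definition holder_continuous p : Prop :=
  exists alpha delta C : R, [/\ 0 < alpha, 0 < delta, 0 < C &
    forall x y, 0 < `|x - y| < delta -> `|p x - p y| < C * `|x - y| `^ alpha].

(* The Hölder constant of p' is local: p' usually blows up at the edges. *)
Definition C1_holder_on (alpha : R) (U : set R) p : Prop :=
  forall x, U x -> derivable p x 1 /\
    exists delta C : R, [/\ 0 < delta, 0 < C &
      forall y z, U y -> U z -> ball x delta y -> ball x delta z ->
        `|derive1 p y - derive1 p z| <= C * `|y - z| `^ alpha].

End Measures.

Section MultiplicativeConvolution.
Context {R : realType}.
Implicit Types (rho : probability R R) (z w : R[i]).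

(* \int e^x z / (1 - e^x z) d rho(x), integrating real and imaginary parts *)
Definition Mtr rho z : R[i] :=
  let k (x : R) : R[i] := (expR x)%:C * z / (1 - (expR x)%:C * z) in
  (\int[rho]_(x in setT) complex.Re (k x)) +i*
  (\int[rho]_(x in setT) complex.Im (k x)).

(* Mtr rho is an increasing bijection from the real half-line z < 0 onto
   ]-1, 0[; Mtr_inv is its inverse (with an arbitrary value outside of
   ]-1, 0[). *)
Definition Mtr_inv rho w : R[i] :=
  xget 0 [set z : R[i] | z < 0 /\ Mtr rho z = w].

Definition Str rho w : R[i] := (1 + w) / w * Mtr_inv rho w.

(* ~rho is the free multiplicative convolution of the ~(rho_ i).  The
   S-transform of a measure on (0, +oo) on ]-1, 0[ determines the measure. *)
Definition is_free_mul_conv (M : nat) rho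
    (rho_ : 'I_M -> probability R R) : Prop :=
  forall w, -1 < w < 0 -> Str rho w = \prod_(i < M) Str (rho_ i) w.

Definition cut_plane : set R[i] := [set z : R[i] | ~~ (0 <= z)].

(* omega is Mtr_inv rhoi \o Mtr rho, continued analytically from the negative
   half-line to the whole cut plane. *)
Definition is_subordination rhoi rho (omega : R[i] -> R[i]) : Prop :=
  [/\ forall z, cut_plane z ->
        derivable (omega : R[i]^o -> R[i]^o) z 1,
      forall z, cut_plane z ->
        cut_plane (omega z) /\ Mtr rhoi (omega z) = Mtr rho z &
      forall z, z < 0 -> omega z = Mtr_inv rhoi (Mtr rho z)].

(* Cauchy principal value of \int e^(s-t) / (1 - e^(s-t)) d rho(s) *)
Definition Mpv rho (t : R) : R :=
  lim ((\int[rho]_(s in [set s | eps < `|s - t|])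
          (expR (s - t) / (1 - expR (s - t)))) @[eps --> 0^'+]).

(* e^(-t + i eps) *)
Definition cexp_mt (t eps : R) : R[i] :=
  (expR (- t))%:C * (cos eps +i* sin eps).

Definition omega_p (omega : R[i] -> R[i]) (t : R) : R[i] :=
  lim ((omega (cexp_mt t eps) : R[i]^o) @[eps --> (0 : R)^'+]).

Definition omega_m (omega : R[i] -> R[i]) (t : R) : R[i] :=
  lim ((omega (cexp_mt t eps) : R[i]^o) @[eps --> (0 : R)^'-]).

Definition dMtr rho (w : R[i]) : R[i] :=
  derive1 (Mtr rho : R[i] -> R[i]^o) w.

End MultiplicativeConvolution.

Section Covariance.
Context {R : realType}.
Variables (M : nat) (rho_ : 'I_M -> probability R R) (rho : probability R R).
Variables (p : R -> R) (omega : 'I_M -> R[i] -> R[i]).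

Definition lnabs (z : R[i]) : R := ln (Normc.normc z).

Definition Lker (t s : R) : R :=
  lnabs (((Mpv rho t - Mpv rho s) +i* (pi * (p t - p s))) /
         ((Mpv rho t - Mpv rho s) +i* (pi * (p t + p s)))).

Definition Kker (t s : R) : R :=
  - (2 * pi ^+ 2)^-1 * Lker t s
  - (2 * pi ^+ 2)^-1 * \sum_(i < M)
      (lnabs ((omega_p (omega i) t - omega_p (omega i) s) /
              (omega_p (omega i) t - omega_m (omega i) s)) - Lker t s).

Definition Kdiag (t s : R) : R :=
  - (2 * pi ^+ 2)^-1 * ln `|t - s|
  - (2 * pi ^+ 2)^-1 *
      lnabs ((derive1 (Mpv rho) t +i* (pi * derive1 p t)) / (2 * pi * p t)%:C)
  + (2 * pi ^+ 2)^-1 * \sum_(i < M)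
      lnabs ((omega_p (omega i) t - omega_m (omega i) t)
             * dMtr (rho_ i) (omega_p (omega i) t) / (2 * pi * p t)%:C).

End Covariance.

(* Main.v *)
(* Write m = M_rho and eta = m / (1 + m) at boundary points of the cut plane.
   The multiplicativity of the S-transform reads
     \prod_i omega_i(z) = z eta(z)^(M-1)
   on the negative half-line, and extends to the upper half-plane by unique
   continuation.  For a measure without atoms the variance of 1 / (1 - e^x w),
   whose values lie on a circle, is positive; this gives
   arg omega_i < arg eta, and arg omega_i < (arg eta) / 2 at a zero of the
   derivative of M_(rho_i).  As the arguments of the omega_i sum up to
   arg z + (M-1) arg eta, the omega_i cannot approach the real line where the
   density is positive, hence they extend continuously to the boundary, and at
   most one of them, omega_(i0), reaches a critical point of its M_(rho_i).

   Taking omega_(i0) as a parameter, z = \prod_i omega_i / eta^(M-1) has a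
   nonzero derivative: otherwise z - e^(-s) would be O(|m(z) - m(s)|^2), which
   at z = e^(-s + i e) is O(e^(4/3)) by the estimate for the Cauchy transform of
   a Lipschitz density, whereas |z - e^(-s)| is of order e.  So omega_(i0) is
   C^1 along the boundary, with nonzero derivative.  In the difference of the
   two sides the logarithms of the increments of m cancel, and what is left is
   a sum of logarithms of ratios tending to 1. *)
Require Import Defs.
From HB Require Import structures.
From mathcomp Require Import all_boot all_order all_algebra.
From mathcomp Require Import all_classical all_reals all_analysis.
From mathcomp Require Import complex.
From mathcomp Require Import measurable_realfun.
From mathcomp Require Import ring lra.
Set Implicit Arguments.
Unset Strict Implicit.
Unset Printing Implicit Defensive.
Import Order.TTheory GRing.Theory Num.Theory.
Import numFieldNormedType.Exports.
Local Open Scope classical_set_scope.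
Local Open Scope ring_scope.
Local Open Scope complex_scope.

(** * Complex modulus and limits *)

(** Complex analysis is reduced to second-order expansions. [is_subordination] grants one complex
    derivative of [omega i]; inverting the explicit expansion of [Mtr (rho_ i)] gives a second
    order, except where the derivative of [Mtr rho] vanishes. These points are isolated, so the
    maximum principle has to tolerate finitely many exceptional points. The product identity is
    known on a half-line only, which is not open; its defect is therefore replaced by 0 in the lower
    half-plane before it is continued. At the boundary the derivative of [Mtr (rho_ i0)] may vanish
    at [omega_i0], so that [m] is not a local coordinate there, whereas [omega_i0] is one in both
    cases. The logarithms of this derivative and of the corresponding divided difference may
    diverge; they cancel before the limit is taken. Heights are written [tau ^+ 3]: the integrals
    for [m] are cut at distance [tau ^+ 2], and at [tau] when needed, and every zone contributes
    O(tau^2). *)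

Lemma cvg_regularP (K : numFieldType) (T : Type) (F : set_system T)
    {FF : ProperFilter F} (f : T -> K) (a : K) :
  (f : T -> K^o) @ F --> (a : K^o) <->
  forall e : K, 0 < e -> \forall t \near F, `|a - f t| < e.
Proof.
by split=> [/cvgrPdist_lt//|h]; apply/cvgrPdist_lt.
Qed.

Section ComplexModulus.
Context {R : realType}.
Implicit Types (x y z w : R[i]).

Definition nc z : R := Normc.normc z.

Lemma normE z : `|z| = (nc z)%:C. Proof. by []. Qed.

Lemma ncE z : nc z = Num.sqrt (complex.Re z ^+ 2 + complex.Im z ^+ 2).
Proof. by case: z. Qed.

Lemma nc2 z : nc z ^+ 2 = complex.Re z ^+ 2 + complex.Im z ^+ 2.
Proof. by rewrite ncE sqr_sqrtr// addr_ge0// sqr_ge0. Qed.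

Lemma nc_ge0 z : 0 <= nc z. Proof. by rewrite ncE sqrtr_ge0. Qed.

Lemma nc0 : nc 0 = 0. Proof. exact: Normc.normc0. Qed.

Lemma nc1 : nc 1 = 1. Proof. exact: Normc.normc1. Qed.

Lemma ncM x y : nc (x * y) = nc x * nc y. Proof. exact: Normc.normcM. Qed.

Lemma ncV x : nc x^-1 = (nc x)^-1. Proof. exact: Normc.normcV. Qed.

Lemma ncD x y : nc (x + y) <= nc x + nc y.
Proof. by have := ler_normD x y; rewrite !normE -rmorphD lecR. Qed.

Lemma ncN x : nc (- x) = nc x.
Proof. by have := normrN x; rewrite !normE => /complexI. Qed.

Lemma ncB x y : nc (x - y) <= nc x + nc y.
Proof. by rewrite -(ncN y) ncD. Qed.

Lemma ncBC x y : nc (x - y) = nc (y - x).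
Proof. by rewrite -ncN opprB. Qed.

Lemma nc_eq0 x : (nc x == 0) = (x == 0).
Proof.
apply/eqP/eqP => [|->]; last exact: nc0.
exact: Normc.eq0_normc.
Qed.

Lemma nc_gt0 x : (0 < nc x) = (x != 0).
Proof. by rewrite lt_def nc_ge0 nc_eq0 andbT. Qed.

Lemma nc_tri x y z : nc (x - z) <= nc (x - y) + nc (y - z).
Proof. by rewrite -[x - z](subrKA y) ncD. Qed.

Lemma ncB_ge x y : nc x - nc y <= nc (x - y).
Proof. by have := ncD (x - y) y; rewrite subrK lerBlDr. Qed.

Lemma ncX x n : nc (x ^+ n) = nc x ^+ n.
Proof. by elim: n => [|n IH]; rewrite ?expr0 ?nc1// !exprS ncM IH. Qed.

Lemma ncR (r : R) : nc r%:C = `|r|.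
Proof. by rewrite ncE/= expr0n addr0 sqrtr_sqr. Qed.

Lemma nc_Re x : `|complex.Re x| <= nc x.
Proof.
by rewrite ncE -sqrtr_sqr ler_wsqrtr// lerDl sqr_ge0.
Qed.

Lemma nc_Im x : `|complex.Im x| <= nc x.
Proof.
by rewrite ncE -sqrtr_sqr ler_wsqrtr// lerDr sqr_ge0.
Qed.

Lemma nc_le_ReIm x : nc x <= `|complex.Re x| + `|complex.Im x|.
Proof.
rewrite -(@ler_pXn2r _ 2)// ?nnegrE ?nc_ge0 ?addr_ge0//.
rewrite nc2 sqrrD !real_normK ?num_real// addrAC lerDl.
by rewrite mulrn_wge0// mulr_ge0.
Qed.

Lemma nc_conj x : nc (conjc x) = nc x.
Proof. by rewrite !ncE; case: x => a b /=; rewrite sqrrN. Qed.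

Lemma ReB x y : complex.Re (x - y) = complex.Re x - complex.Re y.
Proof. by case: x; case: y. Qed.
Lemma ImB x y : complex.Im (x - y) = complex.Im x - complex.Im y.
Proof. by case: x; case: y. Qed.
Lemma ReD x y : complex.Re (x + y) = complex.Re x + complex.Re y.
Proof. by case: x; case: y. Qed.
Lemma ImD x y : complex.Im (x + y) = complex.Im x + complex.Im y.
Proof. by case: x; case: y. Qed.
Lemma ReM x y : complex.Re (x * y) =
  complex.Re x * complex.Re y - complex.Im x * complex.Im y.
Proof. by case: x; case: y. Qed.
Lemma ImM x y : complex.Im (x * y) =
  complex.Re x * complex.Im y + complex.Im x * complex.Re y.
Proof. by case: x => ? ?; case: y => ? ? /=; rewrite addrC. Qed.
Lemma ReV x : complex.Re x^-1 = complex.Re x / nc x ^+ 2.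
Proof. by rewrite nc2; case: x. Qed.
Lemma ImV x : complex.Im x^-1 = - complex.Im x / nc x ^+ 2.
Proof. by rewrite nc2; case: x => a b/=; rewrite mulNr. Qed.
Lemma complex_ext x y : complex.Re x = complex.Re y ->
  complex.Im x = complex.Im y -> x = y.
Proof. by case: x; case: y => a b c d /= -> ->. Qed.

Lemma conj_mul z : conjc z * z = (nc z ^+ 2)%:C.
Proof. by rewrite nc2; case: z => a b; apply: complex_ext => /=; ring. Qed.

End ComplexModulus.

Arguments nc : simpl never.

Section Limits.
Context {R : realType} {T : Type}.
Implicit Types (F G : set_system T) (f g : T -> R[i]) (a b : R[i]).

(** Limits tested with real bounds: the positive elements of [R[i]], over which the topology of
    [R[i]^o] quantifies, are the positive reals ([tendsP]). *)
Definition tends F f a :=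
  forall e : R, 0 < e -> \forall t \near F, nc (f t - a) < e.

Lemma tendsP F {FF : ProperFilter F} f a :
  tends F f a <-> (f : T -> R[i]^o) @ F --> (a : R[i]^o).
Proof.
split=> h.
- apply/(cvg_regularP (K := R[i])) => e e0.
  have [er Ee] : exists er : R, e = er%:C.
    by move: e0; case: e => x y; rewrite ltcE /= => /andP[/eqP-> _]; exists x.
  move: e0; rewrite Ee ltcR => er0.
  by have := h er er0; apply: filterS => t; rewrite distrC normE ltcR.
- move/(cvg_regularP (K := R[i])) : h => h e e0.
  have /h : 0 < e%:C by rewrite ltcR.
  by apply: filterS => t; rewrite distrC normE ltcR.
Qed.

Lemma tends_cst F {FF : Filter F} a : tends F (fun=> a) a.
Proof. by move=> e e0; apply: nearW => t; rewrite subrr nc0. Qed.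

Lemma tends_eq F {FF : Filter F} f g a :
  (\forall t \near F, f t = g t) -> tends F f a -> tends F g a.
Proof.
move=> fg fa e e0; have := fa e e0.
by apply: filter_app; apply: filterS fg => t ->.
Qed.

Lemma tendsD F {FF : Filter F} f g a b :
  tends F f a -> tends F g b -> tends F (fun t => f t + g t) (a + b).
Proof.
move=> fa gb e e0; have e20 : 0 < e / 2 by rewrite divr_gt0.
near=> t.
have -> : f t + g t - (a + b) = (f t - a) + (g t - b) by ring.
rewrite (le_lt_trans (ncD _ _))// (splitr e) ltrD//; near: t.
  exact: fa.
exact: gb.
Unshelve. all: by end_near. Qed.

Lemma tendsN F {FF : Filter F} f a : tends F f a -> tends F (fun t => - f t) (- a).
Proof.
by move=> fa e e0; apply: filterS (fa e e0) => t; rewrite -opprD ncN.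
Qed.

Lemma tendsB F {FF : Filter F} f g a b :
  tends F f a -> tends F g b -> tends F (fun t => f t - g t) (a - b).
Proof. by move=> fa gb; apply: tendsD => //; exact: tendsN. Qed.

Lemma tends_near_bounded F {FF : Filter F} f a : tends F f a ->
  \forall t \near F, nc (f t) <= nc a + 1.
Proof.
move=> /(_ 1 ltr01); apply: filterS => t h.
have := ncD (f t - a) a; rewrite subrK; lra.
Qed.

Lemma tendsM F {FF : Filter F} f g a b :
  tends F f a -> tends F g b -> tends F (fun t => f t * g t) (a * b).
Proof.
move=> fa gb e e0.
have A0 : 0 < nc a + 1 by rewrite ltr_wpDl// nc_ge0.
have B0 : 0 < nc b + 1 by rewrite ltr_wpDl// nc_ge0.
have e1 : 0 < e / 2 / (nc b + 1) by rewrite !divr_gt0.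
have e2 : 0 < e / 2 / (nc a + 1) by rewrite !divr_gt0.
near=> t.
have -> : f t * g t - a * b = (f t - a) * b + f t * (g t - b) by ring.
rewrite (le_lt_trans (ncD _ _))// (splitr e) !ncM.
apply: ltr_leD.
  have h : nc (f t - a) < e / 2 / (nc b + 1) by near: t; exact: fa.
  have : nc (f t - a) * (nc b + 1) < e / 2 by rewrite -ltr_pdivlMr.
  have := nc_ge0 (f t - a); have := nc_ge0 b; nra.
have h : nc (g t - b) < e / 2 / (nc a + 1) by near: t; exact: gb.
have h2 : nc (f t) <= nc a + 1 by near: t; exact: tends_near_bounded.
have : nc (g t - b) * (nc a + 1) < e / 2 by rewrite -ltr_pdivlMr.
have := nc_ge0 (g t - b); have := nc_ge0 (f t); nra.
Unshelve. all: by end_near. Qed.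

Lemma tends_near_neq0 F {FF : Filter F} f a : tends F f a -> a != 0 ->
  \forall t \near F, nc a / 2 < nc (f t).
Proof.
move=> fa a0; have a2 : 0 < nc a / 2 by rewrite divr_gt0// nc_gt0.
apply: filterS (fa _ a2) => t h.
have := ncB_ge a (a - f t); rewrite ncBC opprB addrCA subrr addr0 in h *; lra.
Qed.

Lemma tendsV F {FF : Filter F} f a : tends F f a -> a != 0 ->
  tends F (fun t => (f t)^-1) a^-1.
Proof.
move=> fa a0 e e0.
have A0 : 0 < nc a by rewrite nc_gt0.
have e1 : 0 < e * nc a * (nc a / 2) by rewrite !mulr_gt0// divr_gt0.
near=> t.
have h1 : nc a / 2 < nc (f t) by near: t; exact: tends_near_neq0.
have ft0 : 0 < nc (f t) by rewrite (lt_trans _ h1)// divr_gt0.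
have ftN : f t != 0 by rewrite -nc_gt0.
have -> : (f t)^-1 - a^-1 = (a - f t) / (a * f t).
  by field; rewrite a0 ftN.
rewrite ncM ncV ncM ltr_pdivrMr ?mulr_gt0//.
have : nc (f t - a) < e * nc a * (nc a / 2) by near: t; exact: fa.
rewrite ncBC => /lt_trans; apply.
by rewrite -mulrA ltr_pM2l// ltr_pM2l.
Unshelve. all: by end_near. Qed.

Lemma tends_uniq F {FF : ProperFilter F} f a b :
  tends F f a -> tends F f b -> a = b.
Proof.
move=> fa fb; apply/eqP; rewrite -subr_eq0 -nc_eq0; apply/negPn/negP => ab.
have e0 : 0 < nc (a - b) / 2 by rewrite divr_gt0// lt_def ab nc_ge0.
have [t [h1 h2]] := filter_ex (filterI (fa _ e0) (fb _ e0)).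
have := nc_tri a (f t) b; rewrite (ncBC a (f t)); lra.
Qed.

Lemma tends_prod F {FF : Filter F} (I : Type) (r : seq I) (f : I -> T -> R[i])
    (a : I -> R[i]) : (forall i, tends F (f i) (a i)) ->
  tends F (fun t => \prod_(i <- r) f i t) (\prod_(i <- r) a i).
Proof.
move=> fa; elim: r => [|i r IH].
  by rewrite big_nil; apply: tends_eq (tends_cst 1); apply: nearW => t; rewrite big_nil.
rewrite big_cons; apply: tends_eq (tendsM (fa i) IH).
by apply: nearW => t; rewrite big_cons.
Qed.

Lemma tendsX F {FF : Filter F} f a n :
  tends F f a -> tends F (fun t => f t ^+ n) (a ^+ n).
Proof.
move=> fa; elim: n => [|n IH].
  by rewrite expr0; apply: tends_eq (tends_cst 1); apply: nearW.
rewrite exprS; apply: tends_eq (tendsM fa IH).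
by apply: nearW => t; rewrite exprS.
Qed.

Lemma tends_squeeze F {FF : Filter F} f a (h : T -> R) :
  (\forall t \near F, nc (f t - a) <= h t) ->
  (forall e, 0 < e -> \forall t \near F, h t < e) -> tends F f a.
Proof.
move=> fh h0 e e0; near=> t; apply: (@le_lt_trans _ _ (h t)); near: t => //.
exact: h0.
Unshelve. all: by end_near. Qed.

End Limits.

Section Neighbourhoods.
Context {R : realType}.
Implicit Types (z w : R[i]) (f g : R[i] -> R[i]).

Definition nbc z : set_system R[i] :=
  [set A | exists2 d : R, 0 < d & forall w, nc (w - z) < d -> A w].

Global Instance nbc_filter z : ProperFilter (nbc z).
Proof.
apply: Build_ProperFilter_ex.
  by move=> A [d d0 h]; exists z; apply: h; rewrite subrr nc0.
split.
- by exists 1.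
- move=> A B [d d0 h] [d' d'0 h']; exists (Num.min d d').
    by rewrite lt_min d0.
  by move=> w; rewrite lt_min => /andP[/h ? /h' ?].
- by move=> A B AB [d d0 h]; exists d => // w /h /AB.
Qed.

Lemma near_nbc_ball z (d : R) : 0 < d -> \forall w \near nbc z, nc (w - z) < d.
Proof. by move=> d0; exists d. Qed.

Lemma nbc_singleton z (P : R[i] -> Prop) : (\forall w \near nbc z, P w) -> P z.
Proof. by move=> [d d0]; apply; rewrite subrr nc0. Qed.

Lemma nbc_join z (P : R[i] -> Prop) : (\forall w \near nbc z, P w) ->
  \forall w \near nbc z, \forall u \near nbc w, P u.
Proof.
move=> [d d0 h]; exists (d / 2); first by rewrite divr_gt0.
move=> w hw; exists (d / 2); first by rewrite divr_gt0.
move=> u hu; apply: h; have := nc_tri u w z; lra.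
Qed.

Definition ccont f z := tends (nbc z) f (f z).

Lemma tends_id z : tends (nbc z) id z.
Proof. by move=> e e0; exists e. Qed.

Lemma tends_comp (T : Type) (F : set_system T) {FF : Filter F} f
    (g : T -> R[i]) z b :
  tends F g z -> tends (nbc z) f b -> tends F (fun t => f (g t)) b.
Proof.
move=> gz fz e e0; have [d d0 h] := fz e e0.
by apply: filterS (gz d d0) => t; exact: h.
Qed.

Lemma near_comp (T : Type) (F : set_system T) {FF : Filter F}
    (P : R[i] -> Prop) (g : T -> R[i]) z :
  tends F g z -> (\forall w \near nbc z, P w) -> \forall t \near F, P (g t).
Proof.
by move=> gz [d d0 h]; apply: filterS (gz d d0) => t; exact: h.
Qed.

End Neighbourhoods.

(** * Second-order expansions *)

Section SecondOrder.
Context {R : realType} {T : Type}.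
Implicit Types (F : set_system T) (a b c : R[i]).

(* [f = f0 + a y + b y^2 + o(y^2)] along [F], the coefficient [b] being left
   implicit. *)
Definition taylor2 F (y f : T -> R[i]) (f0 a : R[i]) := exists b (r : T -> R[i]),
  tends F r b /\ \forall t \near F, f t = f0 + a * y t + r t * y t ^+ 2.

Context (F : set_system T) {FF : Filter F} (y : T -> R[i]) (y0 : tends F y 0).

Lemma taylor2_tends f f0 a : taylor2 F y f f0 a -> tends F f f0.
Proof.
move=> [b [r [rb fE]]].
have H : tends F (fun t => f0 + a * y t + r t * y t ^+ 2) (f0 + a * 0 + b * 0 ^+ 2).
  apply: tendsD; last by apply: tendsM => //; exact: tendsX.
  by apply: tendsD; [exact: tends_cst|apply: tendsM => //; exact: tends_cst].
rewrite expr0n/= !mulr0 !addr0 in H.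
by apply: tends_eq H; apply: filterS fE => t ->.
Qed.

Lemma taylor2_eq f g f0 a : (\forall t \near F, f t = g t) ->
  taylor2 F y f f0 a -> taylor2 F y g f0 a.
Proof.
move=> fg [b [r [rb fE]]]; exists b, r; split=> //.
by apply: filterS (filterI fg fE) => t [<-].
Qed.

Lemma taylor2_cst c : taylor2 F y (fun=> c) c 0.
Proof.
exists 0, (fun=> 0); split; first exact: tends_cst.
by apply: nearW => t; rewrite !mul0r !addr0.
Qed.

Lemma taylor2_shift c : taylor2 F y (fun t => c + y t) c 1.
Proof.
exists 0, (fun=> 0); split; first exact: tends_cst.
by apply: nearW => t; rewrite !mul0r mul1r addr0.
Qed.

Lemma taylor2D f g f0 g0 a b : taylor2 F y f f0 a -> taylor2 F y g g0 b ->
  taylor2 F y (fun t => f t + g t) (f0 + g0) (a + b).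
Proof.
move=> [c [r [rc fE]]] [d [q [qd gE]]].
exists (c + d), (fun t => r t + q t); split; first exact: tendsD.
by apply: filterS (filterI fE gE) => t [-> ->]; ring.
Qed.

Lemma taylor2M f g f0 g0 a b : taylor2 F y f f0 a -> taylor2 F y g g0 b ->
  taylor2 F y (fun t => f t * g t) (f0 * g0) (a * g0 + f0 * b).
Proof.
move=> fT gT; have gt := taylor2_tends gT.
move: fT gT => [c [r [rc fE]]] [d [q [qd gE]]].
(* The coefficient is the literal limit of the remainder on the next line ([d * 0] is the limit of
   [q t * y t]), so that the limit lemmas apply term by term. *)
exists (f0 * d + a * (b + d * 0) + c * g0).
exists (fun t => f0 * q t + a * (b + q t * y t) + r t * g t); split.
  apply: tendsD; last exact: tendsM.
  apply: tendsD; apply: tendsM => //; try exact: tends_cst.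
  by apply: tendsD; [exact: tends_cst|exact: tendsM].
by apply: filterS (filterI fE gE) => t [-> ->]; ring.
Qed.

Lemma taylor2_scale f f0 a c : taylor2 F y f f0 a ->
  taylor2 F y (fun t => c * f t) (c * f0) (c * a).
Proof.
by move=> fT; have := taylor2M (taylor2_cst c) fT; rewrite mul0r add0r.
Qed.

Lemma taylor2N f f0 a : taylor2 F y f f0 a ->
  taylor2 F y (fun t => - f t) (- f0) (- a).
Proof.
move=> /(taylor2_scale (-1)); rewrite !mulN1r.
by apply: taylor2_eq; apply: nearW => t; rewrite mulN1r.
Qed.

Lemma taylor2B f g f0 g0 a b : taylor2 F y f f0 a -> taylor2 F y g g0 b ->
  taylor2 F y (fun t => f t - g t) (f0 - g0) (a - b).
Proof. by move=> fT gT; apply: taylor2D => //; exact: taylor2N. Qed.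

Lemma taylor2V f f0 a : taylor2 F y f f0 a -> f0 != 0 ->
  taylor2 F y (fun t => (f t)^-1) f0^-1 (- a / f0 ^+ 2).
Proof.
move=> fT f00; have ft := taylor2_tends fT.
have fN := tends_near_neq0 (FF := FF) ft f00.
move: fT => [c [r [rc fE]]].
exists ((a * (a + c * 0) - f0 * c) * (f0^-1 * f0^-1 * f0^-1)).
exists (fun t => (a * (a + r t * y t) - f0 * r t) * (f0^-1 * f0^-1 * (f t)^-1)).
split.
  apply: tendsM; last first.
    by apply: tendsM; [exact: tends_cst|exact: tendsV].
  apply: tendsB; apply: tendsM => //; try exact: tends_cst.
  by apply: tendsD; [exact: tends_cst|exact: tendsM].
apply: filterS (filterI fE fN) => t [ftE ftN].
have ft0 : f t != 0 by rewrite -nc_gt0 (le_lt_trans _ ftN)// divr_ge0// nc_ge0.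
apply: (mulIf ft0); rewrite mulVf//.
rewrite !mulrDl; transitivity (f0 ^- 2 * (f0 * f t - a * y t * f t +
   (a * (a + r t * y t) - f0 * r t) * y t ^+ 2)); last by field; rewrite ft0 f00.
by rewrite ftE; field.
Qed.

Lemma taylor2X f f0 a n : taylor2 F y f f0 a ->
  taylor2 F y (fun t => f t ^+ n) (f0 ^+ n) (a * n%:R * f0 ^+ n.-1).
Proof.
move=> fT; elim: n => [|n IH].
  by rewrite mulr0 mul0r; exact: taylor2_cst.
have := taylor2M fT IH; rewrite -exprS.
have -> : a * f0 ^+ n + f0 * (a * n%:R * f0 ^+ n.-1) = a * n.+1%:R * f0 ^+ n.
  case: n {IH} => [|n]; first by rewrite !expr0; ring.
  rewrite /= exprS -[n.+2]addn1 natrD; ring.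
by apply: taylor2_eq; apply: nearW => t; rewrite exprS.
Qed.

Lemma taylor2_prod (I : Type) (s : seq I) (f : I -> T -> R[i])
    (f0 a : I -> R[i]) : (forall i, taylor2 F y (f i) (f0 i) (a i)) ->
    (forall i, f0 i != 0) ->
  taylor2 F y (fun t => \prod_(i <- s) f i t) (\prod_(i <- s) f0 i)
    (\prod_(i <- s) f0 i * \sum_(i <- s) a i / f0 i).
Proof.
move=> fT f00; elim: s => [|i s IH].
  rewrite !big_nil mulr0; apply: taylor2_eq (taylor2_cst 1).
  by apply: nearW => t; rewrite big_nil.
rewrite !big_cons; have := taylor2M (fT i) IH.
set P := \prod_(_ <- _) _; set S := \sum_(_ <- _) _.
have -> : a i * P + f0 i * (P * S) = f0 i * P * (a i / f0 i + S).
  by field.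
by apply: taylor2_eq; apply: nearW => t; rewrite big_cons.
Qed.

End SecondOrder.

Section SecondOrderComposition.
Context {R : realType}.

Definition taylor2_at (g : R[i] -> R[i]) (w a : R[i]) :=
  taylor2 (nbc w) (fun u => u - w) g (g w) a.

Lemma tends_subr (w : R[i]) : tends (nbc w) (fun u => u - w) 0.
Proof. by rewrite -(subrr w); apply: tendsB (tends_id w) (tends_cst w). Qed.

Lemma taylor2_at_cont g (w a : R[i]) : taylor2_at g w a -> ccont g w.
Proof. by apply: taylor2_tends; exact: tends_subr. Qed.

Context {T : Type} (F : set_system T) {FF : Filter F}.
Context (y : T -> R[i]) (y0 : tends F y 0).

Lemma taylor2_comp (g : R[i] -> R[i]) (f : T -> R[i]) (w a c : R[i]) :
  taylor2_at g w c -> taylor2 F y f w a ->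
  taylor2 F y (fun t => g (f t)) (g w) (c * a).
Proof.
move=> [d [r [rd gE]]] fT; pose proof (taylor2_tends y0 fT) as ft.
move: fT => [b [q [qb fE]]].
exists (c * b + d * (a + b * 0) ^+ 2).
exists (fun t => c * q t + r (f t) * (a + q t * y t) ^+ 2); split.
  apply: tendsD; apply: tendsM => //; try exact: tends_cst.
    exact (tends_comp ft rd).
  apply: tendsX; apply: tendsD; [exact: tends_cst|exact: tendsM].
have := near_comp (FF := FF) ft gE; apply: filter_app; apply: filterS fE => t ftE ->.
have -> : f t - w = y t * (a + q t * y t) by rewrite ftE; ring.
ring.
Qed.

(** With [h t = f t - w] the expansion of [g] reads [g (f t) - g w = h t * D t], where [D t] tends
    to [c != 0]. Hence [h t = y t * k t] with [k] convergent, and putting this back into the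
    second-order term of [g] yields the second coefficient of [f]. *)
Lemma taylor2_implicit (g : R[i] -> R[i]) (f : T -> R[i]) (w a c : R[i]) :
  taylor2_at g w c -> c != 0 -> tends F f w ->
  taylor2 F y (fun t => g (f t)) (g w) a -> taylor2 F y f w (a / c).
Proof.
move=> [d [r [rd gE]]] c0 fw [b [q [qb gfE]]].
pose h t := f t - w.
have h0 : tends F h 0 by rewrite -(subrr w); apply: tendsB => //; exact: tends_cst.
pose D t := c + r (f t) * h t.
have Dc : tends F D c.
  rewrite -[c]addr0 -(mulr0 d); apply: tendsD; first exact: tends_cst.
  by apply: tendsM => //; exact (tends_comp fw rd).
have DN := tends_near_neq0 (FF := FF) Dc c0.
pose k t := (a + q t * y t) / D t.
have ka : tends F k (a / c).
  apply: tendsM; last exact: tendsV.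
  have H : tends F (fun t => a + q t * y t) (a + b * 0).
    by apply: tendsD; [exact: tends_cst|exact: tendsM].
  by rewrite mulr0 addr0 in H.
exists ((b - d * (a / c) ^+ 2) / c).
exists (fun t => (q t - r (f t) * k t ^+ 2) / c); split.
  apply: tendsM; last exact: tends_cst.
  apply: tendsB => //; apply: tendsM; first exact (tends_comp fw rd).
  exact: tendsX.
have gE' := near_comp (FF := FF) fw gE.
apply: filterS (filterI (filterI gfE gE') DN) => t [[E1 E2] Dt].
have Dt0 : D t != 0 by rewrite -nc_gt0 (le_lt_trans _ Dt)// divr_ge0// nc_ge0.
have E3 : h t * D t = y t * (a + q t * y t).
  have : g w + c * h t + r (f t) * h t ^+ 2 = g w + a * y t + q t * y t ^+ 2.
    by rewrite -E1 E2.
  rewrite -!addrA => /addrI E; rewrite /D.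
  by transitivity (c * h t + r (f t) * h t ^+ 2); [ring|rewrite E; ring].
have E4 : h t = y t * k t by rewrite /k mulrA -E3 mulfK.
have E5 : k t * D t = a + q t * y t by rewrite /k divfK.
have E6 : k t * c = a + q t * y t - k t * (r (f t) * h t).
  by rewrite -E5 /D; ring.
have E7 : k t = a / c + y t * ((q t - r (f t) * k t ^+ 2) / c).
  by apply: (mulIf c0); rewrite E6 E4; field.
have E8 : f t = w + h t by rewrite /h addrC subrK.
by rewrite [LHS]E8 E4 {1}E7; ring.
Qed.

End SecondOrderComposition.

(** * Maximum principle and unique continuation *)

Section Squares.
Context {R : realType}.
Implicit Types (z w : R[i]) (r d : R) (f : R[i] -> R[i]).

(** Squares instead of discs: a product of two segments is compact. *)
Definition square w r : set R[i] :=
  [set z | `|complex.Re (z - w)| <= r /\ `|complex.Im (z - w)| <= r].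

Lemma square_ball w r z : nc (z - w) <= r -> square w r z.
Proof.
by move=> h; split; apply: le_trans h; [exact: nc_Re|exact: nc_Im].
Qed.

Lemma square_nc w r z : square w r z -> nc (z - w) <= r + r.
Proof. by move=> [h1 h2]; rewrite (le_trans (nc_le_ReIm _))// lerD. Qed.

Lemma square_interior w r z : 0 <= r -> square w r z ->
  [\/ `|complex.Re (z - w)| = r, `|complex.Im (z - w)| = r |
      `|complex.Re (z - w)| < r /\ `|complex.Im (z - w)| < r].
Proof.
move=> r0 [h1 h2]; have [e1|n1] := eqVneq `|complex.Re (z - w)| r.
  exact: Or31.
have [e2|n2] := eqVneq `|complex.Im (z - w)| r; first exact: Or32.
by apply: Or33; rewrite !lt_neqAle n1 n2.
Qed.

Lemma square_border_nc w r z :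
  `|complex.Re (z - w)| = r \/ `|complex.Im (z - w)| = r -> r <= nc (z - w).
Proof. by move=> [<-|<-]; [exact: nc_Re|exact: nc_Im]. Qed.

Let uncurry_C (v : R[i] -> R) (xy : R * R) := v (xy.1 +i* xy.2).

Lemma nbc_pair z (P : R[i] -> Prop) : (\forall w \near nbc z, P w) ->
  \forall xy \near (complex.Re z, complex.Im z), P (xy.1 +i* xy.2).
Proof.
move=> [d d0 h].
have d2 : 0 < d / 2 by rewrite divr_gt0.
exists (ball (complex.Re z) (d / 2), ball (complex.Im z) (d / 2)).
  by split; apply: nbhsx_ballx.
move=> [x y] /= [hx hy]; apply: h.
rewrite (le_lt_trans (nc_le_ReIm _))// (splitr d) ReB ImB/= ltrD//.
  by move: hx; rewrite /ball/= distrC.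
by move: hy; rewrite /ball/= distrC.
Qed.

Lemma square_cluster w r (F : set_system R[i]) {FF : ProperFilter F} :
  F (square w r) -> exists2 z, square w r z &
    forall A d, F A -> 0 < d -> exists2 u, A u & nc (u - z) < d.
Proof.
move=> FQ.
pose K := `[complex.Re w - r, complex.Re w + r] `*`
          `[complex.Im w - r, complex.Im w + r].
have cK : compact K by apply: compact_setX; exact: segment_compact.
pose G := (fun z : R[i] => (complex.Re z, complex.Im z)) @ F.
have GK : G K.
  rewrite /G /fmap /=; apply: filterS FQ => z [h1 h2]; split => /=; rewrite in_itv/=.
    by move: h1; rewrite ReB ler_norml; lra.
  by move: h2; rewrite ImB ler_norml; lra.
have PG : ProperFilter G by exact: fmap_proper_filter.
have [[x y] [[/= Kx Ky] clG]] := cK G PG GK.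
exists (x +i* y).
  by move: Kx Ky; rewrite /square /= ReB ImB/= !in_itv/= !ler_norml; split; lra.
move=> A d FA d0.
pose B := [set xy : R * R | nc ((xy.1 +i* xy.2) - (x +i* y)) < d].
have nB : nbhs (x, y) B.
  by apply: (@nbc_pair (x +i* y) (fun z => nc (z - (x +i* y)) < d)); exists d.
pose A' := [set xy : R * R | A (xy.1 +i* xy.2)].
have GA : G A' by rewrite /G /fmap /=; apply: filterS FA => -[a b].
have : A' `&` B !=set0 by exact: clG.
by case=> -[x1 y1] [h1 h2]; exists (x1 +i* y1).
Qed.

Lemma square_max w r (v : R[i] -> R) : 0 <= r ->
  (forall z, square w r z -> forall e, 0 < e ->
     \forall u \near nbc z, `|v u - v z| < e) ->
  exists2 c, square w r c & forall z, square w r z -> v z <= v c.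
Proof.
move=> r0 cv.
pose K := `[complex.Re w - r, complex.Re w + r] `*`
          `[complex.Im w - r, complex.Im w + r].
have cK : compact K by apply: compact_setX; exact: segment_compact.
have KP x y : K (x, y) <-> square w r (x +i* y).
  rewrite /K /square /= ReB ImB/= !in_itv/= !ler_norml.
  by split => -[h1 h2]; split; lra.
have KN : K !=set0.
  exists (complex.Re w, complex.Im w); apply/KP; split;
    by rewrite ?ReB ?ImB/= subrr normr0.
have cvK : {within K, continuous (uncurry_C v)}.
  apply: continuous_in_subspaceT => -[x y] /set_mem /KP Qxy.
  by apply/cvgrPdist_lt => e e0; have := nbc_pair (cv _ Qxy e e0);
    apply: filterS => t; rewrite distrC.
have [[x y] /set_mem/KP Kxy maxv] := compact_EVT_max KN cK cvK.
exists (x +i* y) => // -[a b] Qz; apply: (maxv (a, b)).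
by apply/mem_set/KP.
Qed.

(** If no finite set contained the points of [E] in the square, the complements of finite sets would
    generate a proper filter there; a cluster point of it would not be isolated from [E]. *)
Lemma square_locally_finite w r (E : set R[i]) :
  (forall z, square w r z -> \forall u \near nbc z, u != z -> ~ E u) ->
  exists S : seq R[i], forall z, square w r z -> E z -> z \in S.
Proof.
move=> isoE; apply: contrapT => /forallNP nS.
pose F : set_system R[i] := [set A | exists S : seq R[i],
  forall z, square w r z -> E z -> z \notin S -> A z].
have FF : ProperFilter F.
  apply: Build_ProperFilter_ex.
    move=> A [S hS]; apply: contrapT => /forallNP nA; apply: (nS S) => z Qz Ez.
    by apply/negPn/negP => zS; apply: (nA z); exact: hS.
  split.
  - by exists [::].
  - move=> A B [S hS] [S' hS']; exists (S ++ S') => z Qz Ez.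
    by rewrite mem_cat negb_or => /andP[? ?]; split; [exact: hS|exact: hS'].
  - by move=> A B AB [S hS]; exists S => z Qz Ez zS; apply: AB; exact: hS.
have [|z Qz clz] := @square_cluster w r F FF; first by exists [::].
have [d d0 hd] := isoE z Qz.
have [||u [Eu uz] hu] := clz [set u | E u /\ u != z] d => //.
  by exists [:: z] => u Qu Eu; rewrite inE.
exact: hd hu uz Eu.
Qed.

End Squares.

Section MaximumPrinciple.
Context {R : realType}.
Implicit Types (z w : R[i]) (r d : R) (f : R[i] -> R[i]).

Definition twice_differentiable f z := exists a, taylor2_at f z a.

Lemma nc_comp_near f z : ccont f z -> forall e, 0 < e ->
  \forall u \near nbc z, `|nc (f u) ^+ 2 - nc (f z) ^+ 2| < e.
Proof.
move=> cf e e0.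
pose M := nc (f z) + nc (f z) + 1.
have M0 : 0 < M by rewrite /M; have := nc_ge0 (f z); lra.
have eM : 0 < e / M by rewrite divr_gt0.
near=> u.
have h1 : nc (f u - f z) < e / M by near: u; exact: cf.
have h2 : nc (f u) <= nc (f z) + 1 by near: u; exact: tends_near_bounded.
rewrite subr_sqr normrM mulrC.
have h3 : `|nc (f u) + nc (f z)| <= M.
  by rewrite ger0_norm ?addr_ge0 ?nc_ge0// /M; lra.
have h4 : `|nc (f u) - nc (f z)| <= nc (f u - f z).
  rewrite ler_norml ncB_ge andbT lerNl opprB ncBC; exact: ncB_ge.
rewrite (le_lt_trans (ler_wpM2r _ h3))// mulrC -ltr_pdivlMr//.
exact: le_lt_trans h4 h1.
Unshelve. all: by end_near. Qed.

(* The sum of [|f0 + a x + b x^2|^2] over the four points [x = h i^k]: the mixed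
   terms cancel. *)
Lemma four_point_sum (f0 a b : R[i]) (h : R) :
  let g x := nc (f0 + a * x + b * x ^+ 2) ^+ 2 in
  g h%:C + g (- h%:C) + g ('i * h%:C) + g (- ('i * h%:C)) =
  4 * nc f0 ^+ 2 + 4 * nc a ^+ 2 * h ^+ 2 + 4 * nc b ^+ 2 * h ^+ 4.
Proof.
case: f0 => p q; case: a => s t; case: b => c d.
by move=> g; rewrite /g !nc2 !expr2 /=; ring.
Qed.

Lemma nc_sqr_ge (x y : R[i]) : nc x ^+ 2 - 2 * nc x * nc y <= nc (x + y) ^+ 2.
Proof.
have h := ncB_ge x (- y); rewrite opprK ncN in h.
have := nc_ge0 x; have := nc_ge0 y; have := nc_ge0 (x + y).
move: (nc x) (nc y) (nc (x + y)) h => p q s h s0 q0 p0.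
have [pq|pq] := leP q p; last by nra.
have : (p - q) ^+ 2 <= s ^+ 2 by rewrite ler_sqr ?nnegrE ?subr_ge0.
by nra.
Qed.

(* At an interior maximum of [|f|^2 + e |z - w|^2] the second difference over
   [h, -h, ih, -ih] would be nonpositive, but it is at least [4 e h^2 - o(h^2)]. *)
Lemma no_interior_max f z w (e : R) : 0 < e -> twice_differentiable f z ->
  ~ (\forall u \near nbc z,
       nc (f u) ^+ 2 + e * nc (u - w) ^+ 2 <= nc (f z) ^+ 2 + e * nc (z - w) ^+ 2).
Proof.
move=> e0 [a [b [r [rb fE]]]] maxz.
(* [G] bounds the second-order polynomial for [nc x <= 1]; replacing the remainder [r] by its limit
   [b] then changes the squared modulus by less than [e * h ^+ 2]. *)
pose G := nc (f z) + nc a + nc b + 1.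
have G0 : 0 < G by rewrite /G; have := nc_ge0 (f z); have := nc_ge0 a; have := nc_ge0 b; lra.
have eG : 0 < e / (2 * G) by rewrite divr_gt0// mulr_gt0.
have [d d0 hd] := filterI (filterI maxz fE) (rb _ eG).
pose h := Num.min 1 (d / 2).
have h0 : 0 < h by rewrite lt_min ltr01 divr_gt0.
have h1 : h <= 1 by rewrite ge_min lexx.
have hd2 : h < d by rewrite gt_min; apply/orP; right; lra.
(* Strictness is essential: over the four points the losses [e * h ^+ 2] add up to exactly the gain
   [4 * e * h ^+ 2] of the term [e * nc (u - w) ^+ 2]. *)
have key x : nc x = h -> nc (f z + a * x + b * x ^+ 2) ^+ 2 - e * h ^+ 2
     + e * nc (x + (z - w)) ^+ 2 < nc (f z) ^+ 2 + e * nc (z - w) ^+ 2.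
  move=> xh; have /hd [[m1 m2] m3] : nc ((x + z) - z) < d by rewrite addrK xh.
  rewrite [x + (z - w)]addrA; move: m1; rewrite m2 addrK => m1.
  apply: lt_le_trans m1; rewrite ltrD2r.
  set g := f z + a * x + b * x ^+ 2.
  have -> : f z + a * x + r (x + z) * x ^+ 2 = g + (r (x + z) - b) * x ^+ 2.
    by rewrite /g; ring.
  apply: lt_le_trans (nc_sqr_ge _ _); rewrite ltrD2l ltrN2.
  have gG : nc g <= G.
    rewrite /g (le_trans (ncD _ _))// (le_trans (lerD (ncD _ _) (lexx _)))//.
    rewrite (ncM a) (ncM b) ncX xh /G.
    have := nc_ge0 a; have := nc_ge0 b; have : h ^+ 2 <= 1 by rewrite expr_le1// ltW.
    by nra.
  rewrite ncM ncX xh mulrA ltr_pM2r ?exprn_gt0//.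
  apply: (@le_lt_trans _ _ (2 * G * nc (r (x + z) - b))).
    by rewrite ler_wpM2r ?nc_ge0// ler_wpM2l.
  by move: m3; rewrite ltr_pdivlMr ?mulr_gt0// mulrC.
have ih : nc ('i * h%:C) = h.
  by rewrite ncM ncR gtr0_norm// ncE/= expr0n expr1n/= add0r sqrtr1 mul1r.
have k1 : _ := key h%:C _; rewrite ncR gtr0_norm// in k1.
have k2 : _ := key (- h%:C) _; rewrite ncN ncR gtr0_norm// in k2.
have k3 := key _ ih.
have k4 : _ := key (- ('i * h%:C)) _; rewrite ncN ih in k4.
have S1 := four_point_sum (f z) a b h.
have S2 := four_point_sum (z - w) 1 0 h.
rewrite /= !mul0r !addr0 !mul1r nc1 nc0 in S2.
rewrite /= in S1.
have hn1 := k1 erefl; have hn2 := k2 erefl; have hn4 := k4 erefl.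
rewrite ![_ + (z - w)]addrC in hn1 hn2 k3 hn4.
have a0 : 0 <= nc a ^+ 2 * h ^+ 2 by rewrite mulr_ge0// exprn_ge0// ?nc_ge0// ltW.
have b0 : 0 <= nc b ^+ 2 * h ^+ 4 by rewrite mulr_ge0// exprn_ge0// ?nc_ge0// ltW.
nra.
Qed.

(** The perturbation [e * nc (z - w) ^+ 2] makes [no_interior_max] applicable. A zero of [f] cannot
    be the maximum point, because [nc f ^+ 2] is still larger than [B ^+ 2] there. *)
Lemma max_principle_zeros f w r (B : R) : 0 < r -> 0 <= B ->
  (forall z, square w r z -> ccont f z) ->
  (forall z, `|complex.Re (z - w)| < r -> `|complex.Im (z - w)| < r ->
     f z = 0 \/ twice_differentiable f z) ->
  (forall z, square w r z ->
     `|complex.Re (z - w)| = r \/ `|complex.Im (z - w)| = r -> nc (f z) <= B) ->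
  forall z, square w r z -> nc (f z) <= B.
Proof.
move=> r0 B0 cf df bf z1 Qz1; rewrite leNgt; apply/negP => Bz1.
(* On the square [nc (z - w) <= 2 * r], so the perturbation uses up at most half of the gap. *)
pose e := (nc (f z1) ^+ 2 - B ^+ 2) / (8 * r ^+ 2).
have e0 : 0 < e.
  by rewrite divr_gt0 ?mulr_gt0 ?exprn_gt0// subr_gt0 ltr_pXn2r// ?nnegrE ?nc_ge0.
have eE : e * (8 * r ^+ 2) = nc (f z1) ^+ 2 - B ^+ 2.
  by rewrite divfK// mulf_neq0// expf_neq0// gt_eqF.
pose v z := nc (f z) ^+ 2 + e * nc (z - w) ^+ 2.
have [|zs Qzs maxv] := @square_max _ w r v (ltW r0).
- move=> z Qz d d0.
  have d2 : 0 < d / 2 by rewrite divr_gt0.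
  have de : 0 < d / 2 / e by rewrite divr_gt0.
  have cs : ccont (fun u => u - w) z.
    by apply: tendsB; [exact: tends_id|exact: tends_cst].
  have n1 := nc_comp_near (cf z Qz) d2.
  have n2 := nc_comp_near cs de.
  near=> u.
  have -> : v u - v z = (nc (f u) ^+ 2 - nc (f z) ^+ 2) +
      e * (nc (u - w) ^+ 2 - nc (z - w) ^+ 2) by rewrite /v; ring.
  rewrite (le_lt_trans (ler_normD _ _))// (splitr d) ltrD//; first by near: u.
  by rewrite normrM (gtr0_norm e0) mulrC -ltr_pdivlMr//; near: u.
have vz1 : nc (f z1) ^+ 2 <= v zs.
  by apply: le_trans (maxv _ Qz1); rewrite /v lerDl mulr_ge0 ?(ltW e0)// exprn_ge0// nc_ge0.
have szs : e * nc (zs - w) ^+ 2 <= (nc (f z1) ^+ 2 - B ^+ 2) / 2.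
  have : nc (zs - w) ^+ 2 <= (r + r) ^+ 2.
    by rewrite ler_pXn2r// ?nnegrE ?nc_ge0 ?addr_ge0 ?(ltW r0)//; exact: square_nc.
  by move=> ?; nra.
have gap : B ^+ 2 < nc (f z1) ^+ 2.
  by rewrite ltr_pXn2r// ?nnegrE ?nc_ge0.
have fzs : B ^+ 2 < nc (f zs) ^+ 2 by rewrite /v in vz1; lra.
have notb : ~ (`|complex.Re (zs - w)| = r \/ `|complex.Im (zs - w)| = r).
  move=> /(bf _ Qzs) h; move: fzs; rewrite ltNge => /negP; apply.
  by rewrite ler_pXn2r// ?nnegrE ?nc_ge0.
have [h1|h2|[h1 h2]] := square_interior (ltW r0) Qzs.
- by apply: notb; left.
- by apply: notb; right.
have [fz0|tdf] := df zs h1 h2.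
  by move: fzs; rewrite fz0 nc0 expr0n/=; have := sqr_ge0 B; lra.
apply: (no_interior_max e0 tdf (w := w)).
pose s := Num.min (r - `|complex.Re (zs - w)|) (r - `|complex.Im (zs - w)|).
have s0 : 0 < s by rewrite lt_min !subr_gt0 h1.
exists s => // u us; apply: maxv.
have us1 := le_lt_trans (nc_Re (u - zs)) us.
have us2 := le_lt_trans (nc_Im (u - zs)) us.
move: us1 us2; rewrite !lt_min => /andP[us1 _] /andP[_ us2].
split.
  rewrite -(subrKA zs) ReD (le_trans (ler_normD _ _))//; lra.
rewrite -(subrKA zs) ImD (le_trans (ler_normD _ _))//; lra.
Unshelve. all: by end_near. Qed.

End MaximumPrinciple.

Section UniqueContinuation.
Context {R : realType}.
Implicit Types (z w : R[i]) (r d : R) (f : R[i] -> R[i]) (S : seq R[i]).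

Lemma geometric_small (q p : R) : 0 <= q < 1 -> 0 < p -> exists n, q ^+ n < p.
Proof.
move=> /andP[q0 q1] p0.
have /cvgrPdist_lt/(_ p p0) : (q ^+ n) @[n --> \oo] --> 0.
  by apply: cvg_expr; rewrite ger0_norm.
move=> [n _ /(_ n (leqnn n))]; rewrite /= sub0r normrN ger0_norm ?exprn_ge0//.
by exists n.
Qed.

Lemma near_notin_seq z S : \forall u \near nbc z, u != z -> u \notin S.
Proof.
elim: S => [|s S IH]; first exact: nearW.
have [->|zs] := eqVneq s z.
  by apply: filterS IH => u h uz; rewrite inE (negbTE uz) h.
have sz0 : 0 < nc (s - z) by rewrite nc_gt0 subr_eq0.
apply: filterS (filterI IH (near_nbc_ball z sz0)) => u [h us] uz.
rewrite inE negb_or h// andbT; apply/eqP => E.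
by rewrite E ltxx in us.
Qed.

Lemma twice_differentiable_prod_roots u S :
  twice_differentiable (fun z => \prod_(e <- S) (z - e)) u.
Proof.
elim: S => [|s S [a IH]].
  exists 0; rewrite /taylor2_at big_nil; apply: taylor2_eq (taylor2_cst (F := nbc u) _ 1).
  by apply: nearW => t; rewrite big_nil.
eexists; rewrite /taylor2_at big_cons.
pose proof (taylor2_shift (F := nbc u) (fun x => x - u) (u - s)) as h.
apply: taylor2_eq (taylor2M (tends_subr u) h IH).
by apply: nearW => x; rewrite big_cons; congr (_ * _); ring.
Qed.

(** The product [f ^+ n * P], with [P] the monic polynomial whose roots are the points of [S],
    vanishes at the exceptional points. As [n] grows the bound on [P] becomes irrelevant off [S];
    the points of [S] follow by continuity. *)
Lemma max_principle f w r (B : R) S : 0 < r -> 0 <= B ->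
  (forall z, square w r z -> ccont f z) ->
  (forall z, `|complex.Re (z - w)| < r -> `|complex.Im (z - w)| < r ->
     z \notin S -> twice_differentiable f z) ->
  (forall z, square w r z ->
     `|complex.Re (z - w)| = r \/ `|complex.Im (z - w)| = r -> nc (f z) <= B) ->
  forall z, square w r z -> nc (f z) <= B.
Proof.
move=> r0 B0 cf df bf.
pose P z := \prod_(e <- S) (z - e).
have P0 z : (P z == 0) = (z \in S).
  rewrite /P; elim: S {df P} => [|s S IH]; first by rewrite big_nil oner_eq0.
  by rewrite big_cons mulf_eq0 IH subr_eq0 inE.
pose Pm := \prod_(e <- S) (r + r + nc (w - e)).
have Pm0 : 0 <= Pm.
  by rewrite /Pm prodr_ge0// => e _; rewrite !addr_ge0 ?(ltW r0)// nc_ge0.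
have PPm z : square w r z -> nc (P z) <= Pm.
  move=> Qz; rewrite /P /Pm; elim: S {df P P0 Pm Pm0} => [|s S IH].
    by rewrite !big_nil nc1.
  rewrite !big_cons ncM ler_pM ?nc_ge0//.
  by rewrite (le_trans (nc_tri z w s))// lerD2r square_nc.
have cP z : ccont P z.
  apply: tends_prod => e; apply: tendsB; [exact: tends_id|exact: tends_cst].
have offS z : square w r z -> z \notin S -> nc (f z) <= B.
  move=> Qz zS; rewrite leNgt; apply/negP => Bz.
  have fz0 : 0 < nc (f z) by exact: le_lt_trans Bz.
  have Pz0 : 0 < nc (P z) by rewrite nc_gt0 P0.
  have [n hn] : exists n, (B / nc (f z)) ^+ n < nc (P z) / (Pm + 1).
    apply: geometric_small; first by rewrite divr_ge0 ?nc_ge0//= ltr_pdivrMr// mul1r.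
    by rewrite divr_gt0// ltr_wpDl.
  have : nc (f z ^+ n * P z) <= B ^+ n * Pm.
    apply: (@max_principle_zeros _ (fun u => f u ^+ n * P u) w r) => //.
    - by rewrite mulr_ge0// exprn_ge0.
    - by move=> u Qu; apply: tendsM; [apply: tendsX; exact: cf|exact: cP].
    - move=> u h1 h2; have [uS|uS] := boolP (u \in S).
        by left; move: uS; rewrite -P0 => /eqP ->; rewrite mulr0.
      right; have [a fa] := df u h1 h2 uS.
      pose proof (taylor2X (tends_subr u) n fa) as fan.
      have [c Pn] := twice_differentiable_prod_roots u S.
      by eexists; exact (taylor2M (tends_subr u) fan Pn).
    - move=> u Qu hu; rewrite ncM ncX ler_pM ?exprn_ge0 ?nc_ge0//; last exact: PPm.
      by rewrite lerXn2r ?nnegrE ?nc_ge0// bf.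
  rewrite ncM ncX leNgt => /negP; apply.
  move: hn; rewrite ltr_pdivlMr ?ltr_wpDl// expr_div_n mulrAC.
  rewrite ltr_pdivrMr ?exprn_gt0// => hn.
  have : 0 <= B ^+ n by rewrite exprn_ge0.
  lra.
move=> z Qz; have [/offS->//|zS] := boolP (z \notin S).
have [e1|e2|[h1 h2]] := square_interior (ltW r0) Qz.
- by apply: bf => //; left.
- by apply: bf => //; right.
rewrite leNgt; apply/negP => Bz.
have gap : 0 < nc (f z) - B by rewrite subr_gt0.
have [d d0 hd] := filterI (cf z Qz _ gap) (near_notin_seq z S).
pose h := Num.min (d / 2) ((r - `|complex.Re (z - w)|) / 2).
have h0 : 0 < h by rewrite lt_min !divr_gt0// subr_gt0.
have hd2 : h < d by rewrite gt_min; apply/orP; left; lra.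
have hr : h < r - `|complex.Re (z - w)|.
  by rewrite gt_min; apply/orP; right; lra.
have nch : nc (z + h%:C - z) = h by rewrite addrAC subrr add0r ncR gtr0_norm.
have [u1 u2] : nc (f (z + h%:C) - f z) < nc (f z) - B /\
    (z + h%:C != z -> z + h%:C \notin S) by apply: hd; rewrite nch.
have zhS : z + h%:C \notin S.
  apply: u2; rewrite -subr_eq0 -nc_eq0 nch gt_eqF//.
have Qzh : square w r (z + h%:C).
  split.
    have -> : z + h%:C - w = (z - w) + h%:C by ring.
    rewrite ReD/= (le_trans (ler_normD _ _))// (gtr0_norm h0); lra.
  have -> : z + h%:C - w = (z - w) + h%:C by ring.
  by rewrite ImD/= addr0 ltW.
have := offS _ Qzh zhS; have := ncB_ge (f z) (f (z + h%:C)).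
rewrite ncBC; lra.
Qed.

(** The exceptions will be zeros of the derivative of [Mtr rho], where inverting the transforms
    gives no second-order expansion of the subordination functions. *)
Definition isolated_exceptions f z := ccont f z /\
  \forall u \near nbc z, u != z -> twice_differentiable f u.

(* If [f] vanishes near [w], the maximum principle applies to [f z / (z - w)^n]
   for every [n]. *)
Lemma vanish_square f w r : 0 < r ->
  (forall z, square w r z -> isolated_exceptions f z) ->
  (\forall z \near nbc w, f z = 0) -> forall z, nc (z - w) < r -> f z = 0.
Proof.
move=> r0 gf fw.
have [S hS] : exists S : seq R[i], forall z, square w r z ->
    ~ twice_differentiable f z -> z \in S.
  apply: (@square_locally_finite _ w r (fun z => ~ twice_differentiable f z)).
  move=> z Qz; have [_] := gf z Qz; apply: filterS => u h uz; move=> E; apply: E; exact: h.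
have [c Qc maxc] := @square_max _ w r (fun z => nc (f z) ^+ 2) (ltW r0)
  (fun z Qz => nc_comp_near (proj1 (gf z Qz))).
pose B := nc (f c).
have fB z : square w r z -> nc (f z) <= B.
  by move=> Qz; rewrite -(@ler_pXn2r _ 2)// ?nnegrE ?nc_ge0//; exact: maxc.
have B0 : 0 <= B by exact: nc_ge0.
have bound n z : square w r z -> nc (f z / (z - w) ^+ n) <= B / r ^+ n.
  apply: (@max_principle (fun z => f z / (z - w) ^+ n) w r _ S) => //.
  - by rewrite divr_ge0// exprn_ge0// ltW.
  (* At [u = w] the quotient is 0 by the convention on division, which is also its continuous value
     since [f] vanishes around [w]. *)
  - move=> u Qu; have [->|uw] := eqVneq u w.
      rewrite /ccont (nbc_singleton fw) mul0r.
      apply: tends_eq (tends_cst 0); apply: filterS fw => x ->.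
      by rewrite mul0r.
    apply: tendsM; first exact: (gf u Qu).1.
    apply: tendsV; last by rewrite expf_neq0// subr_eq0.
    by apply: tendsX; apply: tendsB; [exact: tends_id|exact: tends_cst].
  - move=> u h1 h2 uS; have [->|uw] := eqVneq u w.
      exists 0; rewrite /taylor2_at (nbc_singleton fw) mul0r.
      apply: taylor2_eq (taylor2_cst (F := nbc w) _ 0); apply: filterS fw => x ->.
      by rewrite mul0r.
    have [a fa] : twice_differentiable f u.
      apply: contrapT => /hS; rewrite (negbTE uS) => h; apply/notF/h.
      by split; exact: ltW.
    pose proof (taylor2_shift (F := nbc u) (fun x => x - u) (u - w)) as t1.
    pose proof (taylor2X (tends_subr u) n t1) as t2.
    have un : (u - w) ^+ n != 0 by rewrite expf_neq0// subr_eq0.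
    pose proof (taylor2V (tends_subr u) t2 un) as t3.
    eexists; apply: taylor2_eq (taylor2M (tends_subr u) fa t3).
    by apply: nearW => x; congr (_ / _ ^+ n); ring.
  - move=> u Qu hu; rewrite ncM ncV ncX ler_pM ?nc_ge0// ?invr_ge0 ?exprn_ge0 ?nc_ge0//.
      exact: fB.
    have ru := square_border_nc hu.
    rewrite lef_pV2 ?posrE ?exprn_gt0// ?(lt_le_trans r0)//.
    by rewrite lerXn2r ?nnegrE ?nc_ge0 ?(ltW r0).
move=> z zr; have Qz : square w r z by apply: square_ball; exact: ltW.
apply/eqP; rewrite -nc_eq0 eq_le nc_ge0 andbT leNgt; apply/negP => fz0.
have [zw|zw] := eqVneq z w.
  by move: fz0; rewrite zw (nbc_singleton fw) nc0 ltxx.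
have zw0 : 0 < nc (z - w) by rewrite nc_gt0 subr_eq0.
(* The bound says [nc (f z) <= B * (nc (z - w) / r) ^+ n], and [nc (z - w) < r]. *)
have [n hn] : exists n, (nc (z - w) / r) ^+ n < nc (f z) / (B + 1).
  apply: geometric_small; first by rewrite divr_ge0 ?nc_ge0 ?(ltW r0)//= ltr_pdivrMr// mul1r.
  by rewrite divr_gt0// ltr_wpDl.
have := bound n z Qz; rewrite leNgt => /negP; apply.
rewrite ncM ncV ncX ltr_pdivlMr ?exprn_gt0// mulrAC ltr_pdivrMr ?exprn_gt0//.
move: hn; rewrite expr_div_n ltr_pdivrMr ?exprn_gt0// mulrAC.
rewrite ltr_pdivlMr ?ltr_wpDl// => hn.
have : 0 <= nc (z - w) ^+ n by rewrite exprn_ge0// nc_ge0.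
lra.
Qed.

Lemma vanish_segment f (a b : R[i]) d : 0 < d ->
  (forall t : R, 0 <= t <= 1 -> forall z, square (a + t%:C * (b - a)) d z ->
     isolated_exceptions f z) ->
  (\forall z \near nbc a, f z = 0) -> \forall z \near nbc b, f z = 0.
Proof.
move=> d0 gf fa.
(* Consecutive centres [g k] are then closer than the common half-side [d]. *)
have [N hN] : exists N : nat, nc (b - a) < d * N.+1%:R.
  exists (Num.truncn (nc (b - a) / d)).
  by rewrite -ltr_pdivrMl// mulrC truncnS_gt.
pose g k := a + (k%:R / N.+1%:R)%:C * (b - a).
have step k : (k <= N.+1)%N -> \forall z \near nbc (g k), f z = 0.
  elim: k => [_|k IH kN].
    by rewrite /g mul0r mul0r addr0.
  have H := IH (ltnW kN).
  have kN1 : 0 <= (k%:R / N.+1%:R : R) <= 1.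
    by rewrite divr_ge0//= ler_pdivrMr// mul1r ler_nat ltnW.
  have gk := @vanish_square f (g k) d d0 (gf _ kN1) H.
  have dist : nc (g k.+1 - g k) < d.
    have -> : g k.+1 - g k = (N.+1%:R^-1)%:C * (b - a).
      rewrite /g -[k.+1]addn1 natrD mulrDl rmorphD/= mul1r; ring.
    by rewrite ncM ncR ger0_norm// mulrC ltr_pdivrMr.
  have e0 : 0 < d - nc (g k.+1 - g k) by rewrite subr_gt0.
  exists (d - nc (g k.+1 - g k)) => // u hu; apply: gk.
  have := nc_tri u (g k.+1) (g k); lra.
have := step N.+1 (leqnn _).
by rewrite /g divff ?pnatr_eq0// mul1r addrC subrK.
Qed.

End UniqueContinuation.

(** * The moment transform *)

Section BoundedExpectation.
Context {R : realType} (rho : probability R R).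
Implicit Types (f g : R -> R) (u v : R -> R[i]).

Definition bounded_measurable f := measurable_fun setT f /\
  exists B : R, forall x, `|f x| <= B.

Definition expect f : R := \int[rho]_(x in setT) f x.

Lemma bounded_measurable_cst (c : R) : bounded_measurable (fun=> c).
Proof. by split; [exact: measurable_cst|exists `|c|]. Qed.

Lemma bounded_measurableD f g : bounded_measurable f -> bounded_measurable g ->
  bounded_measurable (fun x => f x + g x).
Proof.
move=> [mf [B hB]] [mg [B' hB']]; split; first exact: measurable_funD.
by exists (B + B') => x; rewrite (le_trans (ler_normD _ _))// lerD.
Qed.

Lemma bounded_measurableM f g : bounded_measurable f -> bounded_measurable g ->
  bounded_measurable (fun x => f x * g x).
Proof.
move=> [mf [B hB]] [mg [B' hB']]; split; first exact: measurable_funM.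
by exists (B * B') => x; rewrite normrM ler_pM.
Qed.

Lemma bounded_measurableN f : bounded_measurable f -> bounded_measurable (fun x => - f x).
Proof.
move=> [mf [B hB]]; split; first exact: measurable_funN.
by exists B => x; rewrite normrN.
Qed.

Lemma bounded_measurableB f g : bounded_measurable f -> bounded_measurable g ->
  bounded_measurable (fun x => f x - g x).
Proof.
by move=> bf bg; apply: bounded_measurableD => //; exact: bounded_measurableN.
Qed.

Lemma bounded_measurable_integrable f : bounded_measurable f ->
  rho.-integrable setT (EFin \o f).
Proof.
move=> [mf [B hB]]; apply: measurable_bounded_integrable => //.
  exact: (le_lt_trans (probability_le1 rho measurableT) (ltry 1)).
exists B; split; first exact: num_real.
by move=> M BM x _ /=; rewrite (le_trans (hB x))// ltW.
Qed.

Lemma eq_expect f g : (forall x, f x = g x) -> expect f = expect g.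
Proof. by move=> fg; congr expect; apply/funext. Qed.

Lemma expect_cst (c : R) : expect (fun=> c) = c.
Proof.
rewrite /expect Rintegral_cst//; set m := (X in fine X).
have -> : m = 1%E.
  exact: probability_setT.
by rewrite mulr1.
Qed.

Lemma expectD f g : bounded_measurable f -> bounded_measurable g ->
  expect (fun x => f x + g x) = expect f + expect g.
Proof.
by move=> bf bg; rewrite /expect RintegralD//; exact: bounded_measurable_integrable.
Qed.

Lemma expectZ f (c : R) : bounded_measurable f ->
  expect (fun x => c * f x) = c * expect f.
Proof.
by move=> bf; rewrite /expect RintegralZl//; exact: bounded_measurable_integrable.
Qed.

Lemma expectN f : bounded_measurable f -> expect (fun x => - f x) = - expect f.
Proof.
move=> bf; rewrite -mulN1r -expectZ//; apply: eq_expect => x.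
by rewrite mulN1r.
Qed.

Lemma expectB f g : bounded_measurable f -> bounded_measurable g ->
  expect (fun x => f x - g x) = expect f - expect g.
Proof.
move=> bf bg; rewrite expectD//; first by rewrite expectN.
exact: bounded_measurableN.
Qed.

Lemma expect_le f g : bounded_measurable f -> bounded_measurable g ->
  (forall x, f x <= g x) -> expect f <= expect g.
Proof.
move=> bf bg fg; rewrite /expect le_Rintegral//; try exact: bounded_measurable_integrable.
Qed.

Lemma expect_ge0 f : (forall x, 0 <= f x) -> 0 <= expect f.
Proof. by move=> f0; apply: Rintegral_ge0 => x _; exact: f0. Qed.

Lemma expect_norm_le f (B : R) : bounded_measurable f -> (forall x, `|f x| <= B) ->
  `|expect f| <= B.
Proof.
move=> bf fB; rewrite ler_norml; apply/andP; split.
  rewrite -[leLHS](expect_cst); apply: expect_le => // [|x].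
    exact: bounded_measurable_cst.
  by have := fB x; rewrite ler_norml => /andP[].
rewrite -[leRHS](expect_cst); apply: expect_le => // [|x].
  exact: bounded_measurable_cst.
by have := fB x; rewrite ler_norml => /andP[].
Qed.

Lemma expect_eq0 f : bounded_measurable f -> (forall x, 0 <= f x) ->
  expect f = 0 -> rho [set x | f x != 0] = 0%E.
Proof.
move=> bf f0 Ef0.
have mf : measurable_fun setT (EFin \o f) by apply/measurable_EFinP; exact: bf.1.
have : (\int[rho]_(x in setT) `|(EFin \o f) x| = 0)%E.
  have -> : (\int[rho]_(x in setT) `|(EFin \o f) x| = \int[rho]_(x in setT) (f x)%:E)%E.
    by apply: eq_integral => x _; rewrite /= ger0_norm.
  rewrite -[LHS]fineK; first by rewrite -/(Rintegral rho setT f) -/(expect f) Ef0.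
  exact/integrable_fin_num/bounded_measurable_integrable.
move/(ae_eq_integral_abs rho measurableT mf).
move=> [N [mN N0 hN]]; apply: (subset_measure0 _ mN _ N0).
  have := emeasurable_neq measurableT mf 0%E; rewrite setTI.
  by congr measurable; apply/seteqP; split => x /=; rewrite eqe.
move=> x /= fx; apply: hN => /= /(_ I) [] e; by rewrite e eqxx in fx.
Qed.

Definition cbounded_measurable u :=
  bounded_measurable (fun x => complex.Re (u x)) /\
  bounded_measurable (fun x => complex.Im (u x)).

Definition cexpect u : R[i] :=
  expect (fun x => complex.Re (u x)) +i* expect (fun x => complex.Im (u x)).

Lemma eq_cexpect u v : (forall x, u x = v x) -> cexpect u = cexpect v.
Proof. by move=> uv; congr cexpect; apply/funext. Qed.

Lemma cbounded_measurable_cst (c : R[i]) : cbounded_measurable (fun=> c).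
Proof. by split; exact: bounded_measurable_cst. Qed.

Lemma cbounded_measurable_eq u v : (forall x, u x = v x) ->
  cbounded_measurable u -> cbounded_measurable v.
Proof. by move=> uv; have -> : u = v by apply/funext. Qed.

Lemma cbounded_measurableD u v : cbounded_measurable u -> cbounded_measurable v ->
  cbounded_measurable (fun x => u x + v x).
Proof.
move=> [u1 u2] [v1 v2]; split.
  have := bounded_measurableD u1 v1; congr bounded_measurable.
  by apply/funext => x; rewrite ReD.
have := bounded_measurableD u2 v2; congr bounded_measurable.
by apply/funext => x; rewrite ImD.
Qed.

Lemma cbounded_measurableM u v : cbounded_measurable u -> cbounded_measurable v ->
  cbounded_measurable (fun x => u x * v x).
Proof.
move=> [u1 u2] [v1 v2]; split.
  have := bounded_measurableB (bounded_measurableM u1 v1) (bounded_measurableM u2 v2).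
  by congr bounded_measurable; apply/funext => x; rewrite ReM.
have := bounded_measurableD (bounded_measurableM u1 v2) (bounded_measurableM u2 v1).
by congr bounded_measurable; apply/funext => x; rewrite ImM.
Qed.

Lemma cbounded_measurableZ u (c : R[i]) : cbounded_measurable u ->
  cbounded_measurable (fun x => c * u x).
Proof.
by move=> bu; apply: cbounded_measurableM => //; exact: cbounded_measurable_cst.
Qed.

Lemma cbounded_measurableB u v : cbounded_measurable u -> cbounded_measurable v ->
  cbounded_measurable (fun x => u x - v x).
Proof.
move=> bu bv; apply: cbounded_measurableD => //.
apply: cbounded_measurable_eq (cbounded_measurableZ (-1) bv) => x.
by rewrite mulN1r.
Qed.

Lemma cbounded_measurableX u n : cbounded_measurable u ->
  cbounded_measurable (fun x => u x ^+ n).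
Proof.
move=> bu; elim: n => [|n IH].
  by apply: cbounded_measurable_eq (cbounded_measurable_cst 1) => x; rewrite expr0.
by apply: cbounded_measurable_eq (cbounded_measurableM bu IH) => x; rewrite exprS.
Qed.

Lemma cexpect_cst (c : R[i]) : cexpect (fun=> c) = c.
Proof. by rewrite /cexpect !expect_cst; case: c. Qed.

Lemma cexpectD u v : cbounded_measurable u -> cbounded_measurable v ->
  cexpect (fun x => u x + v x) = cexpect u + cexpect v.
Proof.
move=> [u1 u2] [v1 v2]; rewrite /cexpect.
apply: complex_ext; rewrite /= -expectD//; apply: eq_expect => x.
  exact: ReD.
exact: ImD.
Qed.

Lemma cexpectZ u (c : R[i]) : cbounded_measurable u ->
  cexpect (fun x => c * u x) = c * cexpect u.
Proof.
move=> [u1 u2]; apply: complex_ext.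
  rewrite ReM/= -!expectZ// -expectB; first by apply: eq_expect => x; exact: ReM.
    by apply: bounded_measurableM => //; exact: bounded_measurable_cst.
  by apply: bounded_measurableM => //; exact: bounded_measurable_cst.
rewrite ImM/= -!expectZ// -expectD; first by apply: eq_expect => x; exact: ImM.
  by apply: bounded_measurableM => //; exact: bounded_measurable_cst.
by apply: bounded_measurableM => //; exact: bounded_measurable_cst.
Qed.

Lemma cexpectB u v : cbounded_measurable u -> cbounded_measurable v ->
  cexpect (fun x => u x - v x) = cexpect u - cexpect v.
Proof.
move=> bu bv; rewrite -[- cexpect v]mulN1r -cexpectZ// -cexpectD//.
  by apply: eq_cexpect => x; rewrite mulN1r.
exact: cbounded_measurableZ.
Qed.

(** The factor 2 comes from bounding the real and the imaginary part separately. *)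
Lemma nc_cexpect_le u (B : R) : cbounded_measurable u -> (forall x, nc (u x) <= B) ->
  nc (cexpect u) <= 2 * B.
Proof.
move=> [u1 u2] uB; rewrite (le_trans (nc_le_ReIm _))//.
have e1 : `|complex.Re (cexpect u)| <= B.
  by apply: expect_norm_le => // x; rewrite (le_trans (nc_Re _)).
have e2 : `|complex.Im (cexpect u)| <= B.
  by apply: expect_norm_le => // x; rewrite (le_trans (nc_Im _)).
lra.
Qed.

Lemma cexpect_conj u : cbounded_measurable u ->
  cexpect (fun x => conjc (u x)) = conjc (cexpect u).
Proof.
move=> [u1 u2]; apply: complex_ext => /=.
  by apply: eq_expect => x; case: (u x).
by rewrite -expectN//; apply: eq_expect => x; case: (u x).
Qed.

End BoundedExpectation.

(** * The Cauchy kernel on the cut plane *)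

Section CutPlane.
Context {R : realType}.
Implicit Types (z w h : R[i]) (x : R).

Lemma cut_planeP z : cut_plane z <-> complex.Im z != 0 \/ complex.Re z < 0.
Proof.
rewrite /cut_plane/= lecE /= negb_and -ltNge.
by split => [/orP[->|->]|[->|->]]; rewrite ?orbT//; [left|right].
Qed.

Lemma cut_plane_neq0 z : cut_plane z -> z != 0.
Proof. by move=> cz; apply/eqP => z0; move: cz; rewrite z0 /cut_plane/= lexx. Qed.

Lemma cut_plane_Im z : 0 < complex.Im z -> cut_plane z.
Proof. by move=> z0; apply/cut_planeP; left; rewrite gt_eqF. Qed.

Lemma cut_plane_lt0 z : z < 0 -> cut_plane z.
Proof. by move=> z0; rewrite /cut_plane/= lt_geF. Qed.

Lemma near_cut_plane z : cut_plane z -> \forall w \near nbc z, cut_plane w.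
Proof.
move=> /cut_planeP[Iz|Rz].
  exists `|complex.Im z|; first by rewrite normr_gt0.
  move=> w wz; apply/cut_planeP; left; apply/eqP => Iw.
  have := le_lt_trans (nc_Im _) wz.
  by rewrite ImB Iw sub0r normrN ltxx.
exists (- complex.Re z); first by rewrite oppr_gt0.
move=> w wz; apply/cut_planeP; right.
have := le_lt_trans (nc_Re _) wz; rewrite ReB ltr_norml; lra.
Qed.

Definition cauchy_ker w x : R[i] := (1 - (expR x)%:C * w)^-1.

(** This is [1 / (e^(-x) - w)]. Increments of [cauchy_ker] in [w] factor through it
    ([resolvent]). *)
Definition stieltjes_ker w x : R[i] := (expR x)%:C * cauchy_ker w x.

(** The modulus is at least the distance from 1 to the half-line from 0 through [w], which is 1 when
    [Re w <= 0] and [|Im w| / nc w] otherwise. *)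
Lemma cauchy_den_ge w x : cut_plane w ->
  Num.min 1 (`|complex.Im w| / nc w) <= nc (1 - (expR x)%:C * w) \/
  1 <= nc (1 - (expR x)%:C * w).
Proof.
move=> cw; have w0 : 0 < nc w by rewrite nc_gt0 cut_plane_neq0.
have ex := expR_gt0 x.
have [Rw|Rw] := leP (complex.Re w) 0; [right|left].
  apply: le_trans (nc_Re _); rewrite ReB ReM/= mul0r subr0.
  rewrite ger0_norm; nra.
rewrite ge_min; apply/orP; right; rewrite ler_pdivrMr//.
rewrite -(@ler_pXn2r _ 2)// ?nnegrE ?mulr_ge0 ?nc_ge0// exprMn real_normK ?num_real//.
rewrite !nc2 ReB ImB ReM ImM/= !mul0r !subr0 !addr0 !sub0r.
move: (complex.Re w) (complex.Im w) (expR x) Rw ex => a b t a0 t0.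
have -> : ((1 - t * a) ^+ 2 + (- (t * b)) ^+ 2) * (a ^+ 2 + b ^+ 2) =
  b ^+ 2 + (a - t * (a ^+ 2 + b ^+ 2)) ^+ 2 by ring.
by rewrite lerDl sqr_ge0.
Qed.

Lemma cauchy_den_neq0 w x : cut_plane w -> 1 - (expR x)%:C * w != 0.
Proof.
move=> cw; rewrite -nc_gt0; have w0 : 0 < nc w by rewrite nc_gt0 cut_plane_neq0.
have [Rw|Rw] := leP (complex.Re w) 0.
  apply: (@lt_le_trans _ _ 1) => //; apply: le_trans (nc_Re _).
  rewrite ReB ReM/= mul0r subr0 ger0_norm; have := expR_gt0 x; nra.
have [h|h] := cauchy_den_ge x cw; last exact: lt_le_trans h.
apply: lt_le_trans h; rewrite lt_min ltr01 divr_gt0// normr_gt0.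
by move/cut_planeP : cw => [//|]; rewrite ltNge ltW.
Qed.

Lemma nc_cauchy_ker w : cut_plane w -> exists2 B : R, 0 < B &
  forall x, nc (cauchy_ker w x) <= B.
Proof.
move=> cw; have w0 : 0 < nc w by rewrite nc_gt0 cut_plane_neq0.
have [I0|I0] := eqVneq (complex.Im w) 0.
  exists 1 => // x; rewrite /cauchy_ker ncV invf_le1.
    have Rw : complex.Re w < 0.
      by move/cut_planeP : cw => [|//]; rewrite I0 eqxx.
    apply: le_trans (nc_Re _); rewrite ReB ReM/= mul0r subr0.
    rewrite ger0_norm; have := expR_gt0 x; nra.
  by rewrite nc_gt0 cauchy_den_neq0.
have m0 : 0 < Num.min 1 (`|complex.Im w| / nc w).
  by rewrite lt_min ltr01 divr_gt0// normr_gt0.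
exists (Num.min 1 (`|complex.Im w| / nc w))^-1; first by rewrite invr_gt0.
move=> x; rewrite /cauchy_ker ncV lef_pV2 ?posrE// ?nc_gt0 ?cauchy_den_neq0//.
have [//|] := cauchy_den_ge x cw.
by apply: le_trans; rewrite ge_min lexx.
Qed.

Lemma stieltjes_kerE w x : cut_plane w ->
  stieltjes_ker w x = (cauchy_ker w x - 1) / w.
Proof.
move=> cw; have w0 := cut_plane_neq0 cw; have d0 := cauchy_den_neq0 x cw.
by rewrite /stieltjes_ker /cauchy_ker; field; rewrite d0 w0.
Qed.

Lemma nc_stieltjes_ker w : cut_plane w -> exists2 B : R, 0 < B &
  forall x, nc (stieltjes_ker w x) <= B.
Proof.
move=> cw; have [B B0 hB] := nc_cauchy_ker cw.
have w0 : 0 < nc w by rewrite nc_gt0 cut_plane_neq0.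
exists ((B + 1) / nc w); first by rewrite divr_gt0// addr_gt0.
move=> x; rewrite stieltjes_kerE// ncM ncV ler_pM2r ?invr_gt0//.
by rewrite (le_trans (ncB _ _))// nc1 lerD2r.
Qed.

Lemma resolvent w w' x : cut_plane w -> cut_plane w' ->
  cauchy_ker w' x = cauchy_ker w x + (w' - w) * (stieltjes_ker w x * cauchy_ker w' x).
Proof.
move=> cw cw'; have d0 := cauchy_den_neq0 x cw; have d'0 := cauchy_den_neq0 x cw'.
by rewrite /stieltjes_ker /cauchy_ker; field; rewrite d0 d'0.
Qed.

(** For [nc (w' - w) < 1 / (2 * D)] the resolvent identity bounds the kernel at [w'] by the one at
    [w] plus half of itself, uniformly in [x]. *)
Lemma near_ker_bound w : cut_plane w -> exists2 B : R, 0 < B &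
  \forall w' \near nbc w, cut_plane w' /\ forall x, nc (cauchy_ker w' x) <= B.
Proof.
move=> cw; have [B B0 hB] := nc_cauchy_ker cw.
have [D D0 hD] := nc_stieltjes_ker cw.
exists (2 * B); first by rewrite mulr_gt0.
have D2 : 0 < (2 * D)^-1 by rewrite invr_gt0 mulr_gt0.
apply: filterS (filterI (near_cut_plane cw) (near_nbc_ball w D2)) => w' [cw' hw].
split=> // x.
have h1 : nc (cauchy_ker w' x) <= nc (cauchy_ker w x) +
    nc (w' - w) * (nc (stieltjes_ker w x) * nc (cauchy_ker w' x)).
  by rewrite {1}(resolvent x cw cw') (le_trans (ncD _ _))// !ncM.
have h2 : nc (w' - w) * nc (stieltjes_ker w x) <= 2^-1.
  have -> : 2^-1 = (2 * D)^-1 * D by field; rewrite gt_eqF.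
  by rewrite ler_pM ?nc_ge0// ltW.
have := hB x; have := nc_ge0 (cauchy_ker w' x); rewrite mulrA in h1; nra.
Qed.

Lemma measurable_cauchy_ker w : cut_plane w ->
  measurable_fun setT (fun x => complex.Re (cauchy_ker w x)) /\
  measurable_fun setT (fun x => complex.Im (cauchy_ker w x)).
Proof.
move=> cw.
pose den x := nc (1 - (expR x)%:C * w) ^+ 2.
have denE x : den x = (1 - expR x * complex.Re w) ^+ 2 + (expR x * complex.Im w) ^+ 2.
  by rewrite /den nc2 ReB ImB ReM ImM/= !mul0r subr0 addr0 sub0r sqrrN.
have den0 x : den x != 0.
  by rewrite expf_neq0// nc_eq0 cauchy_den_neq0.
have cden : continuous den.
  move=> x; rewrite (_ : den = fun x => (1 - expR x * complex.Re w) ^+ 2 + (expR x * complex.Im w) ^+ 2); last exact/funext.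
  rewrite /continuous_at; under eq_fun do rewrite !expr2.
  rewrite !expr2.
  have c1 : (expR y * complex.Re w) @[y --> x] --> expR x * complex.Re w.
    by apply: cvgM; [exact: continuous_expR|exact: cvg_cst].
  have c2 : (expR y * complex.Im w) @[y --> x] --> expR x * complex.Im w.
    by apply: cvgM; [exact: continuous_expR|exact: cvg_cst].
  have c3 : (1 - expR y * complex.Re w) @[y --> x] --> 1 - expR x * complex.Re w.
    by apply: cvgB => //; exact: cvg_cst.
  by apply: cvgD; apply: cvgM.
have cinv : continuous (fun x => (den x)^-1).
  by move=> x; apply: cvgV => //; exact: cden.
split.
  apply: continuous_measurable_fun.
  rewrite (_ : (fun x => _) = fun x => (1 - expR x * complex.Re w) * (den x)^-1).
    move=> x; apply: cvgM; last exact: cinv.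
    apply: cvgB; first exact: cvg_cst.
    by apply: cvgM; [exact: continuous_expR|exact: cvg_cst].
  by apply/funext => x; rewrite /cauchy_ker ReV ReB ReM/= mul0r subr0.
apply: continuous_measurable_fun.
rewrite (_ : (fun x => _) = fun x => (expR x * complex.Im w) * (den x)^-1).
  move=> x; apply: cvgM; last exact: cinv.
  by apply: cvgM; [exact: continuous_expR|exact: cvg_cst].
apply/funext => x; rewrite /cauchy_ker ImV ImB ImM/= mul0r addr0 sub0r.
by rewrite opprK.
Qed.

Lemma cbounded_cauchy_ker w : cut_plane w -> cbounded_measurable (cauchy_ker w).
Proof.
move=> cw; have [B B0 hB] := nc_cauchy_ker cw.
have [m1 m2] := measurable_cauchy_ker cw.
by split; split => //; exists B => x; rewrite (le_trans _ (hB x)) ?nc_Re ?nc_Im.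
Qed.

Lemma cbounded_stieltjes_ker w : cut_plane w -> cbounded_measurable (stieltjes_ker w).
Proof.
move=> cw; have := cbounded_measurableZ w^-1 (cbounded_measurableB
  (cbounded_cauchy_ker cw) (cbounded_measurable_cst 1)).
by apply: cbounded_measurable_eq => x; rewrite stieltjes_kerE// mulrC.
Qed.

End CutPlane.

Section MomentTransform.
Context {R : realType} (rho : probability R R).
Implicit Types (z w h : R[i]) (x : R).

(* [divdiff 1 w w'] is the divided difference of [Mtr rho] at [w] and [w'], and
   [divdiff 1 w w] its derivative; the divided difference of [divdiff n w] is
   [divdiff n.+1 w]. *)
Definition divdiff n w w' : R[i] :=
  cexpect rho (fun x => stieltjes_ker w x ^+ n * cauchy_ker w' x).

Lemma cbounded_divdiff n w w' : cut_plane w -> cut_plane w' ->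
  cbounded_measurable (fun x => stieltjes_ker w x ^+ n * cauchy_ker w' x).
Proof.
move=> cw cw'; apply: cbounded_measurableM; last exact: cbounded_cauchy_ker.
exact/cbounded_measurableX/cbounded_stieltjes_ker.
Qed.

Lemma MtrE w : cut_plane w -> Mtr rho w = cexpect rho (cauchy_ker w) - 1.
Proof.
move=> cw; rewrite -[1](cexpect_cst rho) -cexpectB.
- apply: eq_cexpect => x; have d0 := cauchy_den_neq0 x cw.
  by rewrite /cauchy_ker; field.
- exact: cbounded_cauchy_ker.
- exact: cbounded_measurable_cst.
Qed.

Lemma divdiff0 w w' : cut_plane w' -> divdiff 0 w w' = Mtr rho w' + 1.
Proof.
move=> cw'; rewrite MtrE// subrK; apply: eq_cexpect => x.
by rewrite expr0 mul1r.
Qed.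

Lemma divdiffS n w w' : cut_plane w -> cut_plane w' ->
  divdiff n w w' = divdiff n w w + (w' - w) * divdiff n.+1 w w'.
Proof.
move=> cw cw'; have b1 := cbounded_divdiff n cw cw.
have b2 := cbounded_divdiff n.+1 cw cw'.
rewrite /divdiff -(cexpectZ rho (w' - w) b2) -(cexpectD rho b1 (cbounded_measurableZ _ b2)).
by apply: eq_cexpect => x; rewrite {1}(resolvent x cw cw') exprS; ring.
Qed.

Lemma Mtr_divdiff w w' : cut_plane w -> cut_plane w' ->
  Mtr rho w' - Mtr rho w = (w' - w) * divdiff 1 w w'.
Proof.
move=> cw cw'; have := divdiffS 0 cw cw'; rewrite !divdiff0// => h.
by rewrite -(addrK 1 (Mtr rho w')) h; ring.
Qed.

Lemma divdiffC w w' : cut_plane w -> cut_plane w' ->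
  divdiff 1 w w' = divdiff 1 w' w.
Proof.
move=> cw cw'; apply: eq_cexpect => x.
by rewrite !expr1 /stieltjes_ker; ring.
Qed.

Lemma near_divdiff_bounded n w : cut_plane w -> exists2 B : R, 0 < B &
  \forall w' \near nbc w, nc (divdiff n w w') <= B.
Proof.
move=> cw; have [B B0 hB] := near_ker_bound cw.
have [D D0 hD] := nc_stieltjes_ker cw.
exists (2 * (D ^+ n * B)); first by rewrite !mulr_gt0// exprn_gt0.
apply: filterS hB => w' [cw' hw'].
apply: nc_cexpect_le; first exact: cbounded_divdiff.
move=> x; rewrite ncM ncX ler_pM ?exprn_ge0 ?nc_ge0//.
by rewrite lerXn2r ?nnegrE ?nc_ge0// ltW.
Qed.

Lemma tends_divdiff n w : cut_plane w ->
  tends (nbc w) (divdiff n w) (divdiff n w w).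
Proof.
move=> cw; have [B B0 hB] := near_divdiff_bounded n.+1 cw.
apply: (@tends_squeeze _ _ _ _ _ _ (fun w' => nc (w' - w) * B)).
  apply: filterS (filterI hB (near_cut_plane cw)) => w' [h cw'].
  by rewrite (divdiffS n cw cw') addrC addKr ncM ler_wpM2l ?nc_ge0.
move=> e e0; have eB : 0 < e / B by rewrite divr_gt0.
by apply: filterS (near_nbc_ball w eB) => w'; rewrite ltr_pdivlMr.
Qed.

Lemma taylor2_Mtr w : cut_plane w -> taylor2_at (Mtr rho) w (divdiff 1 w w).
Proof.
move=> cw; exists (divdiff 2 w w), (divdiff 2 w); split; first exact: tends_divdiff.
apply: filterS (near_cut_plane cw) => w' cw'.
have := Mtr_divdiff cw cw'; rewrite (divdiffS 1 cw cw') => h.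
by rewrite -(subrK (Mtr rho w) (Mtr rho w')) h; ring.
Qed.

Lemma Mtr_cont w : cut_plane w -> ccont (Mtr rho) w.
Proof. by move=> cw; apply: taylor2_at_cont; exact: taylor2_Mtr. Qed.

Lemma Mtr_expansion n w w' : cut_plane w -> cut_plane w' ->
  Mtr rho w' + 1 = \sum_(k < n) (w' - w) ^+ k * divdiff k w w +
    (w' - w) ^+ n * divdiff n w w'.
Proof.
move=> cw cw'; elim: n => [|n IH].
  by rewrite big_ord0 add0r expr0 mul1r divdiff0.
by rewrite IH big_ord_recr/= (divdiffS n cw cw') exprS; ring.
Qed.

Lemma cauchy_ker_conj w x : cauchy_ker (conjc w) x = conjc (cauchy_ker w x).
Proof.
rewrite /cauchy_ker conjc_inv; congr (_^-1); case: w => a b.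
by apply: complex_ext; rewrite /=; ring.
Qed.

Lemma cut_plane_conj w : cut_plane w -> cut_plane (conjc w).
Proof.
move=> /cut_planeP h; apply/cut_planeP; case: w h => a b /=.
by rewrite oppr_eq0.
Qed.

Lemma Mtr_conj w : cut_plane w -> Mtr rho (conjc w) = conjc (Mtr rho w).
Proof.
move=> cw; rewrite !MtrE//; last exact: cut_plane_conj.
have conjB1 (z : R[i]) : conjc (z - 1) = conjc z - 1.
  by case: z => a b; apply: complex_ext; rewrite /= ?subr0 ?oppr0 ?addr0.
rewrite conjB1 -cexpect_conj; last exact: cbounded_cauchy_ker.
by congr (_ - _); apply: eq_cexpect => x; exact: cauchy_ker_conj.
Qed.

Lemma Im_cauchy_ker w x : complex.Im (cauchy_ker w x) =
  complex.Im w * (expR x * nc (cauchy_ker w x) ^+ 2).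
Proof.
rewrite /cauchy_ker ImV ImB ImM/= ncV exprVn mul0r addr0 sub0r opprK.
by rewrite mulrCA mulrA.
Qed.

End MomentTransform.

Section ComplexDerivative.

Lemma derive1_regular (K : numFieldType) (f : K -> K) (z a : K) :
  (forall e : K, 0 < e -> exists2 d : K, 0 < d & forall h, h != 0 -> `|h| < d ->
     `|a - h^-1 * (f (h + z) - f z)| < e) ->
  derive1 (f : K -> K^o) z = a.
Proof.
move=> H; rewrite /derive1; apply: cvg_lim => //.
apply/cvgrPdist_lt => e /H[d d0 hd].
rewrite near_withinE; apply/nbhs_ballP; exists d => //= h.
by rewrite /ball/= sub0r normrN => hh h0; exact: hd.
Qed.

Lemma derivable_regular_cont (K : numFieldType) (f : K -> K) (z : K) :
  derivable (f : K^o -> K^o) z 1 ->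
  forall e : K, 0 < e -> exists2 d : K, 0 < d & forall w, `|w - z| < d ->
    `|f z - f w| < e.
Proof.
move=> /derivable1_diffP/differentiable_continuous /cvgrPdist_lt H e /H.
move=> /nbhs_ballP[d d0 hd]; exists d => // w wz; apply: hd.
by rewrite /ball/= distrC.
Qed.

Context {R : realType}.

Lemma taylor2_derive1 (f : R[i] -> R[i]) (z a : R[i]) :
  taylor2_at f z a -> derive1 (f : R[i] -> R[i]^o) z = a.
Proof.
move=> [b [r [rb fE]]]; apply: derive1_regular => e e0.
have [er Ee] : exists er : R, e = er%:C.
  by move: e0; case: e => x y; rewrite ltcE /= => /andP[/eqP-> _]; exists x.
move: e0; rewrite Ee ltcR => er0.
have B0 : 0 < nc b + 1 by rewrite ltr_wpDl// nc_ge0.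
have eB : 0 < er / (nc b + 1) by rewrite divr_gt0.
pose proof (tends_near_bounded rb) as rB.
have [d d0 hd] := filterI (filterI fE rB) (near_nbc_ball z eB).
exists d%:C; first by rewrite ltcR.
move=> h h0; rewrite normE ltcR => hh.
have [[E1 E2] E3] := hd (h + z) ltac:(by rewrite addrK).
rewrite addrK in E1 E3.
rewrite normE ltcR E1.
have -> : a - h^-1 * (f z + a * h + r (h + z) * h ^+ 2 - f z) = - (r (h + z) * h).
  by field.
rewrite ncN ncM; move: E3; rewrite ltr_pdivlMr// => E3.
by apply: le_lt_trans E3; rewrite mulrC ler_wpM2l// nc_ge0.
Qed.

Lemma derivable_ccont (f : R[i] -> R[i]) (z : R[i]) :
  derivable (f : R[i]^o -> R[i]^o) z 1 -> ccont f z.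
Proof.
move=> /(@derivable_regular_cont R[i]) H e e0.
have [|d d0 hd] := H e%:C; first by rewrite ltcR.
have [dr Ed] : exists dr : R, d = dr%:C.
  by move: d0; case: (d) => x y; rewrite ltcE /= => /andP[/eqP-> _]; exists x.
exists dr; first by move: d0; rewrite Ed ltcR.
move=> w wz; have := hd w; rewrite Ed !normE !ltcR => /(_ wz).
by rewrite ncBC.
Qed.

End ComplexDerivative.

(** * The variance of the Cauchy kernel *)

Section Variance.
Context {R : realType} (rho : probability R R).
Implicit Types (w : R[i]) (x : R).

Lemma expect_gt0 (f : R -> R) : bounded_measurable f -> (forall x, 0 < f x) ->
  0 < expect rho f.
Proof.
move=> bf f0; rewrite lt_def expect_ge0 ?andbT; last by move=> x; exact: ltW.
apply/eqP => Ef0; have := expect_eq0 bf (fun x => ltW (f0 x)) Ef0.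
have -> : [set x | f x != 0] = setT.
  by apply/seteqP; split => // x _; rewrite /= gt_eqF.
have -> : rho setT = 1%E by exact: probability_setT.
by move=> [/eqP]; rewrite oner_eq0.
Qed.

Definition diffuse := forall x : R, rho [set x] = 0%E.

Lemma exp_no_point_mass_diffuse : exp_no_point_mass rho -> diffuse.
Proof.
move=> h x; have := h (expR x); rewrite /pushforward.
have -> : expR @^-1` [set expR x] = [set x].
  apply/seteqP; split => y /=; last by move=> ->.
  exact: expR_inj.
by [].
Qed.

Lemma expect_gt0_diffuse (f : R -> R) (a b : R) : diffuse ->
  bounded_measurable f -> (forall x, 0 <= f x) ->
  (forall x, f x = 0 -> x = a \/ x = b) -> 0 < expect rho f.
Proof.
move=> na bf f0 fab; rewrite lt_def expect_ge0 // andbT.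
apply/eqP => Ef0; have N0 := expect_eq0 bf f0 Ef0.
have mN : measurable [set x | f x != 0].
  have mf : measurable_fun setT (EFin \o f) by apply/measurable_EFinP; exact: bf.1.
  have := emeasurable_neq measurableT mf 0%E; rewrite setTI.
  by congr measurable; apply/seteqP; split => x /=; rewrite eqe.
have n1 : rho.-negligible [set x | f x != 0] by apply/negligibleP.
have na1 c : rho.-negligible [set c] by apply/negligibleP; [exact: measurable_set1|exact: na].
have nT : rho.-negligible setT.
  apply: negligibleS (negligibleU n1 (negligibleU (na1 a) (na1 b))) => x _ /=.
  have [fx|fx] := eqVneq (f x) 0; last by left.
  by right; exact: fab.
have : rho setT = 0%E by apply: measure_negligible.
have -> : rho setT = 1%E by exact: probability_setT.
by move=> [/eqP]; rewrite oner_eq0.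
Qed.

(* [cauchy_ker w] takes its values on the circle through 0 and 1 from which the
   segment [0, 1] is seen under the angle [arg w]. *)
Lemma cauchy_ker_circle w x : 0 < complex.Im w ->
  nc (cauchy_ker w x) ^+ 2 = complex.Re (cauchy_ker w x) +
    complex.Re w / complex.Im w * complex.Im (cauchy_ker w x).
Proof.
move=> w0; have d0 := cauchy_den_neq0 x (cut_plane_Im w0).
have n0 : nc (1 - (expR x)%:C * w) ^+ 2 != 0 by rewrite expf_neq0// nc_eq0.
rewrite /cauchy_ker ReV ImV ncV exprVn ReB ImB ReM ImM/= !(mul0r, subr0, addr0, sub0r, opprK).
by field; rewrite nc_eq0 d0 gt_eqF.
Qed.

(** Minus the power of the point [V] with respect to the circle of [cauchy_ker_circle]; it is
    positive inside. *)
Definition circle_power w (V : R[i]) : R :=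
  complex.Re V + complex.Re w / complex.Im w * complex.Im V - nc V ^+ 2.

Lemma bounded_nc2 (u : R -> R[i]) : cbounded_measurable u ->
  bounded_measurable (fun x => nc (u x) ^+ 2).
Proof.
move=> [u1 u2]; have := bounded_measurableD (bounded_measurableM u1 u1)
  (bounded_measurableM u2 u2).
by congr bounded_measurable; apply/funext => x; rewrite nc2 !expr2.
Qed.

(** On the circle [nc k ^+ 2] is a linear function of the real and imaginary parts of [k]; the mean
    of [nc k ^+ 2] is therefore that function at the mean [V]. *)
Lemma variance_circle_power w : 0 < complex.Im w ->
  let V := cexpect rho (cauchy_ker w) in
  expect rho (fun x => nc (cauchy_ker w x - V) ^+ 2) = circle_power w V.
Proof.
move=> w0 V; have [b1 b2] := cbounded_cauchy_ker (cut_plane_Im w0).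
pose c := complex.Re w / complex.Im w.
have cc (k : R) f : bounded_measurable f -> bounded_measurable (fun x => k * f x).
  by move=> bf; apply: bounded_measurableM => //; exact: bounded_measurable_cst.
transitivity (expect rho (fun x => (1 - 2 * complex.Re V) * complex.Re (cauchy_ker w x)
   + (c - 2 * complex.Im V) * complex.Im (cauchy_ker w x) + nc V ^+ 2)).
  apply: eq_expect => x; rewrite nc2 ReB ImB.
  have := cauchy_ker_circle x w0; rewrite !nc2 -/c.
  move: (complex.Re _) (complex.Im _) => p q; lra.
have d1 := cc (1 - 2 * complex.Re V) _ b1; have d2 := cc (c - 2 * complex.Im V) _ b2.
rewrite (expectD rho (bounded_measurableD d1 d2) (bounded_measurable_cst _)).
rewrite (expectD rho d1 d2) expect_cst !expectZ//.
rewrite -/(complex.Re V) -/(complex.Im V) /circle_power -/c.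
have -> : expect rho (fun x => complex.Re (cauchy_ker w x)) = complex.Re V by [].
have -> : expect rho (fun x => complex.Im (cauchy_ker w x)) = complex.Im V by [].
by rewrite nc2; ring.
Qed.

Lemma circle_power_ge0 w : 0 < complex.Im w ->
  0 <= circle_power w (Mtr rho w + 1).
Proof.
move=> w0; rewrite MtrE ?subrK; last exact: cut_plane_Im.
by rewrite -variance_circle_power// expect_ge0// => x; rewrite exprn_ge0 ?nc_ge0.
Qed.

Lemma cauchy_ker_inj w : cut_plane w -> injective (cauchy_ker w).
Proof.
move=> cw x y; rewrite /cauchy_ker => /invr_inj /addrI /oppr_inj.
by move=> /(mulIf (cut_plane_neq0 cw)) [] /expR_inj.
Qed.

Lemma circle_power_gt0 w : diffuse -> 0 < complex.Im w ->
  0 < circle_power w (Mtr rho w + 1).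
Proof.
move=> na w0; have cw := cut_plane_Im w0.
rewrite MtrE// subrK -variance_circle_power//.
set V := cexpect _ _.
have bv : cbounded_measurable (fun x => cauchy_ker w x - V).
  apply: cbounded_measurableB; first exact: cbounded_cauchy_ker.
  exact: cbounded_measurable_cst.
have [[a ha]|nx] := pselect (exists a, cauchy_ker w a = V).
  apply: (@expect_gt0_diffuse _ a a) => //; first exact: bounded_nc2.
    by move=> x; rewrite exprn_ge0 ?nc_ge0.
  move=> x /eqP; rewrite expf_eq0/= nc_eq0 subr_eq0 => /eqP vx.
  by left; apply: (cauchy_ker_inj cw); rewrite vx ha.
apply: expect_gt0; first exact: bounded_nc2.
move=> x; rewrite exprn_gt0// nc_gt0 subr_eq0; apply/eqP => vx.
by apply: nx; exists x.
Qed.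

Lemma Im_Mtr_gt0 w : 0 < complex.Im w -> 0 < complex.Im (Mtr rho w).
Proof.
move=> w0; have cw := cut_plane_Im w0.
rewrite MtrE// ImB/= subr0; apply: expect_gt0.
  exact: (cbounded_cauchy_ker cw).2.
move=> x; rewrite Im_cauchy_ker mulr_gt0// mulr_gt0 ?expR_gt0// exprn_gt0//.
by rewrite /cauchy_ker ncV invr_gt0 nc_gt0 cauchy_den_neq0.
Qed.

(* A circle meets a line in at most two points. *)
Lemma cauchy_ker_line w (al be ga : R) : 0 < complex.Im w ->
  (al != 0) || (be != 0) -> exists a b, forall x,
  al * complex.Re (cauchy_ker w x) + be * complex.Im (cauchy_ker w x) = ga ->
  x = a \/ x = b.
Proof.
move=> w0 ab0; have cw := cut_plane_Im w0.
(* Multiplied by [nc (1 - e^x w) ^+ 2], the equation of the line becomes a polynomial equation of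
   degree at most two in [e^x], with coefficients [p0], [p1], [p2]. *)
pose p0 := al - ga; pose p1 := be * complex.Im w - al * complex.Re w + 2 * ga * complex.Re w.
pose p2 := - ga * nc w ^+ 2.
have key x : al * complex.Re (cauchy_ker w x) + be * complex.Im (cauchy_ker w x) = ga ->
    p0 + p1 * expR x + p2 * expR x ^+ 2 = 0.
  have d0 := cauchy_den_neq0 x cw.
  have n0 : nc (1 - (expR x)%:C * w) ^+ 2 != 0 by rewrite expf_neq0// nc_eq0.
  rewrite /cauchy_ker ReV ImV => h.
  have {}h : al * complex.Re (1 - (expR x)%:C * w) - be * complex.Im (1 - (expR x)%:C * w)
      = ga * nc (1 - (expR x)%:C * w) ^+ 2.
    by rewrite -h; field; rewrite nc_eq0.
  move: h; rewrite /p0 /p1 /p2 !nc2 ReB ImB ReM ImM/=; lra.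
have [p20|p20] := eqVneq p2 0.
  have nw : nc w ^+ 2 != 0 by rewrite expf_neq0// nc_eq0 cut_plane_neq0.
  have ga0 : ga = 0 by move: p20 => /eqP; rewrite mulf_eq0 (negbTE nw) orbF oppr_eq0 => /eqP.
  exists (ln (- p0 / p1)), 0 => x /key; rewrite p20 mul0r addr0 => e.
  have [p10|p10] := eqVneq p1 0.
    have al0 : al = 0 by move: e; rewrite p10 mul0r addr0 /p0 ga0 subr0.
    move: p10 ab0; rewrite /p1 al0 ga0 !(mul0r, mulr0, addr0, subr0) eqxx/= => /eqP.
    by rewrite mulf_eq0 (gt_eqF w0) orbF => ->.
  left; have <- : expR x = - p0 / p1.
    by apply: (mulIf p10); rewrite divfK// mulrC; lra.
  by rewrite expRK.
have [[x1 h1]|nx] := pselect (exists x1, p0 + p1 * expR x1 + p2 * expR x1 ^+ 2 = 0).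
  (* The second root is read off from the sum of the roots. *)
  exists x1, (ln (- p1 / p2 - expR x1)) => x /key e.
  have [->|xx] := eqVneq x x1; [by left|right].
  have ex : expR x - expR x1 != 0.
    by rewrite subr_eq0; apply: contraNneq xx => /expR_inj ->.
  have : p1 + p2 * (expR x + expR x1) = 0.
    by apply: (mulIf ex); rewrite mul0r; move: e h1; lra.
  move=> e2; have <- : expR x = - p1 / p2 - expR x1.
    apply: (mulIf p20); rewrite mulrBl divfK//; lra.
  by rewrite expRK.
by exists 0, 0 => x /key e; exfalso; apply: nx; exists x.
Qed.

(** With [k = cauchy_ker w], the derivative of [Mtr rho] at [w] is the mean of [k ^+ 2 - k] divided
    by [w]. When it vanishes, the mean of [(k - V) ^+ 2] is [- V * (V - 1)], while the circle power
    is the mean of [nc (k - V) ^+ 2]. Equality of the moduli would put [k - V] almost surely on one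
    line through 0, which only two values of [x] allow. *)
Lemma critical_circle_power w : diffuse -> 0 < complex.Im w ->
  divdiff rho 1 w w = 0 ->
  nc ((Mtr rho w + 1) * Mtr rho w) < circle_power w (Mtr rho w + 1).
Proof.
move=> na w0 crit; have cw := cut_plane_Im w0; have wn0 := cut_plane_neq0 cw.
have bk := cbounded_cauchy_ker cw.
have Var0 := circle_power_gt0 na w0.
have MV : Mtr rho w + 1 = cexpect rho (cauchy_ker w) by rewrite MtrE// subrK.
have MV1 : Mtr rho w = cexpect rho (cauchy_ker w) - 1 by rewrite MtrE.
move: Var0; rewrite MV MV1 -variance_circle_power//.
set V := cexpect _ _ => Var0.
have bv : cbounded_measurable (fun x => cauchy_ker w x - V).
  by apply: cbounded_measurableB => //; exact: cbounded_measurable_cst.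
have Ev2 : cexpect rho (fun x => cauchy_ker w x ^+ 2) = V.
  have bk2 := cbounded_measurableX 2 bk.
  apply/eqP; rewrite -subr_eq0 -cexpectB//.
  have -> : cexpect rho (fun x => cauchy_ker w x ^+ 2 - cauchy_ker w x) =
      w * divdiff rho 1 w w.
    rewrite /divdiff -(cexpectZ rho w (cbounded_divdiff 1 cw cw)); apply: eq_cexpect => x.
    by rewrite expr1 stieltjes_kerE//; field.
  by rewrite crit mulr0.
have EV2 : cexpect rho (fun x => (cauchy_ker w x - V) ^+ 2) = - (V * (V - 1)).
  have b1 := cbounded_measurableX 2 bk.
  have b2 := cbounded_measurableZ (2 * V) bk.
  transitivity (cexpect rho (fun x => (cauchy_ker w x ^+ 2 - 2 * V * cauchy_ker w x) + V ^+ 2)).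
    by apply: eq_cexpect => x; ring.
  have b3 := cbounded_measurableB b1 b2.
  rewrite (cexpectD rho b3 (cbounded_measurable_cst _)) cexpect_cst.
  by rewrite (cexpectB rho b1 b2) (cexpectZ rho _ bk) Ev2 -/V; ring.
have [->|P0] := eqVneq (V * (V - 1)) 0; first by rewrite nc0.
set P := V * (V - 1) in EV2 P0 *.
pose u := conjc (- P) / (nc P)%:C.
have nP0 : nc P != 0 by rewrite nc_eq0.
have uP : complex.Re (u * - P) = nc P.
  have -> : u * - P = (nc P)%:C.
    rewrite /u mulrAC; apply: (mulIf (x := (nc P)%:C)); first by rewrite -nc_eq0 ncR normr_eq0.
    rewrite divfK; last by rewrite -nc_eq0 ncR normr_eq0.
    by rewrite conj_mul ncN -rmorphM/= -expr2.
  by [].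
have nu : nc u = 1.
  by rewrite /u ncM ncV ncR nc_conj ncN ger0_norm ?nc_ge0// divff.
(* The unit [u] turns [- P] into a positive real and [e ^+ 2 = 1 / u]. Then [g x] is twice the
   square of the imaginary part of [(cauchy_ker w x - V) / e], so it vanishes on a line only. *)
pose e := sqrtc (conjc u).
have e2 : e ^+ 2 = conjc u by exact: sqr_sqrtc.
have e0 : e != 0.
  apply/eqP => e0; have : nc (e ^+ 2) = 1 by rewrite e2 nc_conj.
  by rewrite e0 expr0n/= nc0 => /eqP; rewrite eq_sym oner_eq0.
pose g x := nc (cauchy_ker w x - V) ^+ 2 - complex.Re (u * (cauchy_ker w x - V) ^+ 2).
have bu : cbounded_measurable (fun x => u * (cauchy_ker w x - V) ^+ 2).
  exact/cbounded_measurableZ/cbounded_measurableX.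
have Eg : expect rho g = expect rho (fun x => nc (cauchy_ker w x - V) ^+ 2) - nc P.
  rewrite expectB; [|exact: bounded_nc2|exact: bu.1].
  by rewrite -uP -EV2 -(cexpectZ rho u (cbounded_measurableX 2 bv)).
rewrite -subr_gt0 -Eg.
have [a [b hab]] := @cauchy_ker_line w (- complex.Im e) (complex.Re e)
  (complex.Im (V * conjc e)) w0 ltac:(by rewrite oppr_eq0; case: (e) e0 => p q;
    rewrite /= eq_complex /= negb_and orbC).
apply: (@expect_gt0_diffuse _ a b) => //.
- by apply: bounded_measurableB; [exact: bounded_nc2|exact: bu.1].
- move=> x; rewrite subr_ge0 (le_trans (ler_norm _))// (le_trans (nc_Re _))//.
  by rewrite ncM nu mul1r ncX.
move=> x gx; apply: hab.
set y := cauchy_ker w x - V in gx.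
have ->: - complex.Im e * complex.Re (cauchy_ker w x) + complex.Re e * complex.Im (cauchy_ker w x)
   = complex.Im (cauchy_ker w x * conjc e).
  by case: (e) => p q; rewrite ImM/=; ring.
apply/eqP; rewrite -subr_eq0 -ImB -mulrBl -/y; apply/eqP.
have ue : u * e ^+ 2 = 1.
  rewrite e2; have := nc2 u; rewrite nu expr1n; case: (u) => p q /= h.
  by apply: complex_ext => /=; [lra|ring].
pose t := y / e.
have yE : y = t * e by rewrite /t divfK.
have ne : nc e ^+ 2 = 1 by rewrite -ncX e2 nc_conj.
have t2 : complex.Re (t ^+ 2) = nc t ^+ 2.
  have : g x = 0 by exact: gx.
  rewrite /g -/y yE ncM exprMn ne mulr1 exprMn mulrCA ue mulr1 => /eqP.
  by rewrite subr_eq0 => /eqP.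
have It : complex.Im t = 0.
  by move: t2; rewrite nc2 expr2 ReM; case: (t) => p q /= h; nra.
have -> : y * conjc e = t * (nc e ^+ 2)%:C.
  rewrite yE -mulrA; congr (_ * _); rewrite nc2; case: (e) => p q.
  by apply: complex_ext => /=; ring.
by rewrite ne ImM/= It mulr0 mul0r addr0.
Qed.

End Variance.

(** * Isolation of the critical points *)

Section CriticalPoints.
Context {R : realType} (rho : probability R R).
Implicit Types (w : R[i]) (x : R).

Lemma twice_differentiable_sub (f : R[i] -> R[i]) (w c : R[i]) :
  twice_differentiable f w -> twice_differentiable (fun z => f z - c) w.
Proof.
move=> [a fa]; exists (a - 0); rewrite /taylor2_at.
by apply: taylor2B => //; [exact: tends_subr|exact: taylor2_cst].
Qed.

(** A locally constant value [c] would persist along the horizontal half-line of the points [w - N].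
    There the circle power of [c + 1] is affine in [N] with slope [- Im c / Im w < 0], hence
    eventually negative, against [circle_power_ge0]. *)
Lemma Mtr_not_locally_constant_upper w : 0 < complex.Im w ->
  ~ (\forall w' \near nbc w, Mtr rho w' = Mtr rho w).
Proof.
move=> w0 cst; have I0 := Im_Mtr_gt0 rho w0.
set c := Mtr rho w in cst I0.
have far (N : R) : 0 <= N -> Mtr rho (w - N%:C) = c.
  move=> N0; apply/eqP; rewrite -subr_eq0; apply/eqP.
  have d0 : 0 < complex.Im w / 2 by rewrite divr_gt0.
  apply: (@nbc_singleton _ (w - N%:C) (fun z => Mtr rho z - c = 0)).
  apply: (@vanish_segment _ (fun z => Mtr rho z - c) w (w - N%:C) _ d0).
  - move=> t t01 z [_]; rewrite ImB ImD ImM !ImB ReB/= => hz.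
    have z0 : 0 < complex.Im z by move: hz; rewrite ler_norml; lra.
    have good u : cut_plane u -> twice_differentiable (fun z => Mtr rho z - c) u.
      move=> cu; apply: twice_differentiable_sub.
      by exists (divdiff rho 1 u u); exact: taylor2_Mtr.
    split.
      by apply: tendsB; [apply: Mtr_cont; exact: cut_plane_Im|exact: tends_cst].
    by apply: filterS (near_cut_plane (cut_plane_Im z0)) => u cu _; exact: good.
  - by apply: filterS cst => z ->; rewrite subrr.
pose b := complex.Im w.
have bound (N : R) : 0 <= N -> 0 <= complex.Re (c + 1) + (complex.Re w - N) / b * complex.Im c - nc (c + 1) ^+ 2.
  move=> N0; have IN : 0 < complex.Im (w - N%:C) by rewrite ImB/= subr0.
  have := circle_power_ge0 rho IN.
  by rewrite far// /circle_power ReB !ImB ImD /= !(subr0, addr0).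
pose K := `|complex.Re (c + 1) + complex.Re w / b * complex.Im c| + 1.
have K0 : 0 <= K * b / complex.Im c.
  by rewrite mulr_ge0 ?invr_ge0 ?(ltW I0)// mulr_ge0 ?(ltW w0)// addr_ge0.
have := bound _ K0; have := sqr_ge0 (nc (c + 1)).
have -> : (complex.Re w - K * b / complex.Im c) / b * complex.Im c =
    complex.Re w / b * complex.Im c - K.
  by field; rewrite !gt_eqF.
rewrite /K; have := ler_norm (complex.Re (c + 1) + complex.Re w / b * complex.Im c).
lra.
Qed.

Lemma Mtr_not_locally_constant w : cut_plane w ->
  ~ (\forall w' \near nbc w, Mtr rho w' = Mtr rho w).
Proof.
move=> cw cst; have [w0|w0] := ltP (complex.Im w) 0.
  apply: (@Mtr_not_locally_constant_upper (conjc w)).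
    by case: w w0 {cw cst} => a b /=; rewrite oppr_gt0.
  have [d d0 hd] := filterI cst (near_cut_plane cw).
  exists d => // z hz.
  have h : nc (conjc z - w) < d.
    suff -> : conjc z - w = conjc (z - conjc w) by rewrite nc_conj.
    by case: (z) => ? ?; case: (w) => ? ?; apply: complex_ext => /=; ring.
  have [e1 e2] := hd _ h.
  rewrite (Mtr_conj rho cw) -e1 -Mtr_conj//; congr Mtr.
  by case: (z) => ? ? /=; rewrite opprK.
have [d d0 hd] := nbc_join cst.
pose w1 := w + (d / 2)%:C * 'i.
have h1 : nc (w1 - w) < d.
  rewrite /w1 addrAC subrr add0r ncM ncR gtr0_norm ?divr_gt0//.
  by rewrite ncE/= expr0n expr1n/= add0r sqrtr1 mulr1; lra.
have I1 : 0 < complex.Im w1.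
  by rewrite /w1 ImD ImM/= mulr1 mul0r addr0 ltr_wpDl// divr_gt0.
have cst1 := hd _ h1; have E1 := nbc_singleton cst1.
apply: (Mtr_not_locally_constant_upper I1).
by apply: filterS cst1 => z ->; rewrite E1.
Qed.

(** If all derivatives vanished, only the remainder of [Mtr_expansion] would be left; it decays
    geometrically in [n] when [nc (w' - w) < 1 / (2 * D)], so [Mtr rho] would be locally
    constant. *)
Lemma divdiff_neq0 w : cut_plane w -> exists n, divdiff rho n.+1 w w != 0.
Proof.
move=> cw; apply: contrapT => /forallNP nz.
have {}nz n : divdiff rho n.+1 w w = 0 by apply/eqP/negPn/negP; exact: nz.
apply: (Mtr_not_locally_constant cw).
have [B B0 hB] := near_ker_bound cw; have [D D0 hD] := nc_stieltjes_ker cw.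
have D2 : 0 < (2 * D)^-1 by rewrite invr_gt0 mulr_gt0.
apply: filterS (filterI hB (near_nbc_ball w D2)) => w' [[cw' hw'] hw].
apply/eqP; rewrite -subr_eq0 -nc_eq0 eq_le nc_ge0 andbT leNgt; apply/negP => p0.
have [n hn] : exists n, 2^-1 ^+ n < nc (Mtr rho w' - Mtr rho w) / (2 * B).
  by apply: geometric_small; rewrite ?divr_gt0 ?mulr_gt0// invr_ge0 invf_lt1 ?ltr1n ?ler0n//.
have E : Mtr rho w' - Mtr rho w = (w' - w) ^+ n.+1 * divdiff rho n.+1 w w'.
  have := Mtr_expansion rho n.+1 cw cw'.
  rewrite big_ord_recl big1 => [|i _]; last by rewrite nz mulr0.
  rewrite expr0 mul1r divdiff0// addr0 => h.
  by rewrite -(addrK 1 (Mtr rho w')) h; ring.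
have R1 : nc (divdiff rho n.+1 w w') <= 2 * (D ^+ n.+1 * B).
  apply: nc_cexpect_le; first exact: cbounded_divdiff.
  move=> x; rewrite ncM ncX ler_pM ?exprn_ge0 ?nc_ge0//.
  by rewrite lerXn2r ?nnegrE ?nc_ge0// ltW.
have hD2 : nc (w' - w) * D <= 2^-1.
  have -> : 2^-1 = (2 * D)^-1 * D by field; rewrite gt_eqF.
  by rewrite ler_pM2r// ltW.
have : nc (Mtr rho w' - Mtr rho w) <= 2^-1 ^+ n.+1 * (2 * B).
  rewrite E ncM ncX (le_trans (ler_wpM2l _ R1)) ?exprn_ge0 ?nc_ge0//.
  rewrite mulrCA mulrA mulrA [X in X <= _]mulrC -mulrA -exprMn.
  have : (nc (w' - w) * D) ^+ n.+1 <= 2^-1 ^+ n.+1.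
    by rewrite lerXn2r ?nnegrE ?mulr_ge0 ?nc_ge0 ?invr_ge0 ?(ltW D0).
  by nra.
move: hn; rewrite ltr_pdivlMr ?mulr_gt0// => hn.
have : 0 <= 2^-1 ^+ n :> R by rewrite exprn_ge0// invr_ge0.
rewrite exprS; nra.
Qed.

(** The term-by-term derivative of [Mtr_expansion]. It is an identity between kernels that is then
    integrated, so nothing is differentiated under the integral sign. *)
Lemma derivative_expansion n w w' : cut_plane w -> cut_plane w' ->
  divdiff rho 1 w' w' =
  \sum_(k < n) k.+1%:R * (w' - w) ^+ k * divdiff rho k.+1 w w +
  (w' - w) ^+ n * cexpect rho (fun x => stieltjes_ker w x ^+ n *
     (n.+1%:R - n%:R * (w' - w) * stieltjes_ker w x) *
     (stieltjes_ker w' x * cauchy_ker w' x)).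
Proof.
move=> cw cw'; elim: n => [|n IH].
  rewrite big_ord0 add0r expr0 mul1r; apply: eq_cexpect => x.
  by rewrite expr0 expr1; ring.
rewrite IH big_ord_recr/= -addrA; congr (_ + _).
have bq := cbounded_stieltjes_ker cw.
have b1 := cbounded_divdiff n.+1 cw cw.
have b2 : cbounded_measurable (fun x => stieltjes_ker w x ^+ n.+1 *
     (n.+2%:R - n.+1%:R * (w' - w) * stieltjes_ker w x) *
     (stieltjes_ker w' x * cauchy_ker w' x)).
  apply: cbounded_measurableM; last first.
    by apply: cbounded_measurableM; [exact: cbounded_stieltjes_ker|exact: cbounded_cauchy_ker].
  apply: cbounded_measurableM; first exact: cbounded_measurableX.
  by apply: cbounded_measurableB; [exact: cbounded_measurable_cst|exact: cbounded_measurableZ].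
rewrite -mulrA mulrCA exprSr -!mulrA -mulrDr; congr (_ * _).
rewrite -(cexpectZ rho n.+1%:R b1) -(cexpectZ rho (w' - w) b2).
rewrite -(cexpectD rho (cbounded_measurableZ _ b1) (cbounded_measurableZ _ b2)).
apply: eq_cexpect => x.
have d0 := cauchy_den_neq0 x cw; have d'0 := cauchy_den_neq0 x cw'.
rewrite /stieltjes_ker /cauchy_ker !exprS -![_.+2]addn1 -[n.+1]addn1 !natrD.
set q := ((expR x)%:C / (1 - (expR x)%:C * w)) ^+ n.
by field; rewrite d0 d'0.
Qed.

(* At the first non-vanishing derivative [c_(n+1)] one has
   [M w' - M w ~ c_(n+1) h^(n+1)] and [M' w' ~ (n+1) c_(n+1) h^n]. *)
Lemma critical_points_isolated w : cut_plane w ->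
  \forall w' \near nbc w, w' != w ->
    divdiff rho 1 w' w' != 0 /\ Mtr rho w' != Mtr rho w.
Proof.
move=> cw; have nz := divdiff_neq0 cw.
case: (ex_minnP nz) => n cn minn.
have low k : (k < n)%N -> divdiff rho k.+1 w w = 0.
  by move=> kn; apply/eqP/negPn/negP => /minn; rewrite leqNgt kn.
have [B B0 hB] := near_ker_bound cw; have [D D0 hD] := nc_stieltjes_ker cw.
have [D' D'0 hD'] : exists2 D' : R, 0 < D' & \forall w' \near nbc w,
    forall x, nc (stieltjes_ker w' x) <= D'.
  exists ((B + 1) / (nc w / 2)).
    by rewrite divr_gt0 ?addr_gt0// divr_gt0// nc_gt0 cut_plane_neq0.
  pose proof (tends_near_neq0 (tends_id w) (cut_plane_neq0 cw)) as h.
  apply: filterS (filterI hB h) => w' [[cw' hw'] h' x].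
  rewrite stieltjes_kerE// ncM ncV.
  have w0 : 0 < nc w / 2 by rewrite divr_gt0// nc_gt0 cut_plane_neq0.
  rewrite ler_pM ?nc_ge0 ?invr_ge0 ?nc_ge0//.
    by rewrite (le_trans (ncB _ _))// nc1 lerD2r.
  by rewrite lef_pV2 ?posrE ?(ltW h')//; exact: lt_trans h'.
pose c := nc (divdiff rho n.+1 w w).
have c0 : 0 < c by rewrite nc_gt0.
(* [C] bounds the mean in the remainder of [derivative_expansion] when [nc (w' - w) < 1]; within
   distance [c / (C + 1)] the remainder cannot cancel the leading term. *)
pose C := 2 * (D ^+ n.+1 * (n.+2%:R + n.+1%:R * D) * (D' * B)).
have C0 : 0 < C + 1.
  rewrite ltr_wpDl// /C !mulr_ge0 ?exprn_ge0 ?addr_ge0 ?mulr_ge0 ?ler0n//; exact: ltW.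
have e0 : 0 < c / (C + 1) by rewrite divr_gt0.
pose proof (tends_near_neq0 (tends_divdiff rho n.+1 cw) cn) as hT.
apply: filterS (filterI (filterI hT hD') (filterI hB
  (filterI (near_nbc_ball w ltr01) (near_nbc_ball w e0)))) => w'
  [[hc hq'] [[cw' hv'] [h1 he]]] ww'.
have hw0 : w' - w != 0 by rewrite subr_eq0.
split; last first.
  have := Mtr_expansion rho n.+1 cw cw'.
  rewrite big_ord_recl big1 => [|i _]; last by rewrite /= low// mulr0.
  rewrite expr0 mul1r divdiff0// addr0 => h.
  rewrite -subr_eq0 (_ : _ - _ = (w' - w) ^+ n.+1 * divdiff rho n.+1 w w').
    rewrite mulf_neq0// ?expf_neq0//.
    by rewrite -nc_gt0 (le_lt_trans _ hc)// divr_ge0// ltW.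
  by rewrite -(addrK 1 (Mtr rho w')) h; ring.
rewrite (derivative_expansion n.+1 cw cw') big_ord_recr/= big1 ?add0r => [|i _]; last first.
  by rewrite low// mulr0.
set E := cexpect _ _.
have EC : nc E <= C.
  apply: nc_cexpect_le.
    apply: cbounded_measurableM; last first.
      by apply: cbounded_measurableM; [exact: cbounded_stieltjes_ker|exact: cbounded_cauchy_ker].
    apply: cbounded_measurableM; first exact/cbounded_measurableX/cbounded_stieltjes_ker.
    apply: cbounded_measurableB; first exact: cbounded_measurable_cst.
    exact/cbounded_measurableZ/cbounded_stieltjes_ker.
  move=> x; rewrite (ncM (_ * _)) (ncM (_ ^+ _)) (ncM (stieltjes_ker w' x)) ncX.
  rewrite ler_pM ?mulr_ge0 ?exprn_ge0 ?nc_ge0//; last by rewrite ler_pM ?nc_ge0.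
  rewrite ler_pM ?exprn_ge0 ?nc_ge0//.
    by rewrite lerXn2r ?nnegrE ?nc_ge0// ltW.
  have nn k : nc k%:R = k%:R :> R.
    by rewrite -(rmorph_nat (real_complex R)) ncR ger0_norm.
  rewrite (le_trans (ncB _ _))// nn lerD2l (ncM (_ * _) (stieltjes_ker w x)).
  rewrite (ncM n.+1%:R) nn ler_pM ?mulr_ge0 ?nc_ge0//.
  by rewrite ler_piMr// ltW.
have -> : n.+1%:R * (w' - w) ^+ n * divdiff rho n.+1 w w + (w' - w) ^+ n.+1 * E =
    (w' - w) ^+ n * (n.+1%:R * divdiff rho n.+1 w w + (w' - w) * E).
  by rewrite exprSr; ring.
rewrite mulf_neq0 ?expf_neq0//; apply/eqP => e.
have : nc (n.+1%:R * divdiff rho n.+1 w w) = nc ((w' - w) * E).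
  by rewrite -[RHS]ncN; congr nc; apply/eqP; rewrite -addr_eq0 e.
have nn : nc n.+1%:R = n.+1%:R :> R.
  by rewrite -(rmorph_nat (real_complex R)) ncR ger0_norm.
rewrite !ncM nn -/c => e2.
have : nc (w' - w) * nc E < c.
  move: he; rewrite ltr_pdivlMr// => he.
  have := nc_ge0 (w' - w); nra.
rewrite -e2 ltNge => /negP; apply.
by rewrite ler_peMl ?(ltW c0)// ler1n.
Qed.

End CriticalPoints.

(** * Boundary values of the moment transform *)

Section Density.
Context d (T : measurableType d) {R : realType} (rho : probability T R).
Context (mu : {sigma_finite_measure set T -> \bar R}) (p : T -> R).
Hypothesis rho_p : [/\ measurable_fun setT p, forall x, 0 <= p x &
  forall A : set T, measurable A -> rho A = (\int[mu]_(x in A) (p x)%:E)%E].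

Lemma density_integrable : mu.-integrable setT (EFin \o p).
Proof.
case: rho_p => mp p0 rhoE; apply/integrableP; split; first exact/measurable_EFinP.
have -> : (\int[mu]_(x in setT) `|(EFin \o p) x| = \int[mu]_(x in setT) (p x)%:E)%E.
  by apply: eq_integral => x _; rewrite /= ger0_norm.
rewrite -rhoE//; exact: (le_lt_trans (probability_le1 rho measurableT) (ltry 1)).
Qed.

Lemma density_dominates : rho `<< mu.
Proof.
case: rho_p => mp p0 rhoE; apply/null_content_dominatesP => A mA A0.
rewrite rhoE//; apply: null_set_integral => //.
by apply/measurable_EFinP; exact: measurable_funTS.
Qed.

(** The Radon-Nikodym derivative of [rho] and [p] have the same integral [rho A] over every
    measurable [A], so they agree almost everywhere. *)
Lemma ge0_density_integral (E : set T) (f : T -> \bar R) : measurable E ->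
  (forall x, 0 <= f x)%E -> measurable_fun E f ->
  (\int[rho]_(x in E) f x = \int[mu]_(x in E) (f x * (p x)%:E))%E.
Proof.
move=> mE f0 mf.
rewrite -(Radon_Nikodym_SigmaFinite.change_of_variables density_dominates)//.
set g := Radon_Nikodym_SigmaFinite.f rho mu.
have ig : mu.-integrable setT g by exact: Radon_Nikodym_SigmaFinite.f_integrable density_dominates.
have gp : ae_eq mu E g (EFin \o p).
  apply: integral_ae_eq => //.
  - exact: integrableS ig.
  - by apply/measurable_EFinP; apply: measurable_funTS; case: rho_p.
  - move=> A AE mA; rewrite -Radon_Nikodym_SigmaFinite.f_integral//; last exact: density_dominates.
    by case: rho_p => _ _; exact.
apply: ae_eq_integral => //.
- apply: emeasurable_funM => //; apply: measurable_funTS; exact: measurable_int ig.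
- apply: emeasurable_funM => //; apply/measurable_EFinP; apply: measurable_funTS.
  by case: rho_p.
- exact: ae_eqe_mul2l.
Qed.

Lemma bounded_density_integrable (E : set T) (f : T -> R) (B : R) : measurable E ->
  measurable_fun setT f -> (forall x, `|f x| <= B) ->
  mu.-integrable E (EFin \o (fun x => f x * p x)).
Proof.
move=> mE mf fB; case: (rho_p) => mp p0 _.
apply: (@le_integrable _ _ _ mu E mE _ (EFin \o (fun x => B * p x))).
- by apply/measurable_EFinP; apply: measurable_funTS; exact: measurable_funM.
- move=> x _ /=; have B0 : 0 <= B by apply: le_trans (fB x).
  rewrite lee_fin normrM [leRHS]ger0_norm ?mulr_ge0//.
  by rewrite (ger0_norm (p0 x)) ler_wpM2r.
- apply: (integrableS measurableT) => //.
  rewrite (_ : _ \o _ = (fun x => B%:E * (EFin \o p) x)%E); last exact/funext.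
  exact: integrableZl density_integrable.
Qed.

Lemma density_Rintegral (E : set T) (f : T -> R) (B : R) : measurable E ->
  measurable_fun setT f -> (forall x, `|f x| <= B) ->
  \int[rho]_(x in E) f x = \int[mu]_(x in E) (f x * p x).
Proof.
move=> mE mf fB.
have mp : measurable_fun setT p by case: rho_p.
have pos (g : T -> R) : measurable_fun setT g -> (forall x, 0 <= g x) ->
    \int[rho]_(x in E) g x = \int[mu]_(x in E) (g x * p x).
  move=> mg g0; rewrite /Rintegral ge0_density_integral//.
  by apply/measurable_EFinP; exact: measurable_funTS.
have irho (g : T -> R) (D : R) : measurable_fun setT g -> (forall x, `|g x| <= D) ->
    rho.-integrable E (EFin \o g).
  move=> mg gD; apply: (integrableS measurableT) => //.
  apply: measurable_bounded_integrable => //.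
    exact: (le_lt_trans (probability_le1 rho measurableT) (ltry 1)).
  exists D; split; first exact: num_real.
  by move=> M BM x _ /=; rewrite (le_trans (gD x))// ltW.
have mB : measurable_fun setT (fun _ : T => B) by exact: measurable_cst.
have nB (x : T) : `|B| <= `|B| by [].
have B0 (x : T) : 0 <= B by apply: le_trans (fB x).
(* Adding the bound [B] reduces a signed integrand to two nonnegative ones. *)
have E1 : \int[rho]_(x in E) (f x + B) = \int[mu]_(x in E) ((f x + B) * p x).
  apply: pos; first exact: measurable_funD.
  by move=> x; rewrite -lerBlDr sub0r; have := fB x; rewrite ler_norml => /andP[].
have E2 := pos _ mB B0.
move: E1; rewrite RintegralD//; [|exact: irho mf fB|exact: irho mB nB].
have -> : \int[mu]_(x in E) ((f x + B) * p x) = \int[mu]_(x in E) (f x * p x + B * p x).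
  by apply: eq_Rintegral => x _; rewrite mulrDl.
rewrite RintegralD//; last 2 first.
- exact: bounded_density_integrable mE mf fB.
- exact: bounded_density_integrable mE mB nB.
by rewrite E2 => /addIr.
Qed.

End Density.

Section DensityReal.
Context {R : realType} (rho : probability R R) (p : R -> R).
Hypothesis rho_p : has_density rho p.
Local Notation mu := (@lebesgue_measure R).

(* The library has two measurable structures on the reals, that of [rho] and
   [measurableTypeR R], which carries the Lebesgue measure; they have the same
   measurable sets, and the identity transports one to the other. *)
Let idR (x : R) : measurableTypeR R := x.

Let measurable_idR : measurable_fun setT idR.
Proof. by move=> _ A mA; rewrite setTI. Qed.

Let idX : {mfun R >-> measurableTypeR R} :=
  HB.pack idR (isMeasurableFun.Build _ _ _ _ _ measurable_idR).

Let rho' : probability (measurableTypeR R) R := distribution rho idX.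

Lemma has_density_Rintegral (E : set R) (f : R -> R) : measurable E ->
  bounded_measurable f ->
  \int[rho]_(x in E) f x = \int[mu]_(x in E) (f x * p x).
Proof.
move=> mE [mf [B fB]].
rewrite -(@density_Rintegral _ (measurableTypeR R) R rho' mu p rho_p E f B mE mf fB).
rewrite /Rintegral; congr fine; apply: esym.
have mf' : @measurable_fun _ _ (measurableTypeR R) _ setT (EFin \o f).
  by apply/measurable_EFinP.
have bf' : rho.-integrable setT ((EFin \o f) \o idR).
  by apply: bounded_measurable_integrable; split => //; exists B.
apply: (@integral_pushforward _ _ R (measurableTypeR R) R idR measurable_idR rho E (EFin \o f) mf') => //.
exact: integrableS bf'.
Qed.

End DensityReal.

(** * The kernels in the logarithmic coordinate *)

Section ElementaryBounds.
Context {R : realType}.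
Implicit Types (x y u c e : R).

Lemma sin_ler x : 0 <= x -> `|sin x| <= x.
Proof.
rewrite le_eqVlt => /predU1P[<-|x0]; first by rewrite sin0 normr0.
have [|y _] := @MVT R sin cos 0 x x0 (fun z _ => is_derive_sin z).
  by apply: continuous_subspaceT => z; exact: continuous_sin.
rewrite sin0 !subr0 => ->; rewrite normrM (gtr0_norm x0) ler_piMl ?(ltW x0)//.
exact: cos_max.
Qed.

Lemma cos_ger x : 0 <= x -> 1 - x ^+ 2 / 2 <= cos x.
Proof.
move=> x0; have x2 : 0 <= x / 2 by rewrite divr_ge0.
have := sin_ler x2; have -> : cos x = 1 - 2 * sin (x / 2) ^+ 2.
  rewrite [in LHS](splitr x) cosD -!expr2 -[cos (x / 2) ^+ 2](addrK (sin (x / 2) ^+ 2)).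
  by rewrite cos2Dsin2; ring.
move=> h; have : sin (x / 2) ^+ 2 <= (x / 2) ^+ 2.
  by rewrite -real_normK ?num_real// lerXn2r ?nnegrE.
by rewrite expr_div_n; nra.
Qed.

Lemma atan_ler x : 0 < x -> atan x <= x.
Proof.
move=> x0; have [|y _] := @MVT R (@atan R) (fun z => (1 + z ^+ 2)^-1) 0 x x0
  (fun z _ => is_derive1_atan z).
  by apply: continuous_subspaceT => z; exact: continuous_atan.
rewrite atan0 !subr0 => ->; rewrite ler_piMl ?(ltW x0)// invf_le1.
  by rewrite lerDl sqr_ge0.
by rewrite ltr_wpDr// sqr_ge0.
Qed.

Lemma atan_gt0 x : 0 < x -> 0 < atan x.
Proof. by move=> x0; rewrite -(atan0 R) lt_atan. Qed.

Lemma atanV x : 0 < x -> atan x = pi / 2 - atan x^-1.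
Proof.
move=> x0; have xi0 : 0 < x^-1 by rewrite invr_gt0.
have a1 := atan_gt0 x0; have a2 := atan_gt0 xi0.
have b1 := atan_ltpi2 x; have b2 := atan_ltpi2 x^-1.
have sinE y : sin (atan y) = y * cos (atan y).
  have t : sin (atan y) / cos (atan y) = y by exact: atanK.
  rewrite -{2}t divfK//.
  by rewrite cos_atan invr_neq0// gt_eqF// sqrtr_gt0 ltr_wpDr// sqr_ge0.
have c0 : cos (atan x + atan x^-1) = 0.
  by rewrite cosD !sinE; field; rewrite gt_eqF.
have p2 := pi_gt0 R.
suff : atan x + atan x^-1 = pi / 2 by move=> h; lra.
apply: cos_inj; rewrite ?in_itv/= ?c0 ?cos_pihalf//; lra.
Qed.

Lemma atan_ger x : 0 < x -> pi / 2 - x^-1 <= atan x.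
Proof.
move=> x0; rewrite [leRHS]atanV// lerD2l lerN2 atan_ler// invr_gt0.
exact: x0.
Qed.

(** For [c = cos e] this is the squared modulus of [1 - e^(u + i e)]. With [u = xi - t], the kernel
    [cauchy_ker (cexp_mt t e) xi] has real part [(1 - odd_ker (cos e) u) / 2] and imaginary part
    [poisson_ker e u] ([cauchy_ker_cexp]). At [c = 1] the function [odd_ker] is [coth (u / 2)], the
    kernel of the principal value. *)
Definition ker_den c u : R := expR u ^+ 2 - 2 * c * expR u + 1.

Definition odd_ker c u : R := (expR u ^+ 2 - 1) / ker_den c u.

Definition poisson_ker e u : R := expR u * sin e / ker_den (cos e) u.

(** This is [|coth (u / 2)| <= 1 + 2 / |u|]; both sides are even in [u], and for [u >= 0] it amounts
    to [e^u >= 1 + u]. *)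
Lemma expR_mean u : `|u| * (expR u + 1) <= (2 + `|u|) * `|expR u - 1|.
Proof.
wlog u0 : u / 0 <= u => [H|].
  have [/H//|u0] := leP 0 u.
  have := H (- u); rewrite oppr_ge0 (ltW u0) => /(_ isT).
  rewrite normrN expRN => h.
  have e0 := expR_gt0 u.
  rewrite -(ler_pM2r (x := (expR u)^-1)) ?invr_gt0//.
  have -> : (2 + `|u|) * `|expR u - 1| / expR u = (2 + `|u|) * `|(expR u)^-1 - 1|.
    have -> : (expR u)^-1 - 1 = - ((expR u - 1) / expR u) by field; rewrite gt_eqF.
    by rewrite normrN normrM (gtr0_norm (x := (expR u)^-1)) ?invr_gt0// mulrA.
  apply: le_trans h; rewrite -mulrA ler_wpM2l//.
  by rewrite mulrDl divff ?gt_eqF// mul1r addrC.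
rewrite (ger0_norm u0); have := expR_ge1Dx u => h.
rewrite ger0_norm ?subr_ge0; nra.
Qed.

(* [(e^u - 1)^2 / e^u = 4 sinh^2 (u / 2) >= u^2 / (1 + |u| / 2)^2] *)
Lemma expR_sub1_sqr u : 4 * u ^+ 2 * expR u <= (2 + `|u|) ^+ 2 * (expR u - 1) ^+ 2.
Proof.
have e0 := expR_gt0 u.
have : (`|u| * (expR u + 1)) ^+ 2 <= ((2 + `|u|) * `|expR u - 1|) ^+ 2.
  by rewrite lerXn2r ?nnegrE ?mulr_ge0 ?addr_ge0 ?(ltW e0)//; exact: expR_mean.
rewrite !exprMn !real_normK ?num_real//; apply: le_trans.
rewrite mulrAC mulrC [leRHS]mulrC.
have : 4 * expR u <= (expR u + 1) ^+ 2 by have := sqr_ge0 (expR u - 1); lra.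
by have := sqr_ge0 u; nra.
Qed.

Lemma ker_denE c u : ker_den c u = (expR u - 1) ^+ 2 + 2 * expR u * (1 - c).
Proof. by rewrite /ker_den; ring. Qed.

Lemma ker_den_gt0 c u : -1 < c < 1 -> 0 < ker_den c u.
Proof.
move=> /andP[c1 c2]; rewrite ker_denE; have := expR_gt0 u.
by have := sqr_ge0 (expR u - 1); nra.
Qed.

Lemma expR_neq1 u : u != 0 -> expR u - 1 != 0.
Proof.
by move=> u0; rewrite subr_eq0 -expR0; apply: contraNneq u0 => /expR_inj ->.
Qed.

Lemma odd_ker1_norm u : u != 0 -> `|u| * `|odd_ker 1 u| <= 2 + `|u|.
Proof.
move=> u0; have e1 := expR_neq1 u0; have e0 := expR_gt0 u.
have -> : odd_ker 1 u = (expR u + 1) / (expR u - 1).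
  by rewrite /odd_ker ker_denE subrr mulr0 addr0; field.
rewrite normrM normfV mulrA ler_pdivrMr ?normr_gt0//.
by rewrite (gtr0_norm (x := expR u + 1)) ?addr_gt0// expR_mean.
Qed.

Lemma odd_ker_diff c u : u != 0 -> -1 < c < 1 ->
  `|u| * `|odd_ker c u - odd_ker 1 u| <=
    (2 + `|u|) * (2 * expR u * (1 - c) / ker_den c u).
Proof.
move=> u0 c1; have e1 := expR_neq1 u0; have e0 := expR_gt0 u.
have d0 := ker_den_gt0 u c1.
have -> : odd_ker c u - odd_ker 1 u =
    - (odd_ker 1 u * (2 * expR u * (1 - c) / ker_den c u)).
  rewrite /odd_ker (_ : ker_den 1 u = (expR u - 1) ^+ 2); last by rewrite ker_denE; ring.
  have -> : 2 * expR u * (1 - c) = ker_den c u - (expR u - 1) ^+ 2.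
    by rewrite ker_denE; ring.
  by field; rewrite e1 gt_eqF.
have q0 : 0 <= 2 * expR u * (1 - c) / ker_den c u.
  by move/andP: c1 => [? ?]; rewrite divr_ge0 ?(ltW d0)// !mulr_ge0 ?(ltW e0)//; lra.
rewrite normrN normrM (ger0_norm q0) mulrA ler_wpM2r//.
exact: odd_ker1_norm.
Qed.

Lemma ker_ratio_le1 c u : -1 < c < 1 ->
  2 * expR u * (1 - c) / ker_den c u <= 1.
Proof.
move=> c1; rewrite ler_pdivrMr ?ker_den_gt0// mul1r ker_denE lerDr.
exact: sqr_ge0.
Qed.

Lemma ker_inv_den c u : u != 0 -> -1 < c < 1 ->
  expR u / ker_den c u <= (2 + `|u|) ^+ 2 / (4 * u ^+ 2).
Proof.
move=> u0 c1; have u2 : 0 < 4 * u ^+ 2 by rewrite mulr_gt0// lt_def sqrf_eq0 u0 sqr_ge0.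
have e0 := expR_gt0 u.
rewrite ler_pdivrMr ?ker_den_gt0// mulrAC ler_pdivlMr// mulrC.
apply: (le_trans (expR_sub1_sqr u)); rewrite ler_wpM2l ?sqr_ge0// ker_denE lerDl.
by move/andP: c1 => [? ?]; nra.
Qed.

Lemma ker_ratio_le c e u : u != 0 -> -1 < c < 1 -> 1 - c <= e ^+ 2 / 2 ->
  2 * expR u * (1 - c) / ker_den c u <= e ^+ 2 * ((2 + `|u|) ^+ 2 / (4 * u ^+ 2)).
Proof.
move=> u0 c1 ce; have h := ker_inv_den u0 c1.
have e0 := expR_gt0 u; have d0 := ker_den_gt0 u c1.
have -> : 2 * expR u * (1 - c) / ker_den c u = (2 * (1 - c)) * (expR u / ker_den c u).
  by field; rewrite gt_eqF.
have q0 : 0 <= expR u / ker_den c u by rewrite divr_ge0// ltW.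
move/andP: c1 => [? ?].
by apply: ler_pM => //; lra.
Qed.

(** The first bound serves away from [u = 0]. The second does not involve [e]: it follows from the
    inequality between the arithmetic and geometric means of the two terms of [ker_denE]. *)
Lemma poisson_ker_le e u : u != 0 -> 0 < e < 1 ->
  `|poisson_ker e u| <= e * ((2 + `|u|) ^+ 2 / (4 * u ^+ 2)) /\
  `|u| * `|poisson_ker e u| <= (2 + `|u|) / 2.
Proof.
move=> u0 /andP[e0 e1].
have ce := cos_ger (ltW e0).
have se := sin_ler (ltW e0).
have sc := cos2Dsin2 e.
have s0 : 0 < sin e by rewrite sin_gt0_pi// e0/=; have := pi_ge2 R; lra.
have c1 : -1 < cos e < 1.
  apply/andP; split; first nra.
  by rewrite ltNge; apply/negP => ?; nra.
have d0 := ker_den_gt0 u c1; have x0 := expR_gt0 u.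
have q0 : 0 <= expR u / ker_den (cos e) u by rewrite divr_ge0// ltW.
have PE : `|poisson_ker e u| = sin e * (expR u / ker_den (cos e) u).
  by rewrite /poisson_ker mulrAC mulrC ger0_norm// mulr_ge0// ltW.
split.
  rewrite PE; apply: ler_pM => //; first exact: ltW.
    by rewrite (gtr0_norm s0) in se.
  exact: ker_inv_den.
have p0 : 0 <= `|u| * `|poisson_ker e u| by rewrite mulr_ge0.
have q1 : 0 <= (2 + `|u|) / 2 by rewrite divr_ge0// addr_ge0.
rewrite -(@ler_pXn2r _ 2)// ?nnegrE// exprMn real_normK ?num_real// PE.
have -> : u ^+ 2 * (sin e * (expR u / ker_den (cos e) u)) ^+ 2 =
    u ^+ 2 * expR u * (sin e ^+ 2 * expR u) / ker_den (cos e) u ^+ 2.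
  by field; rewrite gt_eqF.
rewrite ler_pdivrMr ?exprn_gt0//.
have h := expR_sub1_sqr u.
have AG : 8 * expR u * (1 - cos e) * (expR u - 1) ^+ 2 <= ker_den (cos e) u ^+ 2.
  rewrite ker_denE; set A := (expR u - 1) ^+ 2; set B := 2 * expR u * (1 - cos e).
  by rewrite /B; have := sqr_ge0 (A - B); rewrite /B; lra.
have s2 : sin e ^+ 2 <= 2 * (1 - cos e).
  by move/andP: c1 => [? ?]; nra.
have E : ((2 + `|u|) / 2) ^+ 2 = (2 + `|u|) ^+ 2 / 4 by field.
rewrite E.
set U := u ^+ 2; set W := (2 + `|u|) ^+ 2; set x := expR u; set A := (expR u - 1) ^+ 2.
have U0 : 0 <= U by exact: sqr_ge0.
have W0 : 0 <= W by exact: sqr_ge0.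
have h' : 4 * U * x <= W * A by exact: h.
have AG' : 8 * x * (1 - cos e) * A <= ker_den (cos e) u ^+ 2 by exact: AG.
have c2 : 0 <= 1 - cos e by move/andP: c1 => [_ ?]; lra.
have x0' : 0 < x by exact: x0.
apply: (@le_trans _ _ (U * x * (2 * (1 - cos e) * x))).
  have Ux : 0 <= U * x by rewrite mulr_ge0// ltW.
  apply: (ler_wpM2l Ux); apply: ler_wpM2r => //; exact: ltW.
apply: (@le_trans _ _ (W * A / 4 * (2 * (1 - cos e) * x))).
  by rewrite ler_wpM2r ?mulr_ge0 ?(ltW x0')//; lra.
apply: (@le_trans _ _ (W / 4 * (8 * x * (1 - cos e) * A))).
  have : 0 <= W * A * (1 - cos e) * x.
    apply: mulr_ge0; last exact: ltW.
    by apply: mulr_ge0 => //; apply: mulr_ge0 => //; exact: sqr_ge0.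
  lra.
by rewrite ler_wpM2l ?divr_ge0.
Qed.

End ElementaryBounds.

Section LebesgueIntervals.
Context {R : realType}.
Local Notation mu := (@lebesgue_measure R).
Implicit Types (t r : R).

(** An expression of the inverse, valid at 0 as well, in terms of functions that are measurable on
    the whole line. *)
Lemma powR_invE (x : R) : x^-1 = x * (`|x| `^ (-1)) ^+ 2.
Proof.
have [->|x0] := eqVneq x 0; first by rewrite invr0 mul0r.
rewrite powRN powRr1// exprVn real_normK ?num_real//.
by field.
Qed.

Lemma measurable_invr (f : R -> R) : measurable_fun setT f ->
  measurable_fun setT (fun x => (f x)^-1).
Proof.
move=> mf; rewrite (_ : (fun x => _) = fun x => f x * (`|f x| `^ (-1)) ^+ 2); last first.
  by apply/funext => x; rewrite -powR_invE.
apply: measurable_funM => //; apply: measurable_funX.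
apply: (measurableT_comp (measurable_powR _)).
exact: (measurableT_comp (@normr_measurable R setT)).
Qed.

Definition cball t r : set R := `[t - r, t + r]%classic.

Lemma cballE t r x : cball t r x <-> `|x - t| <= r.
Proof. by rewrite /cball/= in_itv/= ler_norml; split => [/andP[]|/andP[]]; lra. Qed.

Lemma measurable_cball t r : measurable (cball t r).
Proof. exact: measurable_itv. Qed.

Lemma lebesgue_cball t r : 0 <= r -> mu (cball t r) = (2 * r)%:E.
Proof.
move=> r0; rewrite lebesgue_measure_itv/= lte_fin.
by case: ifPn => [_|]; [rewrite -EFinB; congr EFin; ring|rewrite -leNgt => ?;
  congr EFin; lra].
Qed.

Lemma lebesgue_cball_lty t r : 0 <= r -> (mu (cball t r) < +oo)%E.
Proof. by move=> r0; rewrite lebesgue_cball// ltry. Qed.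

Lemma bounded_cball_integrable t r (f : R -> R) (B : R) : 0 <= r ->
  measurable_fun setT f -> (forall x, cball t r x -> `|f x| <= B) ->
  mu.-integrable (cball t r) (EFin \o f).
Proof.
move=> r0 mf fB; apply: measurable_bounded_integrable.
- exact: measurable_cball.
- exact: lebesgue_cball_lty.
- exact: measurable_funS mf.
exists B; split; first exact: num_real.
by move=> M BM x /fB /= h; rewrite (le_trans h)// ltW.
Qed.

(** A step majorant on three concentric intervals, used with the radii [tau ^+ 2], [tau] and [r]. *)
Lemma Rintegral_zones t r (f : R -> R) (a b c ra rb : R) : 0 <= r ->
  measurable_fun setT f -> 0 <= a -> 0 <= b -> 0 <= c -> 0 <= ra -> 0 <= rb ->
  (forall x, cball t r x ->
     `|f x| <= a * \1_(cball t ra) x + b * \1_(cball t rb) x + c) ->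
  `|\int[mu]_(x in cball t r) f x| <= a * (2 * ra) + b * (2 * rb) + c * (2 * r).
Proof.
move=> r0 mf a0 b0 c0 ra0 rb0 fle.
have m1 q : measurable_fun setT (\1_(cball t q) : R -> R).
  by apply: measurable_indic; exact: measurable_cball.
have i1 q (k : R) : mu.-integrable (cball t r) (EFin \o (fun x => k * \1_(cball t q) x)).
  apply: (@bounded_cball_integrable _ _ _ `|k|) => //.
    by apply: measurable_funM => //; exact: measurable_cst.
  move=> x _; rewrite normrM ler_piMr// indicE.
  by case: (x \in _); rewrite ?normr1// normr0.
have ic : mu.-integrable (cball t r) (EFin \o (fun=> c)).
  by apply: (@bounded_cball_integrable _ _ _ `|c|) => //; exact: measurable_cst.
have b1 q x : `|\1_(cball t q) x : R| <= 1.
  by rewrite indicE; case: (x \in _); rewrite ?normr1// normr0.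
have b1' q x : 0 <= (\1_(cball t q) x : R) <= 1.
  by rewrite indicE; case: (x \in _); rewrite ?lexx ler01.
have fi : mu.-integrable (cball t r) (EFin \o f).
  apply: (@bounded_cball_integrable _ _ _ (a + b + c)) => // x /fle h.
  have := b1' ra x; have := b1' rb x => /andP[p1 p2] /andP[p3 p4].
  rewrite (le_trans h)// lerD2r lerD// ler_piMr//.
have iabs : mu.-integrable (cball t r) (EFin \o (fun x => `|f x|)).
  exact: (integrable_norm fi).
have J q : 0 <= q -> \int[mu]_(x in cball t r) (\1_(cball t q) x : R) <= 2 * q.
  move=> q0; rewrite /Rintegral integral_indic; [|exact: measurable_cball..].
  rewrite -[leRHS]/(fine (2 * q)%:E) -(lebesgue_cball t q0) fine_le//.
  - rewrite ge0_fin_numE//; apply: (@le_lt_trans _ _ (mu (cball t q))).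
      by apply: le_measure; rewrite ?inE; [apply: measurableI; exact: measurable_cball|
        exact: measurable_cball|exact: subIsetl].
    exact: lebesgue_cball_lty.
  - by have := lebesgue_cball_lty t q0; rewrite ge0_fin_numE.
  - by apply: le_measure; rewrite ?inE; [apply: measurableI; exact: measurable_cball|
        exact: measurable_cball|exact: subIsetl].
rewrite (le_trans (le_normr_Rintegral _ fi))//; first exact: measurable_cball.
have mcb : @measurable _ (measurableTypeR R) (cball t r) by exact: measurable_cball.
have iab := integrableD mcb (i1 ra a) (i1 rb b).
have iabc := integrableD mcb iab ic.
have E1 : \int[mu]_(x in cball t r) `|f x| <=
    \int[mu]_(x in cball t r) (a * \1_(cball t ra) x + b * \1_(cball t rb) x + c).
  exact: (le_Rintegral mcb iabs iabc).
apply: (le_trans E1).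
rewrite (RintegralD mcb iab ic) (RintegralD mcb (i1 ra a) (i1 rb b)).
have i2 q : mu.-integrable (cball t r) (EFin \o (\1_(cball t q) : R -> R)).
  by have := i1 q 1; congr integrable; apply/funext => x /=; rewrite mul1r.
rewrite (RintegralZl a mcb (i2 ra)) (RintegralZl b mcb (i2 rb)) (Rintegral_cst mu mcb).
have -> : fine (mu (cball t r)) = 2 * r by exact: (congr1 fine (lebesgue_cball t r0)).
by rewrite lerD2r lerD// ler_wpM2l// J.
Qed.

(** By uniqueness it suffices to look at half-open intervals; the reflection exchanges their open
    and closed ends, which does not affect the length. *)
Lemma lebesgue_measure_reflect t (A : set R) : measurable A ->
  pushforward mu (fun x : measurableTypeR R => (2 * t - x : measurableTypeR R)) A = mu A.
Proof.
have mphi : measurable_fun setT (fun x : measurableTypeR R => (2 * t - x : measurableTypeR R)).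
  by apply: measurable_funB => //; exact: measurable_cst.
pose phi : {mfun measurableTypeR R >-> measurableTypeR R} :=
  HB.pack (fun x : measurableTypeR R => (2 * t - x : measurableTypeR R))
    (isMeasurableFun.Build _ _ _ _ _ mphi).
move=> mA.
apply/esym/(@lebesgue_measure_unique R (pushforward mu phi)) => //= _ [[a b]] _ <-.
rewrite /pushforward.
have -> : (fun x : R => 2 * t - x) @^-1` `]a, b]%classic = `[2 * t - b, 2 * t - a[%classic.
  by apply/seteqP; split => x /=; rewrite !in_itv/=; lra.
by rewrite !lebesgue_measure_itv/= !lte_fin; do 2 case: ifPn => ?; rewrite -?EFinB;
  try (congr EFin); lra.
Qed.

Lemma Rintegral_odd t r (f : R -> R) (B : R) : 0 <= r -> measurable_fun setT f ->
  (forall x, cball t r x -> `|f x| <= B) -> (forall x, f (2 * t - x) = - f x) ->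
  \int[mu]_(x in cball t r) f x = 0.
Proof.
move=> r0 mf fB fodd.
have fi := bounded_cball_integrable r0 mf fB.
have mphi : measurable_fun setT (fun x : measurableTypeR R => (2 * t - x : measurableTypeR R)).
  by apply: measurable_funB => //; exact: measurable_cst.
have pre : (fun x : R => 2 * t - x) @^-1` (cball t r) = cball t r.
  by apply/seteqP; split => x /=; rewrite /cball/= !in_itv/=; lra.
have ffi : mu.-integrable (cball t r) (EFin \o (fun x => - f x)).
  exact: (integrableN fi).
suff : \int[mu]_(x in cball t r) f x = - \int[mu]_(x in cball t r) f x by lra.
rewrite -[RHS]mulN1r -RintegralZl//; last exact: measurable_cball.
have -> : \int[mu]_(x in cball t r) (-1 * f x) = \int[mu]_(x in cball t r) f (2 * t - x).
  by apply: eq_Rintegral => x _; rewrite fodd mulN1r.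
rewrite /Rintegral; congr fine.
have mef : @measurable_fun _ _ (measurableTypeR R) _ setT (EFin \o f).
  by apply/measurable_EFinP.
have fphi : mu.-integrable ((fun x : measurableTypeR R => (2 * t - x : measurableTypeR R)) @^-1` (cball t r))
    ((EFin \o f) \o (fun x : measurableTypeR R => (2 * t - x : measurableTypeR R))).
  rewrite [X in integrable _ X _]pre.
  by move: ffi; congr integrable; apply/funext => x /=; rewrite fodd.
have := @integral_pushforward _ _ _ _ R _ mphi mu (cball t r) (EFin \o f) mef fphi
   (measurable_cball t r).
move=> H; rewrite -[in RHS]pre; apply: etrans H.
apply: eq_measure_integral => A mA _.
by first [exact (lebesgue_measure_reflect t mA)|exact (esym (lebesgue_measure_reflect t mA))].
Qed.

End LebesgueIntervals.

Section Plemelj.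
Context {R : realType} (rho : probability R R) (p : R -> R).
Hypothesis rho_p : has_density rho p.
Local Notation mu := (@lebesgue_measure R).
Implicit Types (t r L e tau xi : R).

Lemma measurable_odd_ker c t : measurable_fun setT (fun xi => odd_ker c (xi - t)).
Proof.
have me : measurable_fun setT (fun xi : R => expR (xi - t)).
  apply: (measurableT_comp (@measurable_expR R)).
  by apply: measurable_funB => //; exact: measurable_cst.
have me2 : measurable_fun setT (fun xi : R => expR (xi - t) ^+ 2) by exact: measurable_funX.
apply: measurable_funM; first by apply: measurable_funB => //; exact: measurable_cst.
apply: measurable_invr; apply: measurable_funD; last exact: measurable_cst.
by apply: measurable_funB => //; apply: measurable_funM => //; exact: measurable_cst.
Qed.

Lemma measurable_poisson_ker e t : measurable_fun setT (fun xi => poisson_ker e (xi - t)).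
Proof.
have me : measurable_fun setT (fun xi : R => expR (xi - t)).
  apply: (measurableT_comp (@measurable_expR R)).
  by apply: measurable_funB => //; exact: measurable_cst.
have me2 : measurable_fun setT (fun xi : R => expR (xi - t) ^+ 2) by exact: measurable_funX.
apply: measurable_funM; first by apply: measurable_funM => //; exact: measurable_cst.
apply: measurable_invr; apply: measurable_funD; last exact: measurable_cst.
by apply: measurable_funB => //; apply: measurable_funM => //; exact: measurable_cst.
Qed.

Lemma cexp_mt_mul t e xi : (expR xi)%:C * cexp_mt t e =
  (expR (xi - t) * cos e) +i* (expR (xi - t) * sin e).
Proof.
rewrite /cexp_mt mulrA -rmorphM/= -expRD.
by apply: complex_ext; rewrite ?ReM ?ImM/= mul0r ?subr0 ?addr0.
Qed.

Lemma Im_cexp_mt t e : 0 < e < pi -> 0 < complex.Im (cexp_mt t e).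
Proof.
move=> h; rewrite /cexp_mt ImM/= mul0r addr0.
by rewrite mulr_gt0 ?expR_gt0// sin_gt0_pi.
Qed.

Lemma cos_bounds e : 0 < e < 1 -> -1 < cos e < 1.
Proof.
move=> /andP[e0 e1]; have ce := cos_ger (ltW e0); have sc := cos2Dsin2 e.
have s0 : 0 < sin e by rewrite sin_gt0_pi// e0/=; have := pi_ge2 R; lra.
apply/andP; split; first by nra.
by rewrite ltNge; apply/negP => ?; nra.
Qed.

Lemma cauchy_ker_cexp t e xi : 0 < e < 1 -> let u := xi - t in
  cauchy_ker (cexp_mt t e) xi =
    (2^-1 - 2^-1 * odd_ker (cos e) u) +i* poisson_ker e u.
Proof.
move=> e01 u; have d0 := ker_den_gt0 u (cos_bounds e01).
have DE : nc (1 - (expR xi)%:C * cexp_mt t e) ^+ 2 = ker_den (cos e) u.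
  rewrite nc2 cexp_mt_mul ReB ImB/= -/u /ker_den.
  have -> : (0 - expR u * sin e) ^+ 2 = expR u ^+ 2 * (1 - cos e ^+ 2).
    by rewrite -(cos2Dsin2 e); ring.
  by ring.
rewrite /cauchy_ker; apply: complex_ext.
  rewrite ReV DE cexp_mt_mul ReB/= -/u /odd_ker.
  have : 1 - expR u * cos e = 2^-1 * (ker_den (cos e) u - (expR u ^+ 2 - 1)).
    by rewrite /ker_den; field.
  by move=> ->; field; rewrite gt_eqF.
rewrite ImV DE cexp_mt_mul ImB/= -/u /poisson_ker.
by rewrite sub0r opprK.
Qed.

Lemma far_le t r (f : R -> R) (B : R) : 0 <= B -> measurable_fun setT f ->
  (forall xi, ~ cball t r xi -> `|f xi| <= B) ->
  `|\int[rho]_(x in ~` cball t r) f x| <= B.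
Proof.
move=> B0 mf fB.
have mF : measurable (~` cball t r) by apply: measurableC; exact: measurable_cball.
have fin : (rho (~` cball t r) < +oo)%E.
  exact: (le_lt_trans (probability_le1 rho mF) (ltry 1)).
have fi : rho.-integrable (~` cball t r) (EFin \o f).
  apply: measurable_bounded_integrable => //; first exact: measurable_funS mf.
  exists B; split; first exact: num_real.
  by move=> M BM x /fB /= h; rewrite (le_trans h)// ltW.
have ci : rho.-integrable (~` cball t r) (EFin \o (fun=> B)).
  apply: measurable_bounded_integrable => //.
  exists B; split; first exact: num_real.
  by move=> M BM x _ /=; rewrite ger0_norm// ltW.
rewrite (le_trans (le_normr_Rintegral mF fi))//.
apply: (le_trans (le_Rintegral mF (integrable_norm fi) ci _)).
  by move=> x /fB.
rewrite (Rintegral_cst rho mF) ler_piMr//.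
apply: (@fine_le _ _ 1%E) => //; last exact: probability_le1.
by rewrite ge0_fin_numE.
Qed.

(** Near [t] the density is split as [(p x - p t) + p t]: the first part compensates the singularity
    of the kernel, and against the constant the kernel is integrated exactly, by oddness or by a
    primitive. *)
Lemma near_far_split t r (k : R -> R) : 0 <= r -> bounded_measurable k ->
  (exists D, forall xi, cball t r xi -> `|p xi| <= D) ->
  expect rho k = \int[rho]_(x in ~` cball t r) k x +
    \int[mu]_(x in cball t r) (k x * (p x - p t)) +
    p t * \int[mu]_(x in cball t r) k x.
Proof.
move=> r0 bk [D pD].
have mN := measurable_cball t r.
have mN' : @measurable _ (measurableTypeR R) (cball t r) by exact: mN.
have mF : measurable (~` cball t r) by apply: measurableC.
have [mk [B kB]] := bk; have mp : measurable_fun setT p by case: rho_p.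
have kN : mu.-integrable (cball t r) (EFin \o k).
  by apply: (bounded_cball_integrable r0 mk (B := B)) => x _; exact: kB.
have kpN : mu.-integrable (cball t r) (EFin \o (fun x => k x * (p x - p t))).
  apply: (@bounded_cball_integrable _ _ _ _ (B * (D + `|p t|)) r0).
    by apply: measurable_funM => //; apply: measurable_funB => //; exact: measurable_cst.
  move=> x Nx; rewrite normrM ler_pM//.
  by rewrite (le_trans (ler_normB _ _))// lerD2r pD.
have -> : expect rho k = \int[rho]_(x in cball t r) k x +
    \int[rho]_(x in ~` cball t r) k x.
  rewrite /expect -(setUv (cball t r)) Rintegral_setU//.
  - by rewrite setUv; exact: bounded_measurable_integrable.
  - by rewrite disj_set2E setICr.
rewrite (has_density_Rintegral rho_p mN bk).
have -> : \int[mu]_(x in cball t r) (k x * p x) =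
    \int[mu]_(x in cball t r) (k x * (p x - p t) + p t * k x).
  by apply: eq_Rintegral => x _; ring.
rewrite RintegralD//; first by rewrite RintegralZl//; ring.
have := integrableZl mN' (p t) kN; congr integrable.
Qed.

End Plemelj.

Section PoissonIntegral.
Context {R : realType}.
Local Notation mu := (@lebesgue_measure R).
Implicit Types (t r e u x : R).

Lemma sin_gt0_small e : 0 < e < 1 -> 0 < sin e.
Proof. by move=> /andP[e0 e1]; rewrite sin_gt0_pi// e0/=; have := pi_ge2 R; lra. Qed.

Let prim e t x := atan ((sin e)^-1 * (expR (x - t) - cos e)).

Let is_derive_prim e t x : 0 < e < 1 ->
  is_derive x 1 (prim e t) (poisson_ker e (x - t)).
Proof.
move=> e01; have s0 := sin_gt0_small e01.
pose g y := (sin e)^-1 * (expR (y - t) - cos e) : R.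
have dg : is_derive x 1 g ((sin e)^-1 * expR (x - t)).
  have d1 : is_derive x 1 (fun y : R => y - t) 1.
    by apply: is_derive_eq; rewrite subr0.
  have d2 := @is_derive1_comp _ expR (fun y => y - t) x _ _ (is_derive_expR (x - t)) d1.
  rewrite mulr1 in d2.
  have d3 := is_deriveB d2 (is_derive_cst (cos e) x 1).
  rewrite subr0 in d3.
  exact (is_deriveZ (sin e)^-1 d3).
have := @is_derive1_comp _ (@atan R) g x _ _ (is_derive1_atan (g x)) dg.
congr (is_derive _ _ _ _).
rewrite /poisson_ker /ker_den /g.
have d0 := ker_den_gt0 (x - t) (cos_bounds e01).
have E : sin e ^+ 2 = 1 - cos e ^+ 2 by rewrite -(cos2Dsin2 e); ring.
have n0 : sin e ^+ 2 + (expR (x - t) - cos e) ^+ 2 = ker_den (cos e) (x - t).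
  by rewrite E /ker_den; ring.
have -> : (1 + ((sin e)^-1 * (expR (x - t) - cos e)) ^+ 2)^-1 =
    sin e ^+ 2 / ker_den (cos e) (x - t).
  rewrite -n0; field; rewrite n0 gt_eqF//= gt_eqF//.
rewrite -/(ker_den (cos e) (x - t)); field.
by rewrite !gt_eqF.
Qed.

Lemma Rintegral_poisson_ker e t r : 0 < e < 1 -> 0 < r ->
  \int[mu]_(x in cball t r) poisson_ker e (x - t) = prim e t (t + r) - prim e t (t - r).
Proof.
move=> e01 r0.
have dp x : derivable (prim e t) x 1 by have [] := is_derive_prim t x e01.
have cp x : {for x, continuous (prim e t)}.
  by apply/differentiable_continuous/derivable1_diffP.
have ab : t - r < t + r by lra.
rewrite /Rintegral /cball (@continuous_FTC2 _ _ (prim e t))//.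
- apply: continuous_subspaceT => x.
  have c0 : ker_den (cos e) (x - t) != 0 by rewrite gt_eqF// ker_den_gt0// cos_bounds.
  have ce : (expR (y - t) @[y --> x]) --> expR (x - t).
    apply: continuous_comp; last exact: continuous_expR.
    by apply: cvgB; [exact: cvg_id|exact: cvg_cst].
  apply: cvgM; first by apply: cvgM => //; exact: cvg_cst.
  apply: cvgV => //; apply: cvgD; last exact: cvg_cst.
  apply: cvgB; first by rewrite expr2; apply: cvgM.
  by apply: cvgM => //; exact: cvg_cst.
- split => [x _|//|//].
  + exact: dp.
  + exact/cvg_at_right_filter/cp.
  + exact/cvg_at_left_filter/cp.
by move=> x _; rewrite derive1E; have [_ ->] := is_derive_prim t x e01.
Qed.

(** The primitive rises from about [- pi / 2] to about [pi / 2]. The errors at the two ends are at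
    most [e / r] on the right and [4 * e / r] on the left. *)
Lemma Rintegral_poisson_near_pi e t r : 0 < e < 1 -> 0 < r -> r <= 1 -> e <= r / 4 ->
  `|\int[mu]_(x in cball t r) poisson_ker e (x - t) - pi| <= 5 * e / r.
Proof.
move=> e01 r0 r1 er; have s0 := sin_gt0_small e01; have /andP[e0 e1] := e01.
rewrite Rintegral_poisson_ker// /prim.
have -> : t + r - t = r by ring.
have -> : t - r - t = - r by ring.
have se : sin e <= e by have := sin_ler (ltW e0); rewrite gtr0_norm.
have ce := cos_ger (ltW e0).
have /ler_normlP[_ c1] := cos_max e.
have b1 : r / sin e <= (sin e)^-1 * (expR r - cos e).
  by rewrite mulrC ler_pM2l ?invr_gt0//; have := expR_ge1Dx r; lra.
have er1 : expR (- r) <= 1 - r / 2.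
  have x0 := expR_gt0 (- r); have x1 := expR_ge1Dx r.
  have : expR (- r) * expR r = 1 by rewrite -expRD addNr expR0.
  by move: (expR (- r)) (expR r) x0 x1 => x y x0 x1 xy; nra.
have b2 : r / 4 / sin e <= (sin e)^-1 * (cos e - expR (- r)).
  by rewrite mulrC ler_pM2l ?invr_gt0//; nra.
have -> : atan ((sin e)^-1 * (expR (- r) - cos e)) =
    - atan ((sin e)^-1 * (cos e - expR (- r))).
  by rewrite -atanN; congr atan; ring.
set X := (sin e)^-1 * (expR r - _) in b1 *.
set Y := (sin e)^-1 * (cos e - _) in b2 *.
have q1 : 0 < r / sin e by rewrite divr_gt0.
have q2 : 0 < r / 4 / sin e by rewrite divr_gt0// divr_gt0.
have h1 := atan_ger (lt_le_trans q1 b1); have h2 := atan_ger (lt_le_trans q2 b2).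
have h3 := atan_ltpi2 X; have h4 := atan_ltpi2 Y.
have i1 : X^-1 <= e / r.
  apply: (@le_trans _ _ (sin e / r)); last by rewrite ler_pM2r ?invr_gt0.
  by rewrite -[sin e / r]invrK invf_div lef_pV2 ?posrE// (lt_le_trans q1).
have i2 : Y^-1 <= 4 * e / r.
  apply: (@le_trans _ _ (4 * sin e / r)); last by rewrite ler_pM2r ?invr_gt0// ler_pM2l.
  have -> : 4 * sin e / r = (r / 4 / sin e)^-1 by field; rewrite !gt_eqF.
  by rewrite lef_pV2 ?posrE// (lt_le_trans q2).
by rewrite ler_norml; apply/andP; split; lra.
Qed.

End PoissonIntegral.

(** * Plemelj formulas with a rate *)

Section PlemeljEstimates.
Context {R : realType} (rho : probability R R) (p : R -> R).
Hypothesis rho_p : has_density rho p.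
Local Notation mu := (@lebesgue_measure R).
Context (t r L : R).
Implicit Types (u xi tau e q d c : R).
Hypotheses (r0 : 0 < r) (r1 : r <= 1) (L0 : 0 <= L).
Hypothesis lip : forall xi, cball t r xi -> `|p xi - p t| <= L * `|xi - t|.

Let p_ge0 x : 0 <= p x. Proof. by case: rho_p. Qed.
Let mp : measurable_fun setT p. Proof. by case: rho_p. Qed.
Let mpt : measurable_fun setT (fun x => p x - p t).
Proof. by apply: measurable_funB => //; exact: measurable_cst. Qed.

Let near_bound : exists D, forall xi, cball t r xi -> `|p xi| <= D.
Proof.
exists (L + p t) => xi Nxi; have h := lip Nxi.
have u1 : `|xi - t| <= 1 by apply: le_trans r1; apply/cballE.
have := ler_normD (p xi - p t) (p t); rewrite subrK (ger0_norm (p_ge0 t)).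
by move/le_trans; apply; rewrite lerD2r (le_trans h)// ler_piMr.
Qed.

(** The value of [(2 + |u|) / |u|] at [|u| = r], which bounds it for larger [|u|]. *)
Let K := 2 / r + 1.
Let K0 : 1 <= K. Proof. by rewrite /K lerDr divr_ge0// ltW. Qed.

Let K00 : 0 <= K. Proof. exact: le_trans ler01 K0. Qed.

Let far_ratio u : r <= `|u| -> (2 + `|u|) / `|u| <= K.
Proof.
move=> ru; have u0 : 0 < `|u| by exact: lt_le_trans ru.
rewrite /K mulrDl divff ?gt_eqF// lerD2r ler_wpM2l// lef_pV2// posrE.
Qed.

Let far_ratio2 u : r <= `|u| -> (2 + `|u|) ^+ 2 / (4 * u ^+ 2) <= K ^+ 2 / 4.
Proof.
move=> ru; have u0 : 0 < `|u| by exact: lt_le_trans ru.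
have -> : (2 + `|u|) ^+ 2 / (4 * u ^+ 2) = ((2 + `|u|) / `|u|) ^+ 2 / 4.
  by rewrite -(real_normK (num_real u)); field; rewrite gt_eqF.
have q0 : 0 <= (2 + `|u|) / `|u| by rewrite divr_ge0// addr_ge0.
by rewrite ler_pM2r ?invr_gt0// lerXn2r ?nnegrE//; exact: far_ratio.
Qed.

Let near_ratio2 u d : 0 < d -> d <= `|u| -> `|u| <= 1 ->
  (2 + `|u|) ^+ 2 / (4 * u ^+ 2) <= 9 / 4 / d ^+ 2.
Proof.
move=> d0 du u1; have u0 : 0 < `|u| by exact: lt_le_trans du.
rewrite -(real_normK (num_real u)) -[9 / 4 / d ^+ 2]mulrA -invfM.
rewrite ler_pM ?sqr_ge0 ?invr_ge0 ?mulr_ge0 ?sqr_ge0//; first by nra.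
rewrite lef_pV2 ?posrE ?mulr_gt0 ?exprn_gt0// ler_pM2l//.
by rewrite lerXn2r ?nnegrE ?(ltW d0).
Qed.

Let cball_indic q xi : (\1_(cball t q) xi : R) = (`|xi - t| <= q)%R%:R.
Proof.
rewrite indicE; congr (_%:R); congr nat_of_bool; apply/idP/idP.
  by move=> /set_mem/cballE.
by move=> /cballE/mem_set.
Qed.

(* The value of the principal value integral, with the singularity cancelled
   by the Lipschitz condition. *)
Definition pv_value : R := - 2^-1 - 2^-1 *
  (\int[rho]_(x in ~` cball t r) odd_ker 1 (x - t) +
   \int[mu]_(x in cball t r) (odd_ker 1 (x - t) * (p x - p t))).

Let m1 := measurable_odd_ker 1 t.

Let odd_ker0 c : odd_ker c 0 = 0.
Proof. by rewrite /odd_ker expR0 expr1n subrr mul0r. Qed.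

Let odd_ker1_near xi : cball t r xi -> `|odd_ker 1 (xi - t) * (p xi - p t)| <= 3 * L.
Proof.
move=> Nxi; have u1 : `|xi - t| <= 1 by apply: le_trans r1; apply/cballE.
rewrite normrM; have h := lip Nxi.
have [e|u0] := eqVneq (xi - t) 0.
  by rewrite e odd_ker0 normr0 mul0r mulr_ge0.
have h2 := odd_ker1_norm u0.
rewrite (le_trans (ler_wpM2l (normr_ge0 _) h))// mulrCA mulrC ler_wpM2r//.
by rewrite mulrC (le_trans h2)//; lra.
Qed.

Let odd_ker1_far xi : ~ cball t r xi -> `|odd_ker 1 (xi - t)| <= K.
Proof.
move=> Nxi; have ru : r < `|xi - t|.
  by rewrite ltNge; apply/negP => h; apply: Nxi; apply/cballE.
have u0 : xi - t != 0 by rewrite -normr_gt0 (lt_trans r0).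
have := odd_ker1_norm u0; have := far_ratio (ltW ru).
rewrite ler_pdivrMr ?normr_gt0// => h1 h2.
by rewrite -(ler_pM2l (x := `|xi - t|)) ?normr_gt0// (le_trans h2)// mulrC.
Qed.

Let odd_kerN c u : odd_ker c (- u) = - odd_ker c u.
Proof.
rewrite /odd_ker /ker_den expRN; have e0 := expR_gt0 u.
set x := expR u; have x0 : x != 0 by rewrite gt_eqF.
have -> : x^-1 ^+ 2 - 2 * c * x^-1 + 1 = (x ^+ 2 - 2 * c * x + 1) / x ^+ 2 by field.
have -> : x^-1 ^+ 2 - 1 = - (x ^+ 2 - 1) / x ^+ 2 by field.
have [->|d0] := eqVneq (x ^+ 2 - 2 * c * x + 1) 0.
  by rewrite !mul0r !invr0 !mulr0 oppr0.
by field; rewrite d0 x0.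
Qed.

Lemma odd_ker_bound c u : -1 < c < 1 -> `|odd_ker c u| <= 2 / (1 - c) + 3.
Proof.
move=> c1; have d0 := ker_den_gt0 u c1; have x0 := expR_gt0 u.
have /andP[c2 c3] := c1.
have c4 : 0 < 1 - c by lra.
rewrite /odd_ker normrM normfV (gtr0_norm d0) ler_pdivrMr//.
have -> : (2 / (1 - c) + 3) * ker_den c u =
   2 * ker_den c u / (1 - c) + 3 * ker_den c u by field; rewrite gt_eqF.
rewrite [in X in _ <= X + _]ker_denE.
have -> : 2 * ((expR u - 1) ^+ 2 + 2 * expR u * (1 - c)) / (1 - c) =
   2 * (expR u - 1) ^+ 2 / (1 - c) + 4 * expR u by field; rewrite gt_eqF.
have : 0 <= 2 * (expR u - 1) ^+ 2 / (1 - c).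
  by rewrite divr_ge0 ?(ltW c4)// mulr_ge0// sqr_ge0.
have : (expR u - 1) ^+ 2 <= ker_den c u.
  by rewrite ker_denE lerDl !mulr_ge0 ?(ltW x0) ?(ltW c4).
rewrite ler_norml; move: (expR u) x0 => x x0 h1 h2.
by apply/andP; split; nra.
Qed.

(** At height [e = tau ^+ 3] the difference of the kernels, multiplied by the increment of [p], is
    bounded for [|xi - t| <= tau ^+ 2], and beyond it is of order [e ^+ 2 / tau ^+ 4 = tau ^+ 2].
    The rate [e^(2/3)] so obtained is enough, since its square is [o(e)]. *)
Lemma Re_Mtr_estimate tau : 0 < tau -> tau ^+ 3 <= r / 4 ->
  `|complex.Re (Mtr rho (cexp_mt t (tau ^+ 3))) - pv_value| <=
     (K ^+ 3 + 20 * L) * tau ^+ 2.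
Proof.
move=> tau0 taur; set e := tau ^+ 3.
have e0 : 0 < e by rewrite exprn_gt0.
have e1 : e < 1 by move: taur r1; rewrite -/e; lra.
have e01 : 0 < e < 1 by rewrite e0.
have tau1 : tau < 1.
  by rewrite ltNge; apply/negP => h; move: e1; rewrite ltNge exprn_ege1.
have c1 := cos_bounds e01; have ce := cos_ger (ltW e0).
have ce' : 1 - cos e <= e ^+ 2 / 2 by lra.
have mc := measurable_odd_ker (cos e) t.
have cw : cut_plane (cexp_mt t e).
  by apply/cut_plane_Im/Im_cexp_mt; rewrite e0/=; have := pi_ge2 R; lra.
have bS : bounded_measurable (fun xi => odd_ker (cos e) (xi - t)).
  by split => //; exists (2 / (1 - cos e) + 3) => x; exact: odd_ker_bound.
have -> : complex.Re (Mtr rho (cexp_mt t e)) =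
    - 2^-1 - 2^-1 * expect rho (fun xi => odd_ker (cos e) (xi - t)).
  rewrite MtrE// ReB.
  have -> : complex.Re (cexpect rho (cauchy_ker (cexp_mt t e))) =
      expect rho (fun x => 2^-1 - 2^-1 * odd_ker (cos e) (x - t)).
    by apply: eq_expect => x; rewrite cauchy_ker_cexp.
  rewrite (expectB rho (bounded_measurable_cst _)); last first.
    by apply: bounded_measurableM => //; exact: bounded_measurable_cst.
  by rewrite expect_cst (expectZ rho _ bS)/=; field.
rewrite (near_far_split rho_p (ltW r0) bS near_bound).
rewrite (@Rintegral_odd _ t r _ (2 / (1 - cos e) + 3) (ltW r0) mc); last 2 first.
- by move=> x _; exact: odd_ker_bound.
- by move=> x; rewrite -odd_kerN; congr odd_ker; ring.
rewrite mulr0 addr0 /pv_value.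
set F1 := \int[rho]_(x in _) _; set N1 := \int[mu]_(x in _) _.
set F2 := \int[rho]_(x in _) odd_ker 1 _; set N2 := \int[mu]_(x in _) (odd_ker 1 _ * _).
have mF : measurable (~` cball t r) by apply: measurableC; exact: measurable_cball.
have mN' : @measurable _ (measurableTypeR R) (cball t r) by exact: measurable_cball.
have HF : `|F1 - F2| <= K ^+ 3 * tau ^+ 2.
  have iF (f : R -> R) (B : R) : measurable_fun setT f ->
      (forall xi, ~ cball t r xi -> `|f xi| <= B) ->
      rho.-integrable (~` cball t r) (EFin \o f).
    move=> mf fB; apply: measurable_bounded_integrable => //.
    - exact: (le_lt_trans (probability_le1 rho mF) (ltry 1)).
    - exact: measurable_funS mf.
    exists B; split; first exact: num_real.
    by move=> M BM x /fB /= h; rewrite (le_trans h)// ltW.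
  rewrite -RintegralB//; last 2 first.
  - by apply: (iF _ (2 / (1 - cos e) + 3)) => // xi _; exact: odd_ker_bound.
  - exact: (iF _ K).
  apply: far_le; first by rewrite mulr_ge0 ?sqr_ge0// exprn_ge0.
    exact: measurable_funB.
  move=> xi Nxi; have ru : r < `|xi - t|.
    by rewrite ltNge; apply/negP => h; apply: Nxi; apply/cballE.
  have u0 : xi - t != 0 by rewrite -normr_gt0 (lt_trans r0).
  have h1 := odd_ker_diff u0 c1.
  have h2 := ker_ratio_le u0 c1 ce'.
  have h3 := far_ratio2 (ltW ru).
  have un : 0 < `|xi - t| by rewrite normr_gt0.
  rewrite -(ler_pM2l un) (le_trans h1)//.
  apply: (@le_trans _ _ ((2 + `|xi - t|) * (e ^+ 2 * (K ^+ 2 / 4)))).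
    rewrite ler_wpM2l ?addr_ge0// (le_trans h2)// ler_wpM2l ?sqr_ge0//.
  have h4 := far_ratio (ltW ru); rewrite ler_pdivrMr// in h4.
  apply: (@le_trans _ _ (K * `|xi - t| * (e ^+ 2 * (K ^+ 2 / 4)))).
    by apply: (ler_wpM2r _ h4); rewrite mulr_ge0 ?sqr_ge0// divr_ge0// exprn_ge0.
  have -> : K * `|xi - t| * (e ^+ 2 * (K ^+ 2 / 4)) = `|xi - t| * (K ^+ 3 * (e ^+ 2 / 4)).
    by ring.
  rewrite ler_wpM2l// ler_wpM2l ?exprn_ge0 //.
  have : e ^+ 2 <= tau ^+ 2.
    rewrite lerXn2r ?nnegrE ?(ltW e0) ?(ltW tau0)// /e.
    by rewrite -[leRHS]expr1 ler_wiXn2l// ltW.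
  by have := sqr_ge0 e; lra.
(* The factor 3 bounds [2 + |xi - t|] for [|xi - t| <= 1], and 7 exceeds [3 * (9 / 4)]. The middle
   zone has weight 0 here. *)
have HN : `|N1 - N2| <= 3 * L * (2 * tau ^+ 2) + 0 * (2 * 0) + 7 * L * tau ^+ 2 * (2 * r).
  rewrite -RintegralB//; last 2 first.
  - apply: (@bounded_cball_integrable _ t r _ ((2 / (1 - cos e) + 3) * (L * r)) (ltW r0)).
      exact: measurable_funM.
    move=> xi Nxi; rewrite normrM ler_pM//; first exact: odd_ker_bound.
    by rewrite (le_trans (lip Nxi))// ler_wpM2l//; apply/cballE.
  - apply: (@bounded_cball_integrable _ t r _ (3 * L) (ltW r0)) => //.
    exact: measurable_funM.
  apply: Rintegral_zones => //.
  - exact: ltW.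
  - by apply: measurable_funB; apply: measurable_funM.
  - by rewrite mulr_ge0.
  - by apply: mulr_ge0; [exact: mulr_ge0|exact: sqr_ge0].
  - exact: sqr_ge0.
  move=> xi Nxi; rewrite mul0r addr0 cball_indic.
  have u1 : `|xi - t| <= 1 by apply: le_trans r1; apply/cballE.
  have [e'|u0] := eqVneq (xi - t) 0.
    rewrite e' !odd_ker0 !mul0r subrr normr0; apply: addr_ge0.
      by apply: mulr_ge0; [exact: mulr_ge0|].
    by apply: mulr_ge0; [exact: mulr_ge0|exact: sqr_ge0].
  rewrite -mulrBl normrM.
  have h1 := odd_ker_diff u0 c1.
  have un : 0 < `|xi - t| by rewrite normr_gt0.
  have d0 : 0 <= 2 * expR (xi - t) * (1 - cos e) / ker_den (cos e) (xi - t).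
    by rewrite divr_ge0 ?(ltW (ker_den_gt0 _ c1))// !mulr_ge0 ?expR_ge0//; move/andP: c1 => [? ?]; lra.
  apply: (@le_trans _ _ (L * (3 * (2 * expR (xi - t) * (1 - cos e) / ker_den (cos e) (xi - t))))).
    rewrite (le_trans (ler_wpM2l (normr_ge0 _) (lip Nxi)))// mulrCA ler_wpM2l//.
    rewrite mulrC (le_trans h1)// ler_wpM2r//; lra.
  have [ut|ut] := leP `|xi - t| (tau ^+ 2).
    have h5 := ker_ratio_le1 (xi - t) c1.
    move: d0 h5; set q := _ / ker_den _ _ => d0 h5.
    have := mulr_ge0 L0 (sqr_ge0 tau); have := mulr_ge0 L0 d0.
    have := ler_wpM2l L0 h5; rewrite !mulr1.
    rewrite -[7 * L * _]mulrA [L * (3 * q)]mulrCA.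
    by move: (L * tau ^+ 2) (L * q) => a b H1 H2 H3; lra.
  rewrite mulr0 add0r.
  have h2 := ker_ratio_le u0 c1 ce'.
  have tau20 : 0 < tau ^+ 2 by rewrite exprn_gt0.
  have h3 := near_ratio2 tau20 (ltW ut) u1.
  have h6 : e ^+ 2 * ((2 + `|xi - t|) ^+ 2 / (4 * (xi - t) ^+ 2)) <= 9 / 4 * tau ^+ 2.
    rewrite (le_trans (ler_wpM2l (sqr_ge0 e) h3))//.
    rewrite (_ : e ^+ 2 * (9 / 4 / (tau ^+ 2) ^+ 2) = 9 / 4 * tau ^+ 2)// /e.
    by field; rewrite gt_eqF.
  have h7 := le_trans h2 h6.
  move: h7; set q := _ / ker_den _ _ => h7.
  have := ler_wpM2l L0 h7; have := mulr_ge0 L0 (sqr_ge0 tau).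
  rewrite [L * (9 / 4 * _)]mulrCA -[7 * L * _]mulrA [L * (3 * q)]mulrCA.
  by move: (L * tau ^+ 2) (L * q) => a b H1 H2; lra.
have -> : - 2^-1 - 2^-1 * (F1 + N1) - (- 2^-1 - 2^-1 * (F2 + N2)) =
    - (2^-1 * ((F1 - F2) + (N1 - N2))) by ring.
rewrite normrN normrM gtr0_norm ?invr_gt0//.
have := ler_normD (F1 - F2) (N1 - N2).
have q0 : 0 <= L * tau ^+ 2 by rewrite mulr_ge0// sqr_ge0.
have q1 : L * tau ^+ 2 * r <= L * tau ^+ 2 by rewrite ler_piMr.
have q2 : 0 <= K ^+ 3 * tau ^+ 2 by rewrite mulr_ge0 ?sqr_ge0// exprn_ge0// .
move: HF HN; set A := `|F1 - F2|; set B := `|N1 - N2|; set D := `|_ + _| => HF HN HD.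
nra.
Qed.

Let DN := L + p t.
Let near_boundD xi : cball t r xi -> `|p xi| <= DN.
Proof.
move=> Nxi; have h := lip Nxi.
have u1 : `|xi - t| <= 1 by apply: le_trans r1; apply/cballE.
have := ler_normD (p xi - p t) (p t); rewrite subrK (ger0_norm (p_ge0 t)).
by move/le_trans; apply; rewrite lerD2r (le_trans h)// ler_piMr.
Qed.

(** The Poisson kernel decays only like [e / v ^+ 2], with [v = |xi - t|]. Times the Lipschitz
    factor [v], it is at most [3 / 2] everywhere, [9 / 4 * tau] for [v > tau ^+ 2] and
    [9 / 4 * tau ^+ 2] for [v > tau]; each of the three zones contributes O(tau^2). *)
Lemma Im_Mtr_estimate tau : 0 < tau -> tau ^+ 3 <= r / 4 ->
  `|complex.Im (Mtr rho (cexp_mt t (tau ^+ 3))) - pi * p t| <=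
     (K ^+ 2 + 12 * L + 5 * p t / r) * tau ^+ 2.
Proof.
move=> tau0 taur; set e := tau ^+ 3.
have e0 : 0 < e by rewrite exprn_gt0.
have e1 : e < 1 by move: taur r1; rewrite -/e; lra.
have e01 : 0 < e < 1 by rewrite e0.
have tau1 : tau < 1.
  by rewrite ltNge; apply/negP => h; move: e1; rewrite ltNge exprn_ege1.
have et : e <= tau ^+ 2.
  by rewrite /e exprS ler_piMl ?sqr_ge0// ltW.
have mk := measurable_poisson_ker e t.
have cw : cut_plane (cexp_mt t e).
  by apply/cut_plane_Im/Im_cexp_mt; rewrite e0/=; have := pi_ge2 R; lra.
have kE xi : complex.Im (cauchy_ker (cexp_mt t e) xi) = poisson_ker e (xi - t).
  by rewrite cauchy_ker_cexp.
have bS : bounded_measurable (fun xi => poisson_ker e (xi - t)).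
  by have [_] := cbounded_cauchy_ker cw; congr bounded_measurable; apply/funext.
have [_ [B kB]] := bS.
have -> : complex.Im (Mtr rho (cexp_mt t e)) = expect rho (fun xi => poisson_ker e (xi - t)).
  by rewrite MtrE// ImB subr0; apply: eq_expect => x; exact: kE.
rewrite (near_far_split rho_p (ltW r0) bS near_bound).
set F := \int[rho]_(x in _) _; set N := \int[mu]_(x in _) _; set P := \int[mu]_(x in _) _.
have HP : `|P - pi| <= 5 * e / r by exact: Rintegral_poisson_near_pi.
have HF : `|F| <= e * (K ^+ 2 / 4).
  apply: far_le => //; first by rewrite mulr_ge0 ?(ltW e0)// divr_ge0// exprn_ge0.
  move=> xi Nxi; have ru : r < `|xi - t|.
    by rewrite ltNge; apply/negP => h; apply: Nxi; apply/cballE.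
  have u0 : xi - t != 0 by rewrite -normr_gt0 (lt_trans r0).
  have [h _] := poisson_ker_le u0 e01; apply: (le_trans h).
  by rewrite ler_pM2l//; apply: far_ratio2; exact: ltW.
have HN : `|N| <= 3 / 2 * L * (2 * tau ^+ 2) + 9 / 4 * (L * tau) * (2 * tau) +
    9 / 4 * (L * tau ^+ 2) * (2 * r).
  have LT2 : 0 <= L * tau ^+ 2 by apply: mulr_ge0 => //; exact: sqr_ge0.
  have LT : 0 <= L * tau by apply: mulr_ge0 => //; exact: ltW.
  apply: Rintegral_zones.
  - exact: ltW.
  - exact: measurable_funM.
  - by apply: mulr_ge0.
  - exact: mulr_ge0.
  - exact: mulr_ge0.
  - exact: sqr_ge0.
  - exact: ltW.
  move=> xi Nxi; rewrite !cball_indic.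
  have u1 : `|xi - t| <= 1 by apply: le_trans r1; apply/cballE.
  rewrite normrM; have h := lip Nxi.
  have [u0|u0] := eqVneq (xi - t) 0.
    have -> : `|p xi - p t| = 0.
      by apply: le_anti; rewrite normr_ge0 andbT (le_trans h)// u0 normr0 mulr0.
    by rewrite mulr0 !addr_ge0// mulr_ge0// mulr_ge0.
  have un : 0 < `|xi - t| by rewrite normr_gt0.
  have [k1 k2] := poisson_ker_le u0 e01.
  set k := `|poisson_ker _ _| in k1 k2 *.
  have k0 : 0 <= k by exact: normr_ge0.
  set v := `|xi - t| in un h u1 k1 k2 *.
  have hk : k * `|p xi - p t| <= L * (v * k).
    by have := ler_wpM2l k0 h; rewrite [k * (L * v)]mulrCA [k * v]mulrC.
  apply: (le_trans hk).
  have k3 : v ^+ 2 * k <= 9 / 4 * e.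
    have E : (xi - t) ^+ 2 = v ^+ 2 by rewrite real_normK ?num_real.
    have v2 : 0 < v ^+ 2 by rewrite exprn_gt0.
    apply: (le_trans (ler_wpM2l (ltW v2) k1)); rewrite E.
    have -> : v ^+ 2 * (e * ((2 + v) ^+ 2 / (4 * v ^+ 2))) = (2 + v) ^+ 2 / 4 * e.
      by field; rewrite gt_eqF.
    by rewrite ler_wpM2r ?(ltW e0)//; nra.
  have vk : v * k <= 3 / 2 by lra.
  have [w1|w1] := leP v (tau ^+ 2).
    rewrite mulr1; have := ler_wpM2l L0 vk.
    have : 0 <= 9 / 4 * (L * tau) * (v <= tau)%R%:R by apply: mulr_ge0 => //; apply: mulr_ge0.
    by lra.
  have [w2|w2] := leP v tau.
    have : v * k <= 9 / 4 * tau.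
      have t20 : 0 < tau ^+ 2 by rewrite exprn_gt0.
      rewrite -(ler_pM2l t20); apply: (@le_trans _ _ (v * (v * k))).
        by apply: ler_wpM2r; [apply: mulr_ge0 => //; exact: ltW|exact: ltW].
      by rewrite mulrA -expr2 (le_trans k3)// /e; lra.
    move=> /(ler_wpM2l L0); rewrite mulr0 mulr1; lra.
  have : v * k <= 9 / 4 * tau ^+ 2.
    rewrite -(ler_pM2l tau0); apply: (@le_trans _ _ (v * (v * k))).
      by apply: ler_wpM2r; [apply: mulr_ge0 => //; exact: ltW|exact: ltW].
    by rewrite mulrA -expr2 (le_trans k3)// /e; lra.
  move=> /(ler_wpM2l L0); rewrite !mulr0; lra.
have -> : F + N + p t * P - pi * p t = F + N + p t * (P - pi) by ring.
have h1 : `|p t * (P - pi)| <= p t * (5 * e / r).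
  by rewrite normrM (ger0_norm (p_ge0 t)) ler_wpM2l.
have h2 : p t * (5 * e / r) <= 5 * p t / r * tau ^+ 2.
  have -> : p t * (5 * e / r) = 5 * p t / r * e by field; rewrite gt_eqF.
  by rewrite ler_wpM2l// divr_ge0 ?(ltW r0)// mulr_ge0.
have h3 : e * (K ^+ 2 / 4) <= K ^+ 2 * tau ^+ 2.
  rewrite mulrC; apply: ler_pM => //; first by rewrite divr_ge0// exprn_ge0.
    exact: ltW.
  by have := sqr_ge0 K; lra.
have h4 : L * tau ^+ 2 * r <= L * tau ^+ 2.
  by rewrite ler_piMr//; apply: mulr_ge0 => //; exact: sqr_ge0.
have := ler_normD (F + N) (p t * (P - pi)); have := ler_normD F N; lra.
Qed.

Let odd1_bounded (e xi : R) : 0 < e -> e < `|xi - t| -> `|odd_ker 1 (xi - t)| <= 2 / e + 1.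
Proof.
move=> e0 ex; have u0 : 0 < `|xi - t| by exact: lt_trans ex.
have u1 : xi - t != 0 by rewrite -normr_gt0.
have h := odd_ker1_norm u1.
rewrite -(ler_pM2l u0) (le_trans h)//.
have : 2 <= `|xi - t| * (2 / e) by rewrite mulrCA ler_peMr// ler_pdivlMr// mul1r ltW.
by rewrite mulrDr mulr1; lra.
Qed.

Lemma Mpv_truncated e : 0 < e -> e < r ->
  `|\int[rho]_(s in [set s | e < `|s - t|])
      (expR (s - t) / (1 - expR (s - t))) - pv_value| <= (DN + 3 * L) * e.
Proof.
move=> e0 er.
have AE : [set s | e < `|s - t|] = ~` cball t e.
  apply/seteqP; split => x /=; first by move=> h /cballE; rewrite leNgt h.
  by move=> h; rewrite ltNge; apply/negP => h'; apply: h; apply/cballE.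
rewrite AE.
have mN := measurable_cball t e; have mA : measurable (~` cball t e) by apply: measurableC.
pose I x : R := \1_(~` cball t e) x.
have mI : measurable_fun setT I by exact: measurable_indic.
have I1 x : ~ cball t e x -> I x = 1.
  by move=> h; rewrite /I indicE mem_set.
have I0 x : cball t e x -> I x = 0.
  by move=> h; rewrite /I indicE memNset//=; apply.
pose k x := I x * odd_ker 1 (x - t).
have kB x : `|k x| <= 2 / e + 1.
  rewrite /k; have [h|h] := pselect (cball t e x).
    by rewrite I0// mul0r normr0 addr_ge0// divr_ge0// ltW.
  rewrite I1// mul1r; apply: odd1_bounded => //.
  by rewrite ltNge; apply/negP => h'; apply: h; apply/cballE.
have bk : bounded_measurable k.
  by split; [exact: measurable_funM|exists (2 / e + 1)].
(* Off the small interval [G] is the integrand, as [e^u / (1 - e^u) = - (1 + coth (u / 2)) / 2]; on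
   it [G] is [- 1 / 2], and its integral there is at most [DN * e]. *)
pose G x := - 2^-1 - 2^-1 * k x.
have bG : bounded_measurable G.
  apply: bounded_measurableB; first exact: bounded_measurable_cst.
  by apply: bounded_measurableM => //; exact: bounded_measurable_cst.
have -> : \int[rho]_(s in ~` cball t e) (expR (s - t) / (1 - expR (s - t))) =
    \int[rho]_(s in ~` cball t e) G s.
  apply: eq_Rintegral => x /set_mem h; rewrite /G /k I1// mul1r.
  have u0 : x - t != 0.
    rewrite -normr_gt0 (lt_trans e0)// ltNge; apply/negP => h'; apply: h; exact/cballE.
  rewrite /odd_ker (_ : ker_den 1 (x - t) = (expR (x - t) - 1) ^+ 2).
    have n0 := expR_neq1 u0.
    have n1 : 1 - expR (x - t) != 0 by rewrite -oppr_eq0 opprB.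
    by field; rewrite n0 n1.
  by rewrite ker_denE; ring.
have split : expect rho G = \int[rho]_(x in cball t e) G x +
    \int[rho]_(x in ~` cball t e) G x.
  rewrite /expect -(setUv (cball t e)) Rintegral_setU//.
  - by rewrite setUv; exact: bounded_measurable_integrable.
  - by rewrite disj_set2E setICr.
have -> : \int[rho]_(x in ~` cball t e) G x =
    expect rho G - \int[rho]_(x in cball t e) G x by rewrite split; ring.
have sub x : cball t e x -> cball t r x.
  by move=> /cballE h; apply/cballE; rewrite (le_trans h)// ltW.
have Hc : `|\int[rho]_(x in cball t e) G x| <= DN * e.
  rewrite (has_density_Rintegral rho_p mN bG).
  have := @Rintegral_zones _ t e (fun x => G x * p x) 0 0 (2^-1 * DN) 0 0 (ltW e0).
  rewrite !mul0r !add0r => H.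
  have -> : DN * e = 2^-1 * DN * (2 * e) by field.
  apply: H => //; first by apply: measurable_funM => //; exact: bG.1.
    by rewrite mulr_ge0// addr_ge0.
  move=> x hx; rewrite !mul0r !add0r normrM /G /k I0// mul0r mulr0 subr0 normrN.
  rewrite (ger0_norm (x := 2^-1)) ?invr_ge0//; apply: ler_wpM2l => //.
  exact/near_boundD/sub.
have -> : expect rho G = - 2^-1 - 2^-1 * expect rho k.
  rewrite (expectB rho (bounded_measurable_cst _)); last first.
    by apply: bounded_measurableM => //; exact: bounded_measurable_cst.
  by rewrite expect_cst (expectZ rho _ bk).
rewrite (near_far_split rho_p (ltW r0) bk near_bound).
rewrite (@Rintegral_odd _ t r k (2 / e + 1) (ltW r0) bk.1); last 2 first.
- by move=> x _.
- move=> x; rewrite /k; have -> : I (2 * t - x) = I x.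
    rewrite /I !indicE; congr (_%:R); congr nat_of_bool; apply/idP/idP => /set_mem h;
      apply/mem_set => /cballE h'; apply: h; apply/cballE.
      by rewrite distrC (_ : t - (2 * t - x) = x - t)//; ring.
    by rewrite distrC (_ : t - x = 2 * t - x - t)//; ring.
  by rewrite -mulrN -odd_kerN; congr (_ * odd_ker _ _); ring.
rewrite mulr0 addr0 /pv_value.
have -> : \int[rho]_(x in ~` cball t r) k x = \int[rho]_(x in ~` cball t r) odd_ker 1 (x - t).
  by apply: eq_Rintegral => x /set_mem h; rewrite /k I1 ?mul1r// => /sub.
set N1 := \int[mu]_(x in _) _; set N2 := \int[mu]_(x in _) _; set C := \int[rho]_(x in cball t e) _.
have mN' : @measurable _ (measurableTypeR R) (cball t r) by exact: measurable_cball.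
have HN : `|N1 - N2| <= 3 * L * (2 * e).
  rewrite -RintegralB//; last 2 first.
  - apply: (@bounded_cball_integrable _ t r _ (3 * L) (ltW r0)).
      by apply: measurable_funM => //; exact: bk.1.
    move=> x Nx; rewrite /k -mulrA normrM; have [h|h] := pselect (cball t e x).
      by rewrite I0// normr0 mul0r mulr_ge0.
    by rewrite I1// normr1 mul1r odd_ker1_near.
  - apply: (@bounded_cball_integrable _ t r _ (3 * L) (ltW r0)) => //.
    exact: measurable_funM.
  have := @Rintegral_zones _ t r (fun x => k x * (p x - p t) - odd_ker 1 (x - t) * (p x - p t))
    (3 * L) 0 0 e 0 (ltW r0).
  rewrite !mul0r !addr0; apply => //.
  - apply: measurable_funB; apply: measurable_funM => //; exact: bk.1.
  - by rewrite mulr_ge0.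
  - exact: ltW.
  move=> x Nx; rewrite mul0r !addr0 cball_indic; have [h|h] := leP `|x - t| e.
    rewrite /k I0 ?mul0r ?sub0r ?normrN ?mulr1 ?odd_ker1_near//; exact/cballE.
  by rewrite /k I1 ?mul1r ?subrr ?normr0 ?mulr0// => /cballE; rewrite leNgt h.
have -> : - 2^-1 - 2^-1 * (\int[rho]_(x in ~` cball t r) odd_ker 1 (x - t) + N1) - C -
    (- 2^-1 - 2^-1 * (\int[rho]_(x in ~` cball t r) odd_ker 1 (x - t) + N2)) =
    - (2^-1 * (N1 - N2)) - C by field.
have := ler_normB (- (2^-1 * (N1 - N2))) C.
by rewrite normrN normrM gtr0_norm ?invr_gt0//; lra.
Qed.

Lemma MpvE : Mpv rho t = pv_value.
Proof.
rewrite /Mpv; apply: cvg_lim => //; apply/cvgrPdist_lt => eps eps0.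
have D0 : 0 < DN + 3 * L + 1 by rewrite ltr_wpDl// !addr_ge0// mulr_ge0.
near=> e; rewrite distrC.
have e0 : 0 < e by near: e; exact: nbhs_right_gt.
have er : e < r by near: e; exact: nbhs_right_lt.
apply: (le_lt_trans (Mpv_truncated e0 er)).
apply: (@le_lt_trans _ _ ((DN + 3 * L + 1) * e)); first by rewrite ler_pM2r// lerDl.
rewrite mulrC -ltr_pdivlMr//; near: e; apply: nbhs_right_lt; exact: divr_gt0.
Unshelve. all: by end_near. Qed.

End PlemeljEstimates.

Section LocallyLipschitz.
Context {R : realType}.

Lemma derivable_lipschitz (f : R -> R) (s d L : R) :
  (forall x, `|x - s| < d -> derivable f x 1 /\ `|derive1 f x| <= L) ->
  forall x y, `|x - s| < d -> `|y - s| < d -> `|f x - f y| <= L * `|x - y|.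
Proof.
move=> df x y xs ys.
wlog xy : x y xs ys / x < y => [H|].
  have [xy|xy|->] := ltgtP x y; first exact: H.
    by rewrite distrC [`|x - y|]distrC; exact: H.
  by rewrite !subrr !normr0 mulr0.
have seg z : x <= z <= y -> `|z - s| < d.
  by move=> /andP[? ?]; move: xs ys; rewrite !ltr_norml => /andP[? ?] /andP[? ?]; apply/andP; split; lra.
have [||z zxy E] := @MVT R f (derive1 f) x y xy.
- move=> z; rewrite in_itv/= => /andP[z1 z2].
  have zz : x <= z <= y by rewrite !ltW.
  by have [dz _] := df z (seg z zz); rewrite derive1E; exact: derivableP.
- apply: derivable_within_continuous => z; rewrite in_itv/= => h.
  by have [] := df z (seg z h).
rewrite distrC E normrM [`|x - y|]distrC ler_wpM2r//.
move: zxy; rewrite in_itv/= => /andP[z1 z2].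
have zz : x <= z <= y by rewrite !ltW.
by have [] := df z (seg z zz).
Qed.

Lemma C1_holder_locally_lipschitz (p : R -> R) (U : set R) (alpha s : R) : 0 < alpha ->
  open U -> U s -> C1_holder_on alpha U p ->
  exists d L, [/\ 0 < d, 0 <= L &
    forall x y, `|x - s| < d -> `|y - s| < d -> `|p x - p y| <= L * `|x - y|].
Proof.
move=> a0 oU Us H.
have [e /= e0 eU] : exists2 e : R, 0 < e & ball s e `<=` U.
  by apply/nbhs_ballP; move: oU; rewrite openE; exact.
have [_ [delta [C [delta0 C0 HC]]]] := H s Us.
pose d := Num.min e (Num.min delta 1).
have d0 : 0 < d by rewrite !lt_min e0 delta0 ltr01.
exists d, (`|derive1 p s| + C); split => //; first by rewrite addr_ge0// ltW.
apply: derivable_lipschitz => x; rewrite !lt_min => /and3P[h1 h2 h3].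
have Ux : U x by apply: eU; rewrite /ball/= distrC.
split; first by have [] := H x Ux.
have bs : ball s delta s by exact: ballxx.
have bx : ball s delta x by rewrite /ball/= distrC.
have := HC x s Ux Us bx bs => h.
have pw : `|x - s| `^ alpha <= 1.
  by have := ge0_ler_powR (ltW a0) (normr_ge0 (x - s)) ler01 (ltW h3); rewrite powR1.
have := ler_normD (derive1 p x - derive1 p s) (derive1 p s); rewrite subrK.
have : C * `|x - s| `^ alpha <= C by rewrite ler_piMr// ltW.
by lra.
Qed.

End LocallyLipschitz.

Section Triangle.
Context {R : realType}.
Implicit Types (x y z w : R[i]).

Lemma nc_lt2 x y z (e : R) : nc (x - y) < e / 2 -> nc (y - z) < e / 2 -> nc (x - z) < e.
Proof. by have := nc_tri x y z; lra. Qed.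

Lemma nc_lt3 x y z w (e : R) : nc (y - x) < e / 3 -> nc (y - z) < e / 3 ->
  nc (z - w) < e / 3 -> nc (x - w) < e.
Proof. by have := nc_tri x y w; have := nc_tri y z w; rewrite (ncBC x y); lra. Qed.

End Triangle.

Section BoundaryValues.
Context {R : realType}.
Implicit Types (t e tau : R).

Lemma cexp_mt_cont (T : Type) (F : set_system T) {FF : Filter F} (t e : T -> R) (t0 e0 : R) :
  t @ F --> t0 -> e @ F --> e0 -> tends F (fun x => cexp_mt (t x) (e x)) (cexp_mt t0 e0).
Proof.
move=> tt ee.
have ReE a b : complex.Re (cexp_mt a b) = expR (- a) * cos b.
  by rewrite /cexp_mt ReM/= mul0r subr0.
have ImE a b : complex.Im (cexp_mt a b) = expR (- a) * sin b.
  by rewrite /cexp_mt ImM/= mul0r addr0.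
have ce : (fun x => expR (- t x)) @ F --> expR (- t0).
  exact (cvg_comp (fun x => - t x) expR (cvgN tt) (@continuous_expR R (- t0))).
have h1 : (fun x => expR (- t x) * cos (e x)) @ F --> expR (- t0) * cos e0.
  by apply: cvgM => //; exact (cvg_comp e (@cos R) ee (@continuous_cos R e0)).
have h2 : (fun x => expR (- t x) * sin (e x)) @ F --> expR (- t0) * sin e0.
  by apply: cvgM => //; exact (cvg_comp e (@sin R) ee (@continuous_sin R e0)).
move=> r r0; have r2 : 0 < r / 2 by rewrite divr_gt0.
move/cvgrPdist_lt/(_ _ r2) in h1; move/cvgrPdist_lt/(_ _ r2) in h2.
apply: filterS (filterI h1 h2) => x [k1 k2].
apply: le_lt_trans (nc_le_ReIm _) _; rewrite ReB ImB !ReE !ImE.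
by rewrite distrC in k1; rewrite distrC in k2; rewrite (splitr r) ltrD.
Qed.

(* [x.1 -> t] and [x.2 -> 0^+] jointly *)
Definition nbh0 t : set_system (R * R) :=
  [set A | exists2 d : R, 0 < d & forall u e, `|u - t| < d -> 0 < e < d -> A (u, e)].

Global Instance nbh0_filter t : ProperFilter (nbh0 t).
Proof.
apply: Build_ProperFilter_ex.
  move=> A [d d0 h]; exists (t, d / 2); apply: h; first by rewrite subrr normr0.
  by apply/andP; split; lra.
split.
- by exists 1.
- move=> A B [d d0 hA] [d' d0' hB]; exists (Num.min d d'); first by rewrite lt_min d0.
  move=> u e; rewrite !lt_min => /andP[u1 u2] /andP[e0 /andP[e1 e2]].
  by split; [apply: hA|apply: hB] => //; rewrite e0.
- move=> A B AB [d d0 h]; exists d => // u e h1 h2; exact/AB/h.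
Qed.

Lemma near_nbh0 t (d : R) : 0 < d ->
  \forall x \near nbh0 t, `|x.1 - t| < d /\ 0 < x.2 < d.
Proof. by move=> d0; exists d. Qed.

Context (rho : probability R R) (p : R -> R).
Hypothesis rho_p : has_density rho p.

(** The boundary value of [Mtr rho] from the upper half-plane; the one from below is its
    conjugate. *)
Definition Mbd t : R[i] := Mpv rho t +i* (pi * p t).

Context (s d L : R).
Hypotheses (d0 : 0 < d) (L0 : 0 <= L).
Hypothesis lip : forall x y, `|x - s| < d -> `|y - s| < d -> `|p x - p y| <= L * `|x - y|.

Lemma Mtr_boundary_estimate : exists r C, [/\ 0 < r, r < d, 0 < C &
  forall t tau, `|t - s| < r -> 0 < tau -> tau < r ->
    nc (Mtr rho (cexp_mt t (tau ^+ 3)) - Mbd t) <= C * tau ^+ 2].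
Proof.
pose q := Num.min 1 (d / 3).
have q0 : 0 < q by rewrite lt_min ltr01 divr_gt0.
have q1 : q <= 1 by rewrite ge_min lexx.
have qd : q <= d / 3 by rewrite ge_min lexx orbT.
have K0 : 0 <= 2 / q + 1 by rewrite addr_ge0// divr_ge0// ltW.
(* The constants of the two estimates at radius [q], with [p t] replaced by its bound [p s + L * d]
   so that they no longer depend on [t]. *)
pose C := ((2 / q + 1) ^+ 3 + 20 * L) + ((2 / q + 1) ^+ 2 + 12 * L + 5 * (p s + L * d) / q) + 1.
have p0 x : 0 <= p x by case: rho_p.
have C0 : 0 < C.
  have a1 := exprn_ge0 3 K0; have a2 := exprn_ge0 2 K0.
  have a3 : 0 <= L * d by rewrite mulr_ge0// ltW.
  have a4 : 0 <= 5 * (p s + L * d) / q by rewrite divr_ge0 ?(ltW q0)// mulr_ge0// addr_ge0.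
  rewrite /C; apply: ltr_wpDl => //; apply: addr_ge0.
    by apply: addr_ge0 => //; exact: mulr_ge0.
  by apply: addr_ge0 => //; apply: addr_ge0 => //; exact: mulr_ge0.
exists (q / 4), C; split => //; [lra|lra|].
move=> t tau ts tau0 taur.
have lipt xi : cball t q xi -> `|p xi - p t| <= L * `|xi - t|.
  move=> /cballE h; apply: lip; last by lra.
  by have := ler_normD (xi - t) (t - s); rewrite subrKA; lra.
have tau3 : tau ^+ 3 <= q / 4.
  have t1 : tau <= 1 by lra.
  by apply: (@le_trans _ _ tau); [rewrite exprS ler_piMr ?(ltW tau0)// exprn_ile1// ltW|exact: ltW].
have h1 := Re_Mtr_estimate rho_p q0 q1 L0 lipt tau0 tau3.
have h2 := Im_Mtr_estimate rho_p q0 q1 L0 lipt tau0 tau3.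
rewrite -(MpvE rho_p q0 q1 L0 lipt) in h1.
apply: (le_trans (nc_le_ReIm _)); rewrite ReB ImB [complex.Re (Mbd t)]/= [complex.Im (Mbd t)]/=.
have pt : p t <= p s + L * d.
  have ss : `|s - s| < d by rewrite subrr normr0.
  have td : `|t - s| < d by lra.
  have /ler_normlP[_ h] := lip td ss.
  have : L * `|t - s| <= L * d by rewrite ler_wpM2l// ltW.
  by lra.
have h3 : 5 * p t / q * tau ^+ 2 <= 5 * (p s + L * d) / q * tau ^+ 2.
  by rewrite ler_wpM2r ?sqr_ge0// ler_pM2r ?invr_gt0//; lra.
have := sqr_ge0 tau; rewrite /C; lra.
Qed.

(** As the estimate is uniform in [t], [Mbd] is a uniform limit of continuous functions, and the
    convergence is joint in [t] and the height. *)
Lemma Mtr_tends_boundary : exists r, [/\ 0 < r, r < d &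
  forall t, `|t - s| < r ->
    (tends (nbh0 t) (fun x => Mtr rho (cexp_mt x.1 x.2)) (Mbd t)) /\
    tends (nbhs t) Mbd (Mbd t)].
Proof.
have [r [C [r0 rd C0 est]]] := Mtr_boundary_estimate.
exists r; split => // t ts.
have cube e : 0 < e -> exists2 tau, 0 < tau & tau ^+ 3 = e.
  move=> e0; exists (e `^ (3^-1)); first exact: powR_gt0.
  by rewrite -powR_mulrn ?powR_ge0// -powRrM mulVf// powRr1// ltW.
pose q := r - `|t - s|.
have q0 : 0 < q by rewrite subr_gt0.
have near_r u : `|u - t| < q -> `|u - s| < r.
  by rewrite /q => h; have := ler_normD (u - t) (t - s); rewrite subrKA; lra.
have small eta : 0 < eta -> exists2 a, 0 < a & forall tau, 0 < tau -> tau ^+ 3 < a ->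
    tau < r /\ C * tau ^+ 2 < eta.
  move=> eta0; pose b := Num.min (Num.min r 1) (eta / C).
  have b0 : 0 < b by rewrite !lt_min r0 ltr01 divr_gt0.
  exists (b ^+ 3); first by rewrite exprn_gt0.
  move=> tau tau0 ; rewrite ltr_pXn2r ?nnegrE ?(ltW tau0) ?(ltW b0)//.
  rewrite !lt_min => /andP[/andP[h1 h2]]; rewrite ltr_pdivlMr// => h3; split => //.
  apply: le_lt_trans h3; rewrite mulrC ler_pM2r// expr2 ler_piMr ?ltW//.
have MC : tends (nbhs t) Mbd (Mbd t).
  move=> e e0; have e3 : 0 < e / 3 by rewrite divr_gt0.
  have [a a0 ha] := small _ e3.
  pose a' := Num.min a 1.
  have a'0 : 0 < a' by rewrite lt_min a0 ltr01.
  have a'1 : a' <= 1 by rewrite ge_min lexx orbT.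
  have a'a : a' <= a by rewrite ge_min lexx.
  have a2 : 0 < a' / 2 by rewrite divr_gt0.
  have [tau tau0 tauE] := cube _ a2.
  have [|tr te] := ha tau tau0; first by rewrite tauE; lra.
  have cw : cut_plane (cexp_mt t (tau ^+ 3)).
    by apply/cut_plane_Im/Im_cexp_mt; rewrite tauE; have := pi_ge2 R; lra.
  have cc : tends (nbhs t) (fun u => cexp_mt u (tau ^+ 3)) (cexp_mt t (tau ^+ 3)).
    by apply: cexp_mt_cont; [exact: cvg_id|exact: cvg_cst].
  pose proof (tends_comp cc (Mtr_cont rho cw) e3) as h.
  have hq : \forall u \near t, `|u - t| < q.
    by apply/nbhs_ballP; exists q => //= u; rewrite /ball/= distrC.
  apply: filterS (filterI h hq) => u [h1 h2].
  have k1 := est u tau (near_r u h2) tau0 tr.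
  have k2 := est t tau ts tau0 tr.
  exact: nc_lt3 (le_lt_trans k1 te) h1 (le_lt_trans k2 te).
split => // e e0; have e2 : 0 < e / 2 by rewrite divr_gt0.
have [a a0 ha] := small _ e2.
have /nbhs_ballP[b /= b0 hb] := MC _ e2.
exists (Num.min (Num.min a b) q); first by rewrite !lt_min a0 b0.
move=> u ep; rewrite !lt_min => /andP[/andP[_ u1] u2] /andP[ep0 /andP[/andP[ep1 _] _]].
have [tau tau0 tauE] := cube _ ep0.
have [|tr te] := ha tau tau0; first by rewrite tauE.
have k1 := est u tau (near_r u u2) tau0 tr.
have k2 : nc (Mbd u - Mbd t) < e / 2 by apply: hb; rewrite /ball/= distrC.
by rewrite -tauE; exact: nc_lt2 (le_lt_trans k1 te) k2.
Qed.

End BoundaryValues.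

(** * Subordination functions in the upper half-plane *)

Section MomentNegative.
Context {R : realType} (rho : probability R R).
Implicit Types (z w : R[i]).

Lemma lt0_ReIm z : z < 0 <-> complex.Re z < 0 /\ complex.Im z = 0.
Proof.
rewrite ltcE/=; split => [/andP[/eqP <- ->]//|[-> ->]]; by rewrite eqxx.
Qed.

Lemma Mtr1_neq0 z : cut_plane z -> Mtr rho z + 1 != 0.
Proof.
move=> cz; have [I0|I0|I0] := ltgtP 0 (complex.Im z).
- have := Im_Mtr_gt0 rho I0; apply: contraTneq => /(congr1 (@complex.Im R)).
  by rewrite ImD addr0 => ->; rewrite ltxx.
- have I1 : 0 < complex.Im (conjc z) by case: z I0 {cz} => a b /=; rewrite oppr_gt0.
  have := Im_Mtr_gt0 rho I1; rewrite Mtr_conj//.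
  apply: contraTneq => /(congr1 (@complex.Im R)); rewrite ImD addr0.
  by case: (Mtr rho z) => a b /= ->; rewrite oppr0 ltxx.
have Rz : complex.Re z < 0.
  by move/cut_planeP: cz => [|//]; rewrite -I0 eqxx.
rewrite MtrE// subrK; apply/eqP => /(congr1 (@complex.Re R)) /= E.
have : 0 < expect rho (fun x => complex.Re (cauchy_ker z x)).
  apply: expect_gt0; first exact: (cbounded_cauchy_ker cz).1.
  move=> x; rewrite /cauchy_ker ReV divr_gt0//.
    rewrite ReB ReM/= mul0r subr0 subr_gt0.
    by rewrite (@lt_trans _ _ 0)// pmulr_rlt0// expR_gt0.
  by rewrite exprn_gt0// nc_gt0 cauchy_den_neq0.
by rewrite E ltxx.
Qed.

Lemma cauchy_ker_lt0 z x : z < 0 -> cauchy_ker z x = ((1 - expR x * complex.Re z)^-1)%:C.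
Proof.
move=> /lt0_ReIm[Rz Iz]; rewrite /cauchy_ker.
have -> : 1 - (expR x)%:C * z = (1 - expR x * complex.Re z)%:C.
  by apply: complex_ext; rewrite ?ReB ?ImB ?ReM ?ImM/= ?Iz; ring.
by rewrite fmorphV.
Qed.

Let expR_lt0 z x : z < 0 -> expR x * complex.Re z < 0.
Proof. by move=> /lt0_ReIm[Rz _]; rewrite pmulr_rlt0// expR_gt0. Qed.

Lemma Mtr_lt0 z : z < 0 -> -1 < Mtr rho z < 0.
Proof.
move=> z0; have cz := cut_plane_lt0 z0.
have [b1 _] := cbounded_cauchy_ker cz.
have ReE x : complex.Re (cauchy_ker z x) = (1 - expR x * complex.Re z)^-1.
  by rewrite cauchy_ker_lt0.
have E : Mtr rho z = (expect rho (fun x => complex.Re (cauchy_ker z x)) - 1)%:C.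
  rewrite MtrE//; apply: complex_ext; rewrite ?ReB ?ImB//= subr0.
  rewrite (@eq_expect _ _ _ (fun=> 0)) ?expect_cst// => x.
  by rewrite cauchy_ker_lt0.
have h0 : 0 < expect rho (fun x => complex.Re (cauchy_ker z x)).
  apply: expect_gt0 => // x; rewrite ReE invr_gt0.
  by have := expR_lt0 x z0; lra.
have h1 : 0 < expect rho (fun x => 1 - complex.Re (cauchy_ker z x)).
  apply: expect_gt0 => [|x].
    by apply: bounded_measurableB => //; exact: bounded_measurable_cst.
  by rewrite ReE subr_gt0 invf_lt1; have := expR_lt0 x z0; lra.
rewrite (expectB rho (bounded_measurable_cst 1) b1) expect_cst in h1.
rewrite E -[-1]/(-(1%:C)) -rmorphN/= !ltcR; apply/andP; split; lra.
Qed.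

(** On the negative half-line the kernel of the divided difference is positive. *)
Lemma Mtr_inj_lt0 z w : z < 0 -> w < 0 -> Mtr rho z = Mtr rho w -> z = w.
Proof.
move=> z0 w0 /eqP; rewrite -subr_eq0 Mtr_divdiff ?mulf_eq0; try exact: cut_plane_lt0.
case/orP => [|/eqP/(congr1 (@complex.Re R)) /= E]; first by rewrite subr_eq0 => /eqP.
have : 0 < expect rho (fun x => complex.Re (stieltjes_ker w x ^+ 1 * cauchy_ker z x)).
  apply: expect_gt0; first exact: (cbounded_divdiff 1 (cut_plane_lt0 w0) (cut_plane_lt0 z0)).1.
  move=> x; rewrite expr1 /stieltjes_ker !cauchy_ker_lt0// -!rmorphM/=.
  have e1 := expR_lt0 x z0; have e2 := expR_lt0 x w0.
  by rewrite !mulr_gt0 ?invr_gt0 ?expR_gt0//; lra.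
by rewrite E ltxx.
Qed.

Lemma Mtr_invK z : z < 0 -> Mtr_inv rho (Mtr rho z) = z.
Proof.
move=> z0; rewrite /Mtr_inv; case: xgetP => [w _ [w0 E]|/(_ z)[]]//.
exact: Mtr_inj_lt0.
Qed.

Lemma Str_Mtr z : z < 0 -> Str rho (Mtr rho z) = (Mtr rho z + 1) / Mtr rho z * z.
Proof. by move=> z0; rewrite /Str Mtr_invK// [1 + _]addrC. Qed.

End MomentNegative.

Section Derivable.

Lemma derivable_regular (K : numFieldType) (f : K -> K) (z : K) :
  derivable (f : K^o -> K^o) z 1 ->
  forall e : K, 0 < e -> exists2 d : K, 0 < d & forall h, h != 0 -> `|h| < d ->
     `|'D_1 (f : K^o -> K^o) z - h^-1 * (f (h + z) - f z)| < e.
Proof.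
move=> df e e0.
have /cvgrPdist_lt/(_ _ e0) : h^-1 *: ((f : K^o -> K^o) (h *: 1 + z) - f z) @[h --> 0^'] -->
    'D_1 (f : K^o -> K^o) z by exact: df.
rewrite near_withinE => /nbhs_ballP[d d0 hd]; exists d => // h h0 hh.
have := hd h; rewrite /ball/= sub0r normrN => /(_ hh h0).
by rewrite /GRing.scale/= mulr1.
Qed.

Context {R : realType}.

Lemma derivable_near_lipschitz (f : R[i] -> R[i]) (z : R[i]) :
  derivable (f : R[i]^o -> R[i]^o) z 1 -> exists B : R, 0 < B /\
  \forall w \near nbc z, nc (f w - f z) <= B * nc (w - z).
Proof.
move=> /(@derivable_regular R[i])/(_ 1 ltr01).
set a := derive _ _ _ => -[d d0 hd].
have [dr Ed] : exists dr : R, d = dr%:C.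
  by move: d0; case: (d) => x y; rewrite ltcE /= => /andP[/eqP-> _]; exists x.
exists (nc a + 1); split; first by rewrite ltr_wpDl// nc_ge0.
exists dr; first by move: d0; rewrite Ed ltcR.
move=> w wz; have [->|nwz] := eqVneq w z; first by rewrite !subrr nc0 mulr0.
have h0 : w - z != 0 by rewrite subr_eq0.
have := hd (w - z) h0; rewrite Ed !normE ltcR subrK => /(_ wz).
rewrite -[1]/(1%:C) ltcR => h1.
have E : f w - f z = (w - z) * ((w - z)^-1 * (f w - f z)) by rewrite mulrA divff// mul1r.
rewrite E ncM mulrC ler_wpM2r ?nc_ge0//.
have := ncD ((w - z)^-1 * (f w - f z) - a) a; rewrite subrK ncBC.
by move/le_trans; apply; rewrite addrC lerD2l ltW.
Qed.

End Derivable.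

Section Subordination.
Context {R : realType} (rhoi rho : probability R R) (omega : R[i] -> R[i]).
Hypothesis sub : is_subordination rhoi rho omega.
Implicit Types (z w : R[i]).

Lemma subordination_cut z : cut_plane z -> cut_plane (omega z).
Proof. by case: sub => _ H _ /H[]. Qed.

Lemma subordinationE z : cut_plane z -> Mtr rhoi (omega z) = Mtr rho z.
Proof. by case: sub => _ H _ /H[]. Qed.

Lemma subordination_cont z : cut_plane z -> ccont omega z.
Proof. by case: sub => H _ _ /H/derivable_ccont. Qed.

(** The chain rule: [Mtr rhoi], if stationary at [omega z], would make its composition with the
    locally Lipschitz [omega], which is [Mtr rho], stationary at [z]. *)
Lemma subordination_regular z : cut_plane z -> divdiff rho 1 z z != 0 ->
  divdiff rhoi 1 (omega z) (omega z) != 0.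
Proof.
move=> cz; apply: contraNneq => c0.
have cw := subordination_cut cz.
have [B [B0 hB]] : exists B : R, 0 < B /\
  \forall w \near nbc z, nc (omega w - omega z) <= B * nc (w - z).
  by case: sub => H _ _; apply: derivable_near_lipschitz; exact: H.
apply/negPn/negP => q0.
set q := divdiff rho 1 z z in q0.
have q2 : 0 < nc q / 2 / B by rewrite !divr_gt0// nc_gt0.
pose proof (tends_comp (subordination_cont cz) (tends_divdiff rhoi 1 cw) q2) as h1.
pose proof (tends_near_neq0 (tends_divdiff rho 1 cz) q0) as h2.
have [d d0 hd] := filterI (filterI h1 h2) (filterI hB (near_cut_plane cz)).
have dd : nc (z + (d / 2)%:C - z) < d.
  by rewrite addrAC subrr add0r ncR gtr0_norm ?divr_gt0//; lra.
have [[k1 k2] [k3 k4]] := hd _ dd.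
set u := z + _ in dd k1 k2 k3 k4.
have uz : 0 < nc (u - z) by rewrite /u addrAC subrr add0r ncR gtr0_norm divr_gt0.
have E1 := Mtr_divdiff rhoi cw (subordination_cut k4).
have E2 := Mtr_divdiff rho cz k4.
rewrite !subordinationE// in E1.
have E : (u - z) * divdiff rho 1 z u =
    (omega u - omega z) * divdiff rhoi 1 (omega z) (omega u) by rewrite -E1 -E2.
have : nc (u - z) * nc (divdiff rho 1 z u) <= nc (u - z) * (nc q / 2).
  rewrite -(ncM (u - z)) E (ncM (omega u - omega z)).
  rewrite c0 subr0 ltr_pdivlMr// in k1.
  apply: (@le_trans _ _ (B * nc (u - z) * nc (divdiff rhoi 1 (omega z) (omega u)))).
    by rewrite ler_wpM2r ?nc_ge0.
  by rewrite mulrAC mulrC ler_pM2l// mulrC ltW.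
by rewrite ler_pM2l// leNgt k2.
Qed.

(** The second order of [omega] comes from [Mtr rhoi], whose explicit expansion at [omega z] has a
    nonzero derivative and is inverted. *)
Lemma taylor2_subordination z : cut_plane z -> divdiff rho 1 z z != 0 ->
  exists a, taylor2_at omega z a.
Proof.
move=> cz q0; have c0 := subordination_regular cz q0.
eexists; apply: (taylor2_implicit _ (taylor2_Mtr rhoi (subordination_cut cz)) c0).
- exact: tends_subr.
- exact: subordination_cont.
rewrite subordinationE//.
apply: taylor2_eq (taylor2_Mtr rho cz).
by apply: filterS (near_cut_plane cz) => u cu; rewrite subordinationE.
Qed.

End Subordination.

(** * The product of the subordination functions *)

Section ProductIdentity.
Context {R : realType} (M : nat) (rho_ : 'I_M -> probability R R) (rho : probability R R).
Context (omega : 'I_M -> R[i] -> R[i]).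
Hypothesis M_gt0 : (0 < M)%N.
Hypothesis rho_conv : is_free_mul_conv rho rho_.
Hypothesis omega_sub : forall i, is_subordination (rho_ i) rho (omega i).
Implicit Types (z w u : R[i]).

Definition eta z : R[i] := Mtr rho z / (Mtr rho z + 1).

Let D z : R[i] := \prod_(i < M) omega i z - z * eta z ^+ M.-1.

Let D_lt0 z : z < 0 -> D z = 0.
Proof.
move=> z0; have cz := cut_plane_lt0 z0.
have w1 := Mtr_lt0 rho z0.
have := rho_conv w1; rewrite Str_Mtr// /Str big_split/=.
set w := Mtr rho z in w1 *.
have -> : \prod_(i < M) Mtr_inv (rho_ i) w = \prod_(i < M) omega i z.
  by apply: eq_bigr => i _; have [_ _ ->] := omega_sub i.
rewrite prodr_const card_ord /D /eta -/w [1 + w]addrC.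
have n0 : w != 0 by apply: contraTneq w1 => ->; rewrite ltxx andbF.
have n1 : w + 1 != 0 by exact: Mtr1_neq0.
rewrite -[X in _ ^+ X](prednK M_gt0) exprS -[X in _ = X]mulrA.
have k0 : (w + 1) / w != 0 by rewrite mulf_neq0// invr_neq0.
move=> H; have {}H := mulfI k0 H.
rewrite [X in _ - X * _]H mulrAC -exprMn mulrA divfK// divff// expr1n mul1r.
by rewrite subrr.
Qed.

Let D_cont z : cut_plane z -> ccont D z.
Proof.
move=> cz; apply: tendsB.
  by apply: tends_prod => i; exact: subordination_cont.
apply: tendsM; first exact: tends_id.
apply: tendsX; apply: tendsM; first exact: Mtr_cont.
apply: tendsV; last exact: Mtr1_neq0.
by apply: tendsD; [exact: Mtr_cont|exact: tends_cst].
Qed.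

Let D_taylor z : cut_plane z -> divdiff rho 1 z z != 0 -> exists a, taylor2_at D z a.
Proof.
move=> cz q0.
have /choice[a ha] i : exists a, taylor2_at (omega i) z a.
  exact: taylor2_subordination (omega_sub i) _ cz q0.
pose proof (@tends_subr _ z) as y0.
have w0 i : omega i z != 0 by exact/cut_plane_neq0/(subordination_cut (omega_sub i)).
have TM := taylor2_Mtr rho cz.
pose proof (taylor2D TM (taylor2_cst _ 1)) as T1.
pose proof (taylor2X y0 M.-1 (taylor2M y0 TM (taylor2V y0 T1 (Mtr1_neq0 rho cz)))) as T2.
pose proof (taylor2_shift (F := nbc z) (fun u => u - z) z) as T3.
pose proof (taylor2M y0 T3 T2) as T4.
pose proof (taylor2_prod y0 (index_enum 'I_M) ha w0) as T5.
eexists; apply: taylor2_eq (taylor2B y0 T5 T4); apply: nearW => u.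
by rewrite /D /eta addrCA subrr addr0.
Qed.

(** Unique continuation has to start from an open set, and [D] is known to vanish on a half-line
    only. Since it does, replacing it by 0 below keeps continuity and second-order expansions across
    the half-line. *)
Let F z : R[i] := if 0 <= complex.Im z then D z else 0.

Let good z := complex.Re z < 0 \/ 0 < complex.Im z.

Let good_cut z : good z -> cut_plane z.
Proof. by move=> h; apply/cut_planeP; case: h => h; [right|left; rewrite gt_eqF]. Qed.

Let nearF_pos z : 0 < complex.Im z -> \forall u \near nbc z, D u = F u.
Proof.
move=> I0; exists (complex.Im z) => // u uz; rewrite /F ifT//.
have := le_lt_trans (nc_Im _) uz; rewrite ImB ltr_norml => /andP[? _]; lra.
Qed.

Let nearF_neg z : complex.Im z < 0 -> \forall u \near nbc z, 0 = F u.
Proof.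
move=> I0; exists (- complex.Im z); first by rewrite oppr_gt0.
move=> u uz; rewrite /F ifF//; apply/negbTE; rewrite -ltNge.
have := le_lt_trans (nc_Im _) uz; rewrite ImB ltr_norml => /andP[_ ?]; lra.
Qed.

Let F_cont z : good z -> ccont F z.
Proof.
move=> gz; have [I0|I0|I0] := ltgtP 0 (complex.Im z).
- rewrite /ccont {2}/F ifT ?ltW//; apply: tends_eq (nearF_pos I0) _.
  exact: D_cont (good_cut gz).
- rewrite /ccont {2}/F ifF; last by apply/negbTE; rewrite -ltNge.
  by apply: tends_eq (nearF_neg I0) _; exact: tends_cst.
have Rz : complex.Re z < 0 by case: gz => //; rewrite -I0 ltxx.
have Dz0 : D z = 0 by apply: D_lt0; apply/lt0_ReIm.
rewrite /ccont {2}/F -I0 lexx Dz0 => e e0.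
have := D_cont (good_cut gz) e0; rewrite Dz0.
by apply: filterS => u; rewrite /F; case: ifP => // _; rewrite subrr nc0.
Qed.

(** At a negative point both coefficients of [D] are 0, because [D] vanishes on a real sequence
    tending to that point; the expansions of [D] and of 0 then match. *)
Let F_taylor z : good z -> divdiff rho 1 z z != 0 -> twice_differentiable F z.
Proof.
move=> gz q0; have cz := good_cut gz.
have [a Da] := D_taylor cz q0.
have [I0|I0|I0] := ltgtP 0 (complex.Im z).
- exists a; rewrite /taylor2_at {2}/F ifT ?ltW//.
  exact: taylor2_eq (nearF_pos I0) Da.
- exists 0; rewrite /taylor2_at {2}/F ifF; last by apply/negbTE; rewrite -ltNge.
  exact: taylor2_eq (nearF_neg I0) (taylor2_cst _ 0).
have Rz : complex.Re z < 0 by case: gz => //; rewrite -I0 ltxx.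
have z0 : z < 0 by apply/lt0_ReIm.
move: Da => [b [r [rb DE]]].
have real_seq d : 0 < d -> exists2 u, nc (u - z) < d & u != z /\ D u = 0.
  move=> d0; exists (z - (d / 2)%:C).
    by rewrite addrAC subrr sub0r ncN ncR gtr0_norm ?divr_gt0//; lra.
  split; first by rewrite -subr_eq0 addrAC subrr sub0r oppr_eq0 -nc_eq0 ncR normr_eq0 gt_eqF// divr_gt0.
  by apply: D_lt0; apply/lt0_ReIm; rewrite ReB ImB/= -I0 subr0; split => //; lra.
have small (g : R[i] -> R[i]) (l : R[i]) : tends (nbc z) g l ->
    (\forall u \near nbc z, u != z -> D u = 0 -> g u = 0) -> l = 0.
  move=> gl [d d0 hd]; apply/eqP/negPn/negP => l0.
  have [d' d'0 hd'] := tends_near_neq0 gl l0.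
  have [|u ud [uz Du]] := real_seq (Num.min d d'); first by rewrite lt_min d0.
  move: ud; rewrite lt_min => /andP[u1 u2].
  by have := hd' u u2; rewrite (hd u u1 uz Du) nc0 ltNge divr_ge0// nc_ge0.
have a0 : a = 0.
  pose proof (tendsM rb (@tends_subr _ z)) as h; rewrite mulr0 in h.
  have h2 : tends (nbc z) (fun u => a + r u * (u - z)) (a + 0).
    by apply: tendsD => //; exact: tends_cst.
  rewrite addr0 in h2; apply: small h2 _; apply: filterS DE => u E uz Du.
  have yz : u - z != 0 by rewrite subr_eq0.
  apply: (mulIf yz); rewrite mul0r; move: E; rewrite Du (D_lt0 z0) add0r => E.
  by rewrite [RHS]E; ring.
have b0 : b = 0.
  apply: small rb _; apply: filterS DE => u E uz Du.
  have yz : (u - z) ^+ 2 != 0 by rewrite expf_neq0// subr_eq0.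
  apply: (mulIf yz); rewrite mul0r; move: E; rewrite Du (D_lt0 z0) a0 mul0r !add0r.
  by move=> <-.
exists 0; rewrite /taylor2_at.
have -> : F z = 0 by rewrite /F -I0 lexx D_lt0.
exists 0, (fun u => if 0 <= complex.Im u then r u else 0); split.
  move=> e e0; have := rb e e0; rewrite b0; apply: filterS => u.
  by case: ifP => // _; rewrite subrr nc0.
apply: filterS DE => u; rewrite /F; case: ifP => [_ ->|_ _]; last by ring.
by rewrite (D_lt0 z0) a0.
Qed.

Let F_good z : good z -> isolated_exceptions F z.
Proof.
move=> gz; split; first exact: F_cont.
have ng : \forall u \near nbc z, good u.
  case: gz => h.
    exists (- complex.Re z); first by rewrite oppr_gt0.
    move=> u uz; left; have := le_lt_trans (nc_Re _) uz; rewrite ReB ltr_norml; lra.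
  exists (complex.Im z) => // u uz; right.
  by have := le_lt_trans (nc_Im _) uz; rewrite ImB ltr_norml; lra.
apply: filterS (filterI ng (critical_points_isolated rho (good_cut gz))) => u [gu h] uz.
by apply: F_taylor => //; have [] := h uz.
Qed.

Lemma subordination_product z : 0 < complex.Im z ->
  \prod_(i < M) omega i z = z * eta z ^+ M.-1.
Proof.
move=> z0; apply/eqP; rewrite -subr_eq0 -/(D z); apply/eqP.
(* The path leaves [a0], around which [F] is 0 by definition, crosses the negative half-line at -1
   and turns at [a1] towards [z]. Squares of half-side [1 / 4] along the first leg stay in the left
   half-plane, those of half-side [d] along the second stay in the upper one. *)
pose a0 : R[i] := (-1) +i* (- 2^-1); pose a1 : R[i] := (-1) +i* 1.
have F0 : \forall u \near nbc a0, F u = 0.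
  by apply: filterS (nearF_neg (z := a0) _) => [u <-//|] /=; lra.
have F1 : \forall u \near nbc a1, F u = 0.
  have d4 : 0 < 4^-1 :> R by rewrite invr_gt0.
  apply: (vanish_segment d4) F0 => t /andP[t0 t1] u [h1 _].
  apply: F_good; left; move: h1; rewrite ReB ReD ReM/= mul0r subr0 subrr mulr0 addr0.
  by rewrite ler_norml => /andP[_ ?]; lra.
pose d : R := Num.min 1 (complex.Im z) / 2.
have m0 : 0 < Num.min 1 (complex.Im z) by rewrite lt_min ltr01.
have d0 : 0 < d by rewrite divr_gt0.
have F2 : \forall u \near nbc z, F u = 0.
  apply: (vanish_segment d0) F1 => t /andP[t0 t1] u [_ h2].
  apply: F_good; right; move: h2; rewrite ImB ImD ImM/= mul0r addr0 ImB/=.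
  have : Num.min 1 (complex.Im z) <= 1 + t * (complex.Im z - 1).
    have [h|h] := leP 1 (complex.Im z); first by rewrite lerDl mulr_ge0// subr_ge0.
    nra.
  by rewrite ler_norml /d => h /andP[? _]; lra.
by have := nbc_singleton F2; rewrite /F ltW.
Qed.

End ProductIdentity.

(** * Arguments of the subordination functions *)

Section Argument.
Context {R : realType}.
Implicit Types (z w m : R[i]) (a b : R).

(** The argument in []0, 2 pi[], with the same cut as [cut_plane], from the half-angle formula
    [cot (theta / 2) = Im w / (nc w - Re w)]. *)
Definition carg w : R := pi - 2 * atan (complex.Im w / (nc w - complex.Re w)).

Lemma nc_sub_Re_gt0 w : cut_plane w -> 0 < nc w - complex.Re w.
Proof.
move=> /cut_planeP cw; rewrite subr_gt0.
have [R0|R0] := ltP (complex.Re w) 0; first exact: lt_le_trans R0 (nc_ge0 w).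
have I0 : complex.Im w != 0 by case: cw => //; rewrite ltNge R0.
rewrite -(@ltr_pXn2r _ 2)// ?nnegrE ?nc_ge0// nc2 ltrDl.
by rewrite lt_def sqrf_eq0 I0 sqr_ge0.
Qed.

Lemma carg_polar w : cut_plane w ->
  complex.Re w = nc w * cos (carg w) /\ complex.Im w = nc w * sin (carg w).
Proof.
move=> cw; have d0 := nc_sub_Re_gt0 cw.
have n0 : 0 < nc w by rewrite nc_gt0 cut_plane_neq0.
rewrite /carg; set tau := _ / _; have nE := nc2 w.
have q0 : 0 < 1 + tau ^+ 2 by rewrite ltr_wpDr// sqr_ge0.
have c2 : cos (atan tau) ^+ 2 = (1 + tau ^+ 2)^-1.
  by rewrite cos_atan exprVn sqr_sqrtr// ltW.
have cn0 : cos (atan tau) != 0.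
  by rewrite cos_atan invr_neq0// gt_eqF// sqrtr_gt0.
have sE : sin (atan tau) = tau * cos (atan tau).
  have t : sin (atan tau) / cos (atan tau) = tau by exact: atanK.
  by rewrite -{2}t divfK.
have dbl : 2 * atan tau = atan tau + atan tau by ring.
have -> : cos (pi - 2 * atan tau) = - (1 - tau ^+ 2) / (1 + tau ^+ 2).
  rewrite cosB cospi sinpi mul0r addr0 mulN1r dbl cosD -!expr2 sE exprMn c2.
  by field; rewrite gt_eqF.
have -> : sin (pi - 2 * atan tau) = 2 * tau / (1 + tau ^+ 2).
  rewrite sinB cospi sinpi mul0r sub0r mulN1r opprK dbl sinD sE.
  have -> : tau * cos (atan tau) * cos (atan tau) + cos (atan tau) * (tau * cos (atan tau)) =
    2 * tau * cos (atan tau) ^+ 2 by ring.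
  by rewrite c2.
have -> : 1 + tau ^+ 2 = 2 * nc w / (nc w - complex.Re w).
  rewrite /tau expr_div_n; apply: (mulIf (x := (nc w - complex.Re w) ^+ 2)).
    by rewrite expf_neq0// gt_eqF.
  rewrite mulrDl divfK ?expf_neq0 ?gt_eqF// mul1r.
  have -> : complex.Im w ^+ 2 = nc w ^+ 2 - complex.Re w ^+ 2 by rewrite nE; ring.
  by field; rewrite gt_eqF.
have -> : 1 - tau ^+ 2 = - 2 * complex.Re w / (nc w - complex.Re w).
  rewrite /tau expr_div_n; apply: (mulIf (x := (nc w - complex.Re w) ^+ 2)).
    by rewrite expf_neq0// gt_eqF.
  rewrite mulrBl divfK ?expf_neq0 ?gt_eqF// mul1r.
  have -> : complex.Im w ^+ 2 = nc w ^+ 2 - complex.Re w ^+ 2 by rewrite nE; ring.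
  by field; rewrite gt_eqF.
by rewrite /tau; split; field; rewrite !gt_eqF.
Qed.

Lemma carg_bounds w : 0 < complex.Im w -> 0 < carg w < pi.
Proof.
move=> w0; have d0 := nc_sub_Re_gt0 (cut_plane_Im w0).
have t0 : 0 < complex.Im w / (nc w - complex.Re w) by rewrite divr_gt0.
have := atan_gt0 t0; have := atan_ltpi2 (complex.Im w / (nc w - complex.Re w)).
by rewrite /carg => h1 h2; apply/andP; split; lra.
Qed.

Lemma carg_lt0 w : w < 0 -> carg w = pi.
Proof. by move=> /lt0_ReIm[_ I0]; rewrite /carg I0 mul0r atan0 mulr0 subr0. Qed.

Lemma tends_nc (T : Type) (F : set_system T) {FF : Filter F} (f : T -> R[i]) (a : R[i]) :
  tends F f a -> nc \o f @ F --> nc a.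
Proof.
move=> fa; apply/cvgrPdist_lt => e /fa; apply: filterS => x h.
rewrite /= (le_lt_trans _ h)// ler_norml; apply/andP; split.
  by have := ncB_ge (f x) a; lra.
by have := ncB_ge a (f x); rewrite ncBC.
Qed.

Lemma tends_Re (T : Type) (F : set_system T) {FF : Filter F} (f : T -> R[i]) (a : R[i]) :
  tends F f a -> (fun x => complex.Re (f x)) @ F --> complex.Re a.
Proof.
move=> fa; apply/cvgrPdist_lt => e /fa; apply: filterS => x h.
by rewrite distrC (le_lt_trans _ h)// -ReB nc_Re.
Qed.

Lemma tends_Im (T : Type) (F : set_system T) {FF : Filter F} (f : T -> R[i]) (a : R[i]) :
  tends F f a -> (fun x => complex.Im (f x)) @ F --> complex.Im a.
Proof.
move=> fa; apply/cvgrPdist_lt => e /fa; apply: filterS => x h.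
by rewrite distrC (le_lt_trans _ h)// -ImB nc_Im.
Qed.

Lemma carg_cont (T : Type) (F : set_system T) {FF : Filter F} (f : T -> R[i]) (a : R[i]) :
  cut_plane a -> tends F f a -> (fun x => carg (f x)) @ F --> carg a.
Proof.
move=> ca fa; have d0 := nc_sub_Re_gt0 ca.
apply: cvgB; first exact: cvg_cst.
apply: cvgM; first exact: cvg_cst.
have h : (fun x => complex.Im (f x) / (nc (f x) - complex.Re (f x))) @ F -->
    complex.Im a / (nc a - complex.Re a).
  apply: cvgM; first exact: tends_Im.
  apply: cvgV; first by rewrite gt_eqF.
  by apply: cvgB; [exact: tends_nc|exact: tends_Re].
exact (cvg_comp _ (@atan R) h (@continuous_atan R _)).
Qed.

Definition cis a : R[i] := cos a +i* sin a.

Lemma cisD a b : cis (a + b) = cis a * cis b.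
Proof. by rewrite /cis cosD sinD; apply: complex_ext; rewrite ?ReM ?ImM/=; ring. Qed.

Lemma cis0 : cis 0 = 1.
Proof. by rewrite /cis cos0 sin0. Qed.

Lemma cisX a n : cis (a * n%:R) = cis a ^+ n.
Proof.
elim: n => [|n IH]; first by rewrite mulr0 cis0.
by rewrite exprS -IH -cisD mulrSr mulrDr mulr1 addrC.
Qed.

Lemma nc_cis a : nc (cis a) = 1.
Proof. by rewrite ncE/= cos2Dsin2 sqrtr1. Qed.

Lemma polarE w : cut_plane w -> w = (nc w)%:C * cis (carg w).
Proof.
move=> /carg_polar[E1 E2]; apply: complex_ext; rewrite ?ReM ?ImM/= mul0r.
  by rewrite subr0.
by rewrite addr0.
Qed.

Lemma nc_add1_gt0 m : 0 < complex.Im m -> 0 < nc (m + 1).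
Proof.
move=> m0; rewrite nc_gt0; apply: contraTneq m0 => /(congr1 (@complex.Im R)).
by rewrite ImD addr0 => ->; rewrite ltxx.
Qed.

Lemma Im_ratio m : 0 < complex.Im m -> 0 < complex.Im (m / (m + 1)).
Proof.
move=> m0; have n0 := nc_add1_gt0 m0.
rewrite ImM ReV ImV ReD ImD/= addr0.
have -> : complex.Re m * (- complex.Im m / nc (m + 1) ^+ 2) +
   complex.Im m * ((complex.Re m + 1) / nc (m + 1) ^+ 2) = complex.Im m / nc (m + 1) ^+ 2.
  by field; rewrite gt_eqF.
by rewrite divr_gt0// exprn_gt0.
Qed.

(* [|v|^2 - Re v] is minus [|v|^2] times the real part of [1 - 1 / v]. *)
Lemma circle_power_sin w m : 0 < complex.Im w -> 0 < complex.Im m ->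
  circle_power w (m + 1) * sin (carg w) =
  nc (m + 1) ^+ 2 * nc (m / (m + 1)) * sin (carg (m / (m + 1)) - carg w).
Proof.
move=> w0 m0; have cw := cut_plane_Im w0.
have ce := cut_plane_Im (Im_ratio m0).
have [E1 E2] := carg_polar cw; have [E3 E4] := carg_polar ce.
have nw : 0 < nc w by rewrite nc_gt0 cut_plane_neq0.
have s0 : sin (carg w) != 0 by apply: contraTneq w0 => s; rewrite E2 s mulr0 ltxx.
have n1 : nc (m + 1) != 0 by rewrite gt_eqF// nc_add1_gt0.
have n0 : nc (m + 1) ^+ 2 != 0 by rewrite expf_neq0.
rewrite sinB mulrBr; move: E3 E4; set e := m / (m + 1) => E3 E4.
have -> : nc (m + 1) ^+ 2 * nc e * (sin (carg e) * cos (carg w)) =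
    nc (m + 1) ^+ 2 * complex.Im e * cos (carg w) by rewrite E4; ring.
have -> : nc (m + 1) ^+ 2 * nc e * (cos (carg e) * sin (carg w)) =
    nc (m + 1) ^+ 2 * complex.Re e * sin (carg w) by rewrite E3; ring.
have -> : complex.Im e = complex.Im m / nc (m + 1) ^+ 2.
  by rewrite /e ImM ReV ImV ReD ImD/= addr0; field.
have -> : complex.Re e = 1 - (complex.Re m + 1) / nc (m + 1) ^+ 2.
  rewrite /e ReM ReV ImV ReD ImD/= addr0; apply: (mulIf n0).
  have nE : nc (m + 1) ^+ 2 = (complex.Re m + 1) ^+ 2 + complex.Im m ^+ 2.
    by rewrite nc2 ReD ImD/= addr0.
  by rewrite [RHS]mulrBl divfK// mul1r [X in _ = X - _]nE; field.
have -> : circle_power w (m + 1) = complex.Re m + 1 +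
    cos (carg w) / sin (carg w) * complex.Im m - nc (m + 1) ^+ 2.
  rewrite /circle_power ReD ImD/= addr0; congr (_ + _ * _ - _).
  by rewrite {1}E1 {1}E2; field; rewrite s0 gt_eqF.
by field; rewrite ?s0 ?n1.
Qed.

Context (rho : probability R R).
Hypothesis rho_diffuse : diffuse rho.

Lemma circle_power_diff_gt0 w : 0 < complex.Im w ->
  0 < sin (carg (Mtr rho w / (Mtr rho w + 1)) - carg w).
Proof.
set m := Mtr rho w => w0; have m0 := Im_Mtr_gt0 rho w0.
have c0 := circle_power_gt0 rho_diffuse w0.
have /andP[a0 a1] := carg_bounds w0.
have s0 : 0 < sin (carg w) by rewrite sin_gt0_pi// a0 a1.
have := mulr_gt0 c0 s0; rewrite circle_power_sin//.
rewrite pmulr_rgt0// mulr_gt0//.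
  rewrite exprn_gt0// nc_gt0; exact/Mtr1_neq0/cut_plane_Im.
by rewrite nc_gt0; exact/cut_plane_neq0/cut_plane_Im/Im_ratio.
Qed.

Lemma carg_lt_ratio w : 0 < complex.Im w ->
  carg w < carg (Mtr rho w / (Mtr rho w + 1)).
Proof.
set m := Mtr rho w => w0; have := circle_power_diff_gt0 w0; rewrite -/m => s0.
have /andP[a0 a1] := carg_bounds w0.
have /andP[b0 b1] := carg_bounds (Im_ratio (Im_Mtr_gt0 rho w0)).
rewrite ltNge; apply/negP => h.
have : 0 <= sin (carg w - carg (m / (m + 1))).
  by rewrite sin_ge0_pi//; apply/andP; split; lra.
by rewrite -opprB sinN; lra.
Qed.

(** By [circle_power_sin] the two sides of [critical_circle_power], times [sin (carg w)], share the
    factor [nc ((m + 1) * m)]. What is left is [sin (carg w) < sin (T - carg w)], where [T] is the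
    argument of [m / (m + 1)]. *)
Lemma carg_critical w : 0 < complex.Im w -> divdiff rho 1 w w = 0 ->
  carg w < carg (Mtr rho w / (Mtr rho w + 1)) / 2.
Proof.
set m := Mtr rho w => w0 crit.
have /andP[a0 a1] := carg_bounds w0.
have m0 : 0 < complex.Im m by exact: Im_Mtr_gt0.
have /andP[b0 b1] := carg_bounds (Im_ratio m0).
have lt := carg_lt_ratio w0.
have s0 : 0 < sin (carg w) by rewrite sin_gt0_pi// a0 a1.
have V0 : m + 1 != 0 by exact/Mtr1_neq0/cut_plane_Im.
have N0 : 0 < nc (m + 1) ^+ 2 * nc (m / (m + 1)).
  rewrite mulr_gt0 ?exprn_gt0 ?nc_gt0//.
  by exact/cut_plane_neq0/cut_plane_Im/Im_ratio.
have := critical_circle_power rho_diffuse w0 crit.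
rewrite -/m -(ltr_pM2r s0) circle_power_sin//.
have -> : nc ((m + 1) * m) = nc (m + 1) ^+ 2 * nc (m / (m + 1)).
  rewrite (ncM (m + 1)) (ncM m) ncV; field.
  by rewrite nc_eq0.
rewrite ltr_pM2l// => h.
set T := carg (m / (m + 1)) in b0 b1 lt h *.
have E : sin (T - carg w) - sin (carg w) = 2 * cos (T / 2) * sin (T / 2 - carg w).
  have sums a b : sin (a + b) - sin (a - b) = 2 * cos a * sin b.
    by rewrite sinD sinB; ring.
  rewrite -sums; congr (sin _ - sin _); first by field.
  by ring.
have c0 : 0 < cos (T / 2) by rewrite cos_gt0_pihalf//; apply/andP; split; lra.
have : 0 < sin (T / 2 - carg w).
  by rewrite -(pmulr_rgt0 _ (mulr_gt0 (ltr0Sn R 1) c0)) -E subr_gt0.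
move=> h2; rewrite ltNge; apply/negP => h3.
have : 0 <= sin (carg w - T / 2).
  by rewrite sin_ge0_pi//; apply/andP; split; lra.
by rewrite -opprB sinN; lra.
Qed.

End Argument.

Section UpperHalfPlane.
Context {R : realType} (rhoi rho : probability R R) (omega : R[i] -> R[i]).
Hypothesis sub : is_subordination rhoi rho omega.
Implicit Types (z w : R[i]).

Lemma Im_Mtr_gt0_inv (nu : probability R R) w : cut_plane w ->
  0 < complex.Im (Mtr nu w) -> 0 < complex.Im w.
Proof.
move=> cw m0; have [//|I0|I0] := ltgtP 0 (complex.Im w).
  have I1 : 0 < complex.Im (conjc w) by case: w I0 {cw m0} => a b /=; rewrite oppr_gt0.
  have := Im_Mtr_gt0 nu I1; rewrite Mtr_conj//.
  by case: (Mtr nu w) m0 => a b /=; rewrite oppr_gt0 => h1 /(lt_trans h1); rewrite ltxx.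
have R0 : complex.Re w < 0 by move/cut_planeP: cw => [|//]; rewrite -I0 eqxx.
have w0 : w < 0 by apply/lt0_ReIm.
by have /andP[_ /lt0_ReIm[_ E]] := Mtr_lt0 nu w0; move: m0; rewrite E ltxx.
Qed.

Lemma subordination_upper z : 0 < complex.Im z -> 0 < complex.Im (omega z).
Proof.
move=> z0; have cz := cut_plane_Im z0.
apply: (@Im_Mtr_gt0_inv rhoi); first exact: subordination_cut sub _ cz.
by rewrite (subordinationE sub cz) Im_Mtr_gt0.
Qed.

Lemma subordination_lt0 z : z < 0 -> omega z < 0.
Proof.
move=> z0; have cz := cut_plane_lt0 z0.
have cw := subordination_cut sub cz; have E := subordinationE sub cz.
have /andP[_ /lt0_ReIm[_ I0]] := Mtr_lt0 rho z0.
have [I1|I1|I1] := ltgtP 0 (complex.Im (omega z)).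
- by have := Im_Mtr_gt0 rhoi I1; rewrite E I0 ltxx.
- have I2 : 0 < complex.Im (conjc (omega z)).
    by case: (omega z) I1 => a b /=; rewrite oppr_gt0.
  have := Im_Mtr_gt0 rhoi I2; rewrite Mtr_conj// E.
  by case: (Mtr rho z) I0 => a b /= ->; rewrite oppr0 ltxx.
apply/lt0_ReIm; split => //.
by move/cut_planeP: cw => [|//]; rewrite -I1 eqxx.
Qed.

End UpperHalfPlane.

Section ArgumentSum.
Context {R : realType} (M : nat) (rho_ : 'I_M -> probability R R) (rho : probability R R).
Context (omega : 'I_M -> R[i] -> R[i]).
Hypothesis M_gt0 : (0 < M)%N.
Hypothesis rho_conv : is_free_mul_conv rho rho_.
Hypothesis omega_sub : forall i, is_subordination (rho_ i) rho (omega i).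
Context (t : R).
Implicit Types (phi : R).

Let c phi := cexp_mt t phi.

Let cE phi : c phi = (expR (- t))%:C * cis phi. Proof. by []. Qed.

Let c_pi : c pi < 0.
Proof.
apply/lt0_ReIm; rewrite cE ReM ImM/= cospi sinpi; split; last by rewrite !mul0r mulr0 addr0.
by rewrite mulrN1 mul0r subr0 oppr_lt0 expR_gt0.
Qed.

Let c_cut phi : 0 < phi <= pi -> cut_plane (c phi).
Proof.
rewrite le_eqVlt => /andP[p0 /orP[/eqP ->|p1]]; first exact: cut_plane_lt0 c_pi.
by apply/cut_plane_Im/Im_cexp_mt; rewrite p0.
Qed.

Let ratio_lt0 z : z < 0 -> eta rho z < 0.
Proof.
move=> z0; have /andP[h1 h2] := Mtr_lt0 rho z0.
have h3 : 0 < Mtr rho z + 1 by rewrite -(subrr (-1)) opprK ltrD2r.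
by rewrite /eta pmulr_llt0 ?invr_gt0.
Qed.

Let eta_cut phi : 0 < phi <= pi -> cut_plane (eta rho (c phi)).
Proof.
rewrite le_eqVlt => /andP[p0 /orP[/eqP ->|p1]].
  exact/cut_plane_lt0/ratio_lt0/c_pi.
by apply/cut_plane_Im/Im_ratio/Im_Mtr_gt0/Im_cexp_mt; rewrite p0.
Qed.

Let g phi := \sum_(i < M) carg (omega i (c phi)) - (phi + carg (eta rho (c phi)) * M.-1%:R).

Let g_pi : g pi = 0.
Proof.
rewrite /g (carg_lt0 (ratio_lt0 c_pi)).
have -> : \sum_(i < M) carg (omega i (c pi)) = \sum_(i < M) pi.
  by apply: eq_bigr => i _; rewrite carg_lt0//; exact: subordination_lt0 (omega_sub i) _ c_pi.
rewrite sumr_const card_ord -[X in _ *+ X](prednK M_gt0) mulrS.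
by rewrite mulr_natr subrr.
Qed.

Let g_cont phi : 0 < phi <= pi -> {for phi, continuous g}.
Proof.
move=> hp; have cc := c_cut hp.
have cont_c : tends (nbhs phi) c (c phi).
  by apply: cexp_mt_cont; [exact: cvg_cst|exact: cvg_id].
rewrite /continuous_at; apply: cvgB.
  have sum_cont (r : seq 'I_M) : \sum_(i <- r) carg (omega i (c x)) @[x --> phi] -->
      \sum_(i <- r) carg (omega i (c phi)).
    elim: r => [|i r IH].
      rewrite big_nil (_ : (fun _ => _) = (fun _ => 0)); first exact: cvg_cst.
      by apply/funext => x; rewrite big_nil.
    rewrite big_cons (_ : (fun x => _) =
      (fun x => carg (omega i (c x)) + \sum_(j <- r) carg (omega j (c x)))).
      apply: cvgD => //; apply: carg_cont.
        exact: subordination_cut (omega_sub i) _ cc.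
      exact (tends_comp cont_c (subordination_cont (omega_sub i) cc)).
    by apply/funext => x; rewrite big_cons.
  exact: sum_cont.
apply: cvgD; first exact: cvg_id.
apply: cvgM; last exact: cvg_cst.
apply: carg_cont; first exact: eta_cut.
pose proof (tends_comp cont_c (Mtr_cont rho cc)) as TM.
apply: tendsM => //; apply: tendsV; last exact: Mtr1_neq0.
by apply: tendsD => //; exact: tends_cst.
Qed.

Let prod_polar (r : seq 'I_M) (w : 'I_M -> R[i]) : (forall i, cut_plane (w i)) ->
  \prod_(i <- r) w i = (nc (\prod_(i <- r) w i))%:C * cis (\sum_(i <- r) carg (w i)).
Proof.
move=> cw; elim: r => [|i r IH]; first by rewrite !big_nil nc1 cis0 mulr1.
rewrite !big_cons cisD (ncM (w i)) rmorphM/= {1}IH {1}(polarE (cw i)).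
by rewrite -!mulrA; congr (_ * _); rewrite mulrCA.
Qed.

Let cis_g phi : 0 < phi < pi -> cis (g phi) = 1.
Proof.
move=> hp; have hp' : 0 < phi <= pi by case/andP: hp => -> /ltW.
have I0 : 0 < complex.Im (c phi) by exact: Im_cexp_mt.
have := subordination_product M_gt0 rho_conv omega_sub I0.
have cw i : cut_plane (omega i (c phi)).
  exact: subordination_cut (omega_sub i) _ (c_cut hp').
move=> E; have := prod_polar (index_enum 'I_M) cw; rewrite E => {}E.
set S := \sum_(i <- _) _ in E.
have N0 : nc (c phi * eta rho (c phi) ^+ M.-1) != 0.
  rewrite nc_eq0 mulf_neq0 ?expf_neq0//; apply: cut_plane_neq0; [exact: c_cut|exact: eta_cut].
have E2 : c phi * eta rho (c phi) ^+ M.-1 =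
    (nc (c phi * eta rho (c phi) ^+ M.-1))%:C * cis (phi + carg (eta rho (c phi)) * M.-1%:R).
  rewrite (ncM (c phi)) ncX cisD cisX rmorphM rmorphXn/=.
  rewrite [nc (c phi)](_ : _ = expR (- t)); last first.
    by rewrite cE (ncM (_%:C)) nc_cis mulr1 ncR ger0_norm// expR_ge0.
  by rewrite {1}(polarE (eta_cut hp')) exprMn {1}cE -!mulrA; congr (_ * _); rewrite mulrCA.
have N1 : (nc (c phi * eta rho (c phi) ^+ M.-1))%:C != 0.
  by apply: contraNneq N0 => /complexI ->.
have E3 : cis S = cis (phi + carg (eta rho (c phi)) * M.-1%:R).
  by apply: (mulfI N1); rewrite -E.
rewrite /g; set b := phi + _ in E3 *.
have b0 : cis b != 0 by rewrite -nc_eq0 nc_cis oner_eq0.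
by apply: (mulIf b0); rewrite mul1r -cisD subrK -E3.
Qed.

(** The product identity determines the sum of the arguments modulo [2 pi] only. On the arc of
    radius [e^(-t)] the defect [g] is continuous, [cis g = 1], and [g] is 0 at the negative end,
    where all the arguments are [pi]. *)
Lemma carg_sum_ge e : 0 < e < pi ->
  carg (eta rho (cexp_mt t e)) * M.-1%:R <= \sum_(i < M) carg (omega i (cexp_mt t e)).
Proof.
move=> /andP[e0 e1].
suff : 0 <= g e by rewrite /g -/(c e); lra.
have cg : cos (g e) = 1.
  by have := cis_g (introT andP (conj e0 e1)) => /(congr1 (@complex.Re R)).
rewrite leNgt; apply/negP => ge0.
(* In the first case [g] would take the value [- pi] somewhere on the arc, where [cis] is -1; in the
   second one [g e] lies in []- pi, 0[] and has cosine 1. *)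
have [gpi|gpi] := leP (g e) (- pi).
  have [||x xE gx] := @IVT R g e pi (- pi) (ltW e1).
  - apply: continuous_in_subspaceT => x; rewrite inE/= in_itv/= => /andP[h1 h2].
    by apply: g_cont; rewrite h2 andbT (lt_le_trans e0).
  - rewrite g_pi ge_min gpi le_max; apply/orP; right.
    by rewrite oppr_le0 ltW// pi_gt0.
  move: xE; rewrite in_itv/= => /andP[x1]; rewrite le_eqVlt => /orP[/eqP xpi|x2].
    by move: gx; rewrite xpi g_pi => h; have := pi_gt0 R; rewrite -oppr_lt0 -h ltxx.
  have /(congr1 (@complex.Re R)) := cis_g (introT andP (conj (lt_le_trans e0 x1) x2)).
  by rewrite gx /= cosN cospi => h; lra.
have : - g e = 0.
  apply: cos_inj; rewrite ?in_itv/= ?cosN ?cos0 ?cg//; last by rewrite lexx pi_ge0.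
  by apply/andP; split; lra.
by lra.
Qed.

End ArgumentSum.

(** * The moment transform in sectors *)

Section SectorBounds.
Context {R : realType} (rho : probability R R).
Implicit Types (w m : R[i]) (c e a b : R).

Lemma tightness e : 0 < e -> exists2 A : R, 0 <= A &
  expect rho (\1_(~` cball 0 A)) < e.
Proof.
move=> e0; pose F (n : nat) := ~` cball 0 (n%:R : R).
have mF n : measurable (F n) by apply: measurableC; exact: measurable_cball.
have F0 : \bigcap_n F n = set0.
  apply/seteqP; split => // x Fx.
  have := Fx (Num.truncn `|x|).+1 I; apply; apply/cballE; rewrite subr0.
  by rewrite ltW// Num.Theory.truncnS_gt.
have dF : {homo F : n m / (n <= m)%N >-> (m <= n)%O}.
  move=> n m nm; apply/subsetPset => x h /cballE k; apply: h; apply/cballE.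
  by rewrite (le_trans k)// ler_nat.
have fin : (rho (F 0%N) < +oo)%E by exact: (le_lt_trans (probability_le1 rho (mF 0%N)) (ltry 1)).
have mI : measurable (\bigcap_n F n) by rewrite F0.
have h := nonincreasing_cvg_mu fin mF mI dF.
rewrite F0 measure0 in h.
have /fine_cvgP[_ /cvgrPdist_lt/(_ e e0)[N _ /(_ N (leqnn N))]] := h.
rewrite /= sub0r normrN => hN; exists N%:R => //.
rewrite /expect /Rintegral integral_indic ?setIT//; last exact: mF.
by rewrite (le_lt_trans _ hN)// ler_norm.
Qed.

Lemma nc_cexpect_le_expect (u : R -> R[i]) (g : R -> R) : cbounded_measurable u ->
  bounded_measurable g -> (forall x, nc (u x) <= g x) ->
  nc (cexpect rho u) <= 2 * expect rho g.
Proof.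
move=> [u1 u2] bg ug; apply: le_trans (nc_le_ReIm _) _.
have norm_le f : bounded_measurable f -> (forall x, `|f x| <= g x) ->
    `|expect rho f| <= expect rho g.
  move=> bf fg; rewrite ler_norml -(expectN rho bg); apply/andP; split; apply: expect_le => //.
  - exact: bounded_measurableN.
  - by move=> x; have := fg x; rewrite ler_norml => /andP[].
  - by move=> x; have := fg x; rewrite ler_norml => /andP[].
have e1 := norm_le _ u1 (fun x => le_trans (nc_Re _) (ug x)).
have e2 := norm_le _ u2 (fun x => le_trans (nc_Im _) (ug x)).
by rewrite /=; lra.
Qed.

Lemma cauchy_ker_sector w c x : 0 < c -> c <= 1 -> 0 < complex.Im w ->
  c * nc w <= complex.Im w -> nc (cauchy_ker w x) <= c^-1.
Proof.
move=> c0 c1 w0 cw; have cut := cut_plane_Im w0.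
have n0 : 0 < nc w by rewrite nc_gt0 cut_plane_neq0.
have d0 : 0 < nc (1 - (expR x)%:C * w) by rewrite nc_gt0 cauchy_den_neq0.
rewrite /cauchy_ker ncV lef_pV2 ?posrE//.
have [|h] := cauchy_den_ge x cut; last exact: le_trans c1 h.
apply: le_trans; rewrite le_min c1/= (gtr0_norm w0) ler_pdivlMr//.
Qed.

Let bounded_far A : bounded_measurable (\1_(~` cball 0 A) : R -> R).
Proof.
split; first by apply: measurable_indic; apply: measurableC; exact: measurable_cball.
by exists 1 => x; rewrite indicE; case: (_ \in _); rewrite ?normr1// normr0.
Qed.

Let far_bound A (k : R -> R[i]) (B D : R) : 0 <= B -> 0 <= D -> cbounded_measurable k ->
  (forall x, `|x| <= A -> nc (k x) <= D) -> (forall x, nc (k x) <= B) ->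
  nc (cexpect rho k) <= 2 * (D + B * expect rho (\1_(~` cball 0 A))).
Proof.
move=> B0 D0 bk kD kB.
have bB : bounded_measurable (fun x => B * \1_(~` cball 0 A) x).
  by apply: bounded_measurableM => //; exact: bounded_measurable_cst.
have bg : bounded_measurable (fun x => D + B * \1_(~` cball 0 A) x).
  by apply: bounded_measurableD => //; exact: bounded_measurable_cst.
rewrite -(expectZ rho B (bounded_far A)) -{1}(expect_cst rho D).
rewrite -(expectD rho (bounded_measurable_cst D) bB).
apply: nc_cexpect_le_expect => // x; rewrite indicE.
have [xA|xA] := leP `|x| A.
  rewrite memNset; first by rewrite mulr0 addr0 kD.
  by apply; apply/cballE; rewrite subr0.
rewrite mem_set ?mulr1; first by rewrite (le_trans (kB x))// lerDr.
by move/cballE; rewrite subr0 leNgt xA.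
Qed.

(** In the sector [c * nc w <= Im w] the kernel is bounded by [1 / c] for all [x]. Outside a large
    interval [rho] has little mass, and inside it [e^x w] is small with [w]. *)
Lemma Mtr_sector_small c e : 0 < c -> c <= 1 -> 0 < e -> exists2 a, 0 < a &
  forall w, 0 < complex.Im w -> c * nc w <= complex.Im w -> nc w < a ->
    nc (Mtr rho w) <= e.
Proof.
move=> c0 c1 e0; have ci : 0 < c^-1 by rewrite invr_gt0.
have B0 : 0 < c^-1 + 1 by rewrite addr_gt0.
have e4 : 0 < e / 4 / (c^-1 + 1) by rewrite !divr_gt0.
have [A A0 hA] := tightness e4.
exists (e / 4 * c / expR A); first by rewrite divr_gt0 ?expR_gt0// mulr_gt0// divr_gt0.
move=> w w0 cw wa; have cut := cut_plane_Im w0.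
rewrite MtrE// -[1](cexpect_cst rho) -(cexpectB rho (cbounded_cauchy_ker cut) (cbounded_measurable_cst 1)).
have kB x : nc (cauchy_ker w x - 1) <= c^-1 + 1.
  by apply: le_trans (ncB _ _) _; rewrite nc1 lerD2r cauchy_ker_sector.
have kD x : `|x| <= A -> nc (cauchy_ker w x - 1) <= e / 4.
  move=> xA; have -> : cauchy_ker w x - 1 = (expR x)%:C * w * cauchy_ker w x.
    by have := cauchy_den_neq0 x cut => d0; rewrite /cauchy_ker; field.
  rewrite (ncM (_ * w)) (ncM (_%:C)) ncR (gtr0_norm (expR_gt0 x)).
  have xe : expR x <= expR A by rewrite ler_expR (le_trans (ler_norm x)).
  have kc := cauchy_ker_sector x c0 c1 w0 cw.
  apply: (@le_trans _ _ (expR A * nc w * c^-1)).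
    by rewrite ler_pM ?mulr_ge0 ?expR_ge0 ?nc_ge0// ler_wpM2r ?nc_ge0.
  rewrite ler_pdivrMr// mulrC -ler_pdivlMr ?expR_gt0//; exact: ltW.
have bk : cbounded_measurable (fun x => cauchy_ker w x - 1).
  by apply: cbounded_measurableB; [exact: cbounded_cauchy_ker|exact: cbounded_measurable_cst].
have e40 : 0 <= e / 4 by rewrite divr_ge0// ltW.
have := far_bound (ltW B0) e40 bk kD kB.
have : (c^-1 + 1) * expect rho (\1_(~` cball 0 A)) <= e / 4.
  by rewrite mulrC -ler_pdivlMr// ltW.
by lra.
Qed.

Lemma Mtr_sector_large c e : 0 < c -> c <= 1 -> 0 < e -> exists2 b, 0 < b &
  forall w, 0 < complex.Im w -> c * nc w <= complex.Im w -> b < nc w ->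
    nc (Mtr rho w + 1) <= e.
Proof.
move=> c0 c1 e0; have ci : 0 < c^-1 by rewrite invr_gt0.
have e4 : 0 < e / 4 / c^-1 by rewrite !divr_gt0.
have [A A0 hA] := tightness e4.
exists ((1 + 4 / e) * expR A); first by rewrite mulr_gt0 ?expR_gt0// addr_gt0// divr_gt0.
move=> w w0 cw wb; have cut := cut_plane_Im w0.
rewrite MtrE// subrK.
have kB x : nc (cauchy_ker w x) <= c^-1 by exact: cauchy_ker_sector.
have kD x : `|x| <= A -> nc (cauchy_ker w x) <= e / 4.
  move=> xA; rewrite /cauchy_ker ncV.
  have xe : expR (- A) <= expR x by rewrite ler_expR; move: xA; rewrite ler_norml => /andP[].
  have q : 4 / e <= nc (1 - (expR x)%:C * w).
    have h1 := ncB_ge ((expR x)%:C * w) 1.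
    rewrite ncBC; apply: le_trans h1; rewrite nc1 (ncM (_%:C)) ncR (gtr0_norm (expR_gt0 x)).
    have : (1 + 4 / e) * expR A * expR (- A) <= nc w * expR x.
      apply: ler_pM; rewrite ?expR_ge0//; last exact: ltW.
      by rewrite mulr_ge0 ?expR_ge0// addr_ge0// divr_ge0// ltW.
    by rewrite -mulrA -expRD subrr expR0 mulr1 [nc w * _]mulrC; lra.
  have q0 : 0 < 4 / e by rewrite divr_gt0.
  by rewrite -[e / 4]invrK invf_div lef_pV2 ?posrE// (lt_le_trans q0).
have e40 : 0 <= e / 4 by rewrite divr_ge0// ltW.
have := far_bound (ltW ci) e40 (cbounded_cauchy_ker cut) kD kB.
have : c^-1 * expect rho (\1_(~` cball 0 A)) <= e / 4.
  by rewrite mulrC -ler_pdivlMr// ltW.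
by lra.
Qed.

(** Within a sector [Mtr rho] tends to 0 at 0 and to -1 at infinity, so a value close to [m]
    confines [w] to an annulus. *)
Lemma sector_bounded m c : 0 < c -> c <= 1 -> m != 0 -> m + 1 != 0 ->
  exists a b d, [/\ 0 < a, 0 < b, 0 < d &
    forall w, 0 < complex.Im w -> c * nc w <= complex.Im w -> nc (Mtr rho w - m) < d ->
      a <= nc w <= b].
Proof.
move=> c0 c1 m0 m1.
have n0 : 0 < nc m by rewrite nc_gt0.
have n1 : 0 < nc (m + 1) by rewrite nc_gt0.
have h0 : 0 < nc m / 2 by rewrite divr_gt0.
have h1 : 0 < nc (m + 1) / 2 by rewrite divr_gt0.
have [a a0 ha] := Mtr_sector_small c0 c1 h0.
have [b b0 hb] := Mtr_sector_large c0 c1 h1.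
exists a, b, (Num.min (nc m / 2) (nc (m + 1) / 2)); split => //; first by rewrite lt_min h0.
move=> w w0 cw; rewrite lt_min => /andP[k0 k1]; apply/andP; split; rewrite leNgt; apply/negP => h.
  by have := ha w w0 cw h; have := ncB_ge m (Mtr rho w); rewrite ncBC; lra.
have := hb w w0 cw h; have := ncB_ge (m + 1) (Mtr rho w + 1); rewrite ncBC.
have -> : Mtr rho w + 1 - (m + 1) = Mtr rho w - m by ring.
by lra.
Qed.

Definition upper_box a b : set R[i] := square (0 +i* (a + b)) b.

Lemma upper_boxP a b w : 0 <= a -> a <= complex.Im w -> nc w <= b -> upper_box a b w.
Proof.
move=> a0 wa wb; have h1 := le_trans (nc_Re w) wb; have b0 := le_trans (nc_ge0 w) wb; have h2 := le_trans (nc_Im w) wb.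
split; rewrite ?ReB ?ImB/= ?subr0//.
move: h2; rewrite !ler_norml => /andP[_ h2]; apply/andP; split; lra.
Qed.

Lemma upper_box_Im a b w : upper_box a b w -> a <= complex.Im w.
Proof. by move=> [_]; rewrite ImB/= ler_norml => /andP[h _]; lra. Qed.

Hypothesis rho_diffuse : diffuse rho.

Lemma circle_power_lower a b : 0 < a -> 0 <= b -> exists2 c, 0 < c &
  forall w, upper_box a b w -> c <= circle_power w (Mtr rho w + 1).
Proof.
move=> a0 b0; pose v w := - circle_power w (Mtr rho w + 1).
have [|w Kw hw] := @square_max _ (0 +i* (a + b)) b v b0.
  move=> z Kz; have z0 : 0 < complex.Im z by exact: lt_le_trans (upper_box_Im Kz).
  pose proof (Mtr_cont rho (cut_plane_Im z0)) as cM.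
  have tV : tends (nbc z) (fun u => Mtr rho u + 1) (Mtr rho z + 1).
    by apply: tendsD => //; exact: tends_cst.
  have cv : v u @[u --> nbc z] --> v z.
    apply: cvgN; apply: cvgB.
      apply: cvgD; first exact (tends_Re tV).
      apply: cvgM; last exact (tends_Im tV).
      apply: cvgM; first exact (tends_Re (@tends_id _ z)).
      by apply: cvgV; [rewrite gt_eqF|exact (tends_Im (@tends_id _ z))].
    by rewrite expr2; apply: cvgM; exact (tends_nc tV).
  move=> e e0; move/cvgrPdist_lt/(_ e e0): cv; apply: filterS => u.
  by rewrite distrC.
exists (circle_power w (Mtr rho w + 1)).
  by apply: circle_power_gt0 => //; exact: lt_le_trans (upper_box_Im Kw).
by move=> u /hw; rewrite lerN2.
Qed.

(** A uniform [carg_lt_ratio]: [w] is confined to a compact box of the upper half-plane, on which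
    the circle power is at least some [l > 0]. Through [circle_power_sin], with [sin (carg w) >= c],
    this bounds the sine of the gap from below. *)
Lemma carg_gap m c : 0 < c -> c <= 1 -> 0 < complex.Im m -> exists kap d, [/\ 0 < kap, 0 < d &
  forall w, 0 < complex.Im w -> c * nc w <= complex.Im w -> nc (Mtr rho w - m) < d ->
    kap <= carg (Mtr rho w / (Mtr rho w + 1)) - carg w].
Proof.
move=> c0 c1 m0.
have mn0 : m != 0 by exact/cut_plane_neq0/cut_plane_Im.
have mn1 : m + 1 != 0 by rewrite -nc_gt0 nc_add1_gt0.
have [a [b [d [a0 b0 d0 hab]]]] := sector_bounded c0 c1 mn0 mn1.
have ca0 : 0 < c * a by rewrite mulr_gt0.
have [l l0 hl] := circle_power_lower ca0 (ltW b0).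
pose D := (nc m + 2) ^+ 2.
have D0 : 0 < D by rewrite exprn_gt0// ltr_wpDl// nc_ge0.
exists (l * c / D), (Num.min d 1); split.
- by rewrite divr_gt0// mulr_gt0.
- by rewrite lt_min d0 ltr01.
move=> w w0 cw; rewrite lt_min => /andP[h1 h2].
have /andP[wa wb] := hab w w0 cw h1.
have Kw : upper_box (c * a) b w.
  by apply: upper_boxP => //; [exact: ltW|rewrite (le_trans _ cw)// ler_wpM2l// ltW].
have lw := hl w Kw.
set mw := Mtr rho w in h1 h2 lw *.
have mw0 : 0 < complex.Im mw by exact: Im_Mtr_gt0.
have E := circle_power_sin w0 mw0.
have gap := carg_lt_ratio rho_diffuse w0; rewrite -/mw in gap.
have n0 : 0 < nc w by rewrite nc_gt0; exact/cut_plane_neq0/cut_plane_Im.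
have sc : c <= sin (carg w).
  have [_ E2] := carg_polar (cut_plane_Im w0).
  by move: cw; rewrite E2 mulrC ler_pM2l.
have nE : nc (mw + 1) ^+ 2 * nc (mw / (mw + 1)) = nc (mw + 1) * nc mw.
  rewrite (ncM mw) ncV; field; rewrite gt_eqF//; exact: nc_add1_gt0.
rewrite nE in E.
have nb : nc mw <= nc m + 1 by have := ncD (mw - m) m; rewrite subrK; lra.
have nb1 : nc (mw + 1) <= nc m + 2 by have := ncD mw 1; rewrite nc1; lra.
have ND : nc (mw + 1) * nc mw <= D.
  by rewrite /D expr2 ler_pM ?nc_ge0//; lra.
have gap0 : 0 <= carg (mw / (mw + 1)) - carg w by rewrite subr_ge0 ltW.
apply: (@le_trans _ _ (sin (carg (mw / (mw + 1)) - carg w))); last first.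
  by rewrite (le_trans _ (sin_ler gap0))// ler_norm.
have s0 := circle_power_diff_gt0 rho_diffuse w0; rewrite -/mw in s0.
rewrite ler_pdivrMr//.
apply: (@le_trans _ _ (circle_power w (mw + 1) * sin (carg w))).
  by rewrite ler_pM// ltW.
by rewrite E mulrC ler_wpM2l// ltW.
Qed.

End SectorBounds.

Section SectorSubordination.
Context {R : realType} (M : nat) (rho_ : 'I_M -> probability R R) (rho : probability R R).
Context (omega : 'I_M -> R[i] -> R[i]).
Hypothesis M_gt1 : (1 < M)%N.
Hypothesis rho_conv : is_free_mul_conv rho rho_.
Hypothesis omega_sub : forall i, is_subordination (rho_ i) rho (omega i).
Hypothesis rho_diffuse : forall i, diffuse (rho_ i).
Context (t : R) (m : R[i]) (m0 : 0 < complex.Im m).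
Hypothesis Mtr_m : tends (nbh0 t) (fun x => Mtr rho (cexp_mt x.1 x.2)) m.

Lemma sin_ge_edge (a x : R) : 0 < a -> a <= x -> x <= pi - a -> sin a <= sin x.
Proof.
move=> a0 ax xa; rewrite -subr_ge0.
have -> : sin x - sin a = 2 * cos ((x + a) / 2) * sin ((x - a) / 2).
  have sums u v : sin (u + v) - sin (u - v) = 2 * cos u * sin v :> R.
    by rewrite sinD sinB; ring.
  by rewrite -sums; congr (sin _ - sin _); field.
rewrite mulr_ge0 ?mulr_ge0//.
  by rewrite cos_ge0_pihalf//; apply/andP; split; lra.
by rewrite sin_ge0_pi//; apply/andP; split; lra.
Qed.

(** With a single factor the product identity makes [omega] the identity on the upper half-plane,
    and its boundary values are real. *)
Lemma other_index (i : 'I_M) : exists j : 'I_M, j != i.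
Proof.
pose a : 'I_M := Ordinal (ltnW M_gt1); pose b : 'I_M := Ordinal M_gt1.
by have [->|] := eqVneq i a; [exists b|exists a; rewrite eq_sym].
Qed.

(* If one of the arguments of the [omega i] were small, then another one would
   be close to that of [eta], against [carg_gap]. *)
Lemma subordination_sector : exists c, [/\ 0 < c, c <= 1 &
  \forall x \near nbh0 t, forall i,
    0 < complex.Im (omega i (cexp_mt x.1 x.2)) /\
    c * nc (omega i (cexp_mt x.1 x.2)) <= complex.Im (omega i (cexp_mt x.1 x.2))].
Proof.
pose T := carg (m / (m + 1)).
have /andP[T0 Tpi] : 0 < T < pi by exact/carg_bounds/Im_ratio.
(* A margin: when the argument [Th] of [eta] is within [q] of [T], an argument between [q] and [Th]
   stays at distance [q] from both 0 and [pi]. *)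
pose q := Num.min T (pi - T) / 4.
have q0 : 0 < q by rewrite divr_gt0// lt_min T0 subr_gt0.
have qT : 4 * q <= T by rewrite /q mulrC divfK// ge_min lexx.
have qpi : 4 * q <= pi - T by rewrite /q mulrC divfK// ge_min lexx orbT.
have sq0 : 0 < sin q by rewrite sin_gt0_pi// q0/=; lra.
have sin1 a : sin a <= 1 :> R.
  by have := cos2Dsin2 a; have := sqr_ge0 (cos a); have := sqr_ge0 (sin a - 1); nra.
have /choice[kd hkd] j : exists kd : R * R, [/\ 0 < kd.1, 0 < kd.2 &
    forall w, 0 < complex.Im w -> sin q * nc w <= complex.Im w ->
      nc (Mtr (rho_ j) w - m) < kd.2 ->
    kd.1 <= carg (Mtr (rho_ j) w / (Mtr (rho_ j) w + 1)) - carg w].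
  have [k [d [k0 d0 h]]] := carg_gap (rho_diffuse j) sq0 (sin1 q) m0.
  by exists (k, d).
pose kap := \big[Num.min/q]_(j < M) (kd j).1.
have kap0 : 0 < kap by apply: lt_bigmin => // j _; have [] := hkd j.
have kapj j : kap <= (kd j).1 by apply: bigmin_le_cond.
have kapq : kap <= q by apply: bigmin_le_id.
have near_m : \forall x \near nbh0 t, forall j : 'I_M,
    nc (Mtr rho (cexp_mt x.1 x.2) - m) < (kd j).2.
  by apply: filter_forall => j; apply: Mtr_m; have [] := hkd j.
have near_T : \forall x \near nbh0 t, `|T - carg (eta rho (cexp_mt x.1 x.2))| < q.
  have m1 : m + 1 != 0 by rewrite -nc_gt0 nc_add1_gt0.
  have te : tends (nbh0 t) (fun x => eta rho (cexp_mt x.1 x.2)) (m / (m + 1)).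
    apply: tendsM => //; apply: tendsV => //.
    by apply: tendsD => //; exact: tends_cst.
  pose proof (carg_cont (cut_plane_Im (Im_ratio m0)) te) as h.
  by move/cvgrPdist_lt: h; exact.
have sk0 : 0 < sin kap by rewrite sin_gt0_pi// kap0/=; lra.
exists (sin kap); split => //.
apply: filterS (filterI (filterI near_m near_T) (near_nbh0 t (pi_gt0 R))).
move=> x [[hm hT] [_ hx]] i.
have z0 := Im_cexp_mt x.1 hx.
set z := cexp_mt x.1 x.2 in hm hT z0 *.
have w0 j : 0 < complex.Im (omega j z) by exact: subordination_upper (omega_sub j) _ z0.
split => //.
set Th := carg (eta rho z) in hT.
have ME j : Mtr (rho_ j) (omega j z) = Mtr rho z.
  exact: subordinationE (omega_sub j) _ (cut_plane_Im z0).
have lt j : carg (omega j z) < Th.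
  by have := carg_lt_ratio (rho_diffuse j) (w0 j); rewrite ME.
have hb j : 0 < carg (omega j z) < pi by exact: carg_bounds.
move: hT; rewrite ltr_norml => /andP[hT1 hT2].
have sec j (a : R) : 0 < a -> a <= q -> a <= carg (omega j z) ->
    sin a * nc (omega j z) <= complex.Im (omega j z).
  move=> a0 aq aj; have [_ ->] := carg_polar (cut_plane_Im (w0 j)).
  rewrite mulrC ler_wpM2l ?nc_ge0//; apply: sin_ge_edge => //.
  by have := lt j; lra.
apply: (sec i kap) => //; rewrite leNgt; apply/negP => small.
have [j ji] := other_index i.
(* The arguments add up to at least [(M - 1) * Th], so the gaps add up to at most [Th]. An argument
   of [omega i] below [kap] uses more than [Th - kap] of it, which leaves less than [kap] for
   [omega j]. *)
have sum_gap : \sum_(k < M) (Th - carg (omega k z)) <= Th.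
  rewrite sumrB sumr_const card_ord.
  have := carg_sum_ge (ltnW M_gt1) rho_conv omega_sub x.1 hx.
  rewrite -/z -/Th -[X in Th *+ X](prednK (ltnW M_gt1)) mulrS -[Th *+ _]mulr_natr; lra.
have gap2 : (Th - carg (omega i z)) + (Th - carg (omega j z)) <= Th.
  apply: le_trans sum_gap; rewrite (bigD1 i)//= (bigD1 j)//= addrA lerDl.
  by apply: sumr_ge0 => k _; rewrite subr_ge0 ltW.
have [_ _ /(_ (omega j z) (w0 j))] := hkd j.
have jq : q <= carg (omega j z) by lra.
move=> /(_ (sec j q q0 (lexx q) jq)); rewrite ME => /(_ (hm j)).
by have := kapj j; rewrite -/Th; lra.
Qed.

End SectorSubordination.

(** * Subordination functions at the boundary *)

Section JointLimit.
Context {R : realType} (rhoi rho : probability R R) (omega : R[i] -> R[i]).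
Hypothesis sub : is_subordination rhoi rho omega.
Context (t : R) (m : R[i]) (m0 : 0 < complex.Im m).
Hypothesis Mtr_m : tends (nbh0 t) (fun x => Mtr rho (cexp_mt x.1 x.2)) m.
Context (c : R) (c0 : 0 < c) (c1 : c <= 1).

Let w (x : R * R) := omega (cexp_mt x.1 x.2).

Hypothesis sector : \forall x \near nbh0 t,
  0 < complex.Im (w x) /\ c * nc (w x) <= complex.Im (w x).

Let near_box : exists a b, 0 < a /\ \forall x \near nbh0 t, upper_box a b (w x).
Proof.
have mn0 : m != 0 by exact/cut_plane_neq0/cut_plane_Im.
have mn1 : m + 1 != 0 by rewrite -nc_gt0 nc_add1_gt0.
have [a [b [d [a0 b0 d0 hab]]]] := sector_bounded rhoi c0 c1 mn0 mn1.
exists (c * a), b; split; first exact: mulr_gt0.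
apply: filterS (filterI (filterI sector (Mtr_m d0)) (near_nbh0 t (pi_gt0 R))).
move=> x [[[w0 cw] hm] [_ hx]].
have z0 := Im_cexp_mt x.1 hx.
have /andP[wa wb] : a <= nc (w x) <= b.
  by apply: hab => //; rewrite /w (subordinationE sub (cut_plane_Im z0)).
apply: upper_boxP => //; first by rewrite mulr_ge0// ltW.
by rewrite (le_trans _ cw)// ler_wpM2l// ltW.
Qed.

(** Used twice: with a trivial [P] to find a candidate limit, and with [P] an annulus around the
    candidate to exclude other values. *)
Let cluster_value (P : R * R -> Prop) :
  (forall B, nbh0 t B -> exists2 x, B x & P x) ->
  exists Om, [/\ 0 < complex.Im Om, Mtr rhoi Om = m &
    forall B d, nbh0 t B -> 0 < d -> exists x, [/\ B x, P x & nc (w x - Om) < d]].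
Proof.
move=> HP; have [a [b [a0 hK]]] := near_box.
pose G : set_system R[i] := [set A | exists2 B, nbh0 t B & forall x, B x -> P x -> A (w x)].
have GG : ProperFilter G.
  apply: Build_ProperFilter_ex.
    by move=> A [B NB BA]; have [x Bx Px] := HP B NB; exists (w x); exact: BA.
  split.
  - by exists setT => //; exact: filterT.
  - move=> A A' [B NB BA] [B' NB' BA']; exists (B `&` B'); first exact: filterI.
    by move=> x [Bx Bx'] Px; split; [exact: BA|exact: BA'].
  - by move=> A A' AA [B NB BA]; exists B => // x Bx Px; exact/AA/BA.
have [|Om KOm HOm] := @square_cluster _ (0 +i* (a + b)) b G GG.
  by exists (fun x => upper_box a b (w x)).
have Om0 : 0 < complex.Im Om by exact: lt_le_trans (upper_box_Im KOm).
have clus B d : nbh0 t B -> 0 < d -> exists x, [/\ B x, P x & nc (w x - Om) < d].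
  move=> NB d0; have [|u [x [Bx Px <-]] ud] := HOm [set u | exists x, [/\ B x, P x & w x = u]] d _ d0.
    by exists B => // x Bx Px; exists x.
  by exists x.
exists Om; split => //.
apply/eqP; rewrite -subr_eq0 -nc_eq0; apply/negPn/negP => n0.
have e2 : 0 < nc (Mtr rhoi Om - m) / 2 by rewrite divr_gt0// lt_def n0 nc_ge0.
have [d d0 hd] := Mtr_cont rhoi (cut_plane_Im Om0) e2.
have [x [[hm [_ hx]] _ xd]] := clus _ d (filterI (Mtr_m e2) (near_nbh0 t (pi_gt0 R))) d0.
have z0 := Im_cexp_mt x.1 hx.
have h1 := hd _ xd; rewrite /w (subordinationE sub (cut_plane_Im z0)) ncBC in h1.
by have := nc_tri (Mtr rhoi Om) (Mtr rho (cexp_mt x.1 x.2)) m; lra.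
Qed.

(* The solutions of [Mtr rhoi w = m] are isolated, and the points [(t, e)] near
   the boundary form a convex set: only one of them is a limit point. *)
Lemma subordination_joint_limit : exists Om, [/\ 0 < complex.Im Om, Mtr rhoi Om = m &
  tends (nbh0 t) w Om].
Proof.
have [B [d1 d10 H]|Om [Om0 OmE clus]] := cluster_value (P := fun=> True).
  by exists (t, d1 / 2) => //; apply: H; [rewrite subrr normr0|apply/andP; split; lra].
exists Om; split => // e0 e00.
have [r r0 hr] := critical_points_isolated rhoi (cut_plane_Im Om0).
pose e := Num.min e0 r / 2.
have m00 : 0 < Num.min e0 r by rewrite lt_min e00.
have eE : 0 < e by rewrite divr_gt0.
have ee0 : e < e0.
  by rewrite (@lt_le_trans _ _ (Num.min e0 r)) ?ge_min ?lexx// /e; lra.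
have er : e < r.
  by rewrite (@lt_le_trans _ _ (Num.min e0 r)) ?ge_min ?lexx ?orbT// /e; lra.
(* Otherwise these values would cluster at a second solution of [Mtr rhoi w = m], closer to [Om]
   than the isolation radius [r]. *)
have [d d0 hd] : \forall x \near nbh0 t, ~ (e / 2 <= nc (w x - Om) <= e).
  apply: contrapT => H.
  have [B NB|Om' [Om'0 Om'E clus']] := cluster_value (P := fun x => e / 2 <= nc (w x - Om) <= e).
    apply: contrapT => H2; apply: H; apply: filterS NB => x Bx hx.
    by apply: H2; exists x.
  have lo : e / 2 <= nc (Om' - Om).
    rewrite leNgt; apply/negP => h.
    have q0 : 0 < e / 2 - nc (Om' - Om) by rewrite subr_gt0.
    have [x [_ /andP[h1 _] h2]] := clus' setT _ filterT q0.
    by have := nc_tri (w x) Om' Om; lra.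
  have hi : nc (Om' - Om) <= e.
    rewrite leNgt; apply/negP => h.
    have q0 : 0 < nc (Om' - Om) - e by rewrite subr_gt0.
    have [x [_ /andP[_ h1] h2]] := clus' setT _ filterT q0.
    by have := nc_tri Om' (w x) Om; rewrite (ncBC Om' (w x)); lra.
  have [||_ /eqP[]] := hr Om' _ _; first exact: le_lt_trans hi er.
    by rewrite -subr_eq0 -nc_gt0 (lt_le_trans _ lo)// divr_gt0.
  by rewrite OmE.
pose d' := Num.min d pi.
have d'0 : 0 < d' by rewrite lt_min d0 pi_gt0.
have e20 : 0 < e / 2 by rewrite divr_gt0.
have [x0 [[u0 v0] _ hx0]] := clus _ _ (near_nbh0 t d'0) e20.
apply: filterS (near_nbh0 t d'0) => x [u1 v1].
apply: lt_trans ee0; rewrite ltNge; apply/negP => xe.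
(* The segment from a point with [w] close to [Om] to one with [w] far from it stays at positive
   heights near [(t, 0)]; by the intermediate value theorem [w] would enter the forbidden annulus on
   it. *)
pose X (l : R) : R * R := (x0.1 + l * (x.1 - x0.1), x0.2 + l * (x.2 - x0.2)).
have boxX l : 0 <= l <= 1 -> `|(X l).1 - t| < d' /\ 0 < (X l).2 < d'.
  move=> /andP[l0 l1] /=; move: u0 u1 v0 v1; rewrite !ltr_norml.
  move=> /andP[p1 p2] /andP[p3 p4] /andP[p5 p6] /andP[p7 p8].
  have lo a p q : a < p -> a < q -> a < p + l * (q - p).
    by move=> ap aq; have [pq|pq] := leP p q; nra.
  have hi a p q : p < a -> q < a -> p + l * (q - p) < a.
    by move=> ap aq; have [pq|pq] := leP p q; nra.
  rewrite lo// hi// ltrBlDr ltrBrDr; split => //.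
  by apply/andP; split; [apply: lo|apply: hi]; lra.
pose h l := nc (w (X l) - Om).
have hc l : 0 <= l <= 1 -> {for l, continuous h}.
  move=> hl; have [_ /andP[b1 b2]] := boxX l hl.
  have z0 : 0 < complex.Im (cexp_mt (X l).1 (X l).2).
    by apply: Im_cexp_mt; rewrite b1 (lt_le_trans b2)// ge_min lexx orbT.
  have cX : tends (nbhs l) (fun k => cexp_mt (X k).1 (X k).2) (cexp_mt (X l).1 (X l).2).
    apply: cexp_mt_cont; (apply: cvgD; first exact: cvg_cst);
      apply: cvgM; [exact: cvg_id|exact: cvg_cst|exact: cvg_id|exact: cvg_cst].
  pose proof (tends_comp cX (subordination_cont sub (cut_plane_Im z0))) as cw.
  have cw' : tends (nbhs l) (fun k => w (X k) - Om) (w (X l) - Om).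
    by apply: tendsB => //; exact: tends_cst.
  exact (tends_nc cw').
have h0 : h 0 < e / 2.
  by rewrite /h /X !mul0r !addr0; case: (x0) hx0.
have h1 : e <= h 1.
  rewrite /h /X !mul1r (addrC x0.1) (addrC x0.2) !subrK.
  by case: (x) xe.
have [||l lE hl] := @IVT R h 0 1 e ler01.
- by apply: continuous_in_subspaceT => l; rewrite inE/= in_itv/=; exact: hc.
- by rewrite ge_min le_max h1 orbT andbT; apply/orP; left; lra.
move: lE; rewrite in_itv/= => lE; have [b1 /andP[b2 b3]] := boxX l lE.
apply: (hd (X l).1 (X l).2).
- by apply: lt_le_trans b1 _; rewrite ge_min lexx.
- by rewrite b2 (lt_le_trans b3)// ge_min lexx.
by rewrite -/(X l); have := hl; rewrite /h => ->; apply/andP; split; lra.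
Qed.

End JointLimit.

Section BoundaryContinuity.
Context {R : realType}.

Lemma tends_nbh0_right (f : R * R -> R[i]) (t : R) (a : R[i]) :
  tends (nbh0 t) f a -> tends (0 : R)^'+ (fun e => f (t, e)) a.
Proof.
move=> fa e e0; have [d d0 hd] := fa e e0.
near=> x; apply: (hd t x); first by rewrite subrr normr0.
apply/andP; split; near: x; [exact: nbhs_right_gt|exact: nbhs_right_lt].
Unshelve. all: by end_near. Qed.

(** A point of positive height close enough to [(u, 0)] is also close to [(t, 0)], and the value of
    [f] there compares [g u] with [g t]. *)
Lemma nbh0_limit_continuous (f : R * R -> R[i]) (g : R -> R[i]) (t : R) :
  (\forall u \near t, tends (nbh0 u) f (g u)) -> tends (nbhs t) g (g t).
Proof.
move=> H e e0; have e2 : 0 < e / 2 by rewrite divr_gt0.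
have Ht : tends (nbh0 t) f (g t) by exact: (nbhs_singleton H).
have [d d0 hd] := Ht _ e2.
near=> u.
have fu : tends (nbh0 u) f (g u) by near: u.
have ud : `|u - t| < d / 2.
  by near: u; apply/nbhs_ballP; exists (d / 2) => /=; [rewrite divr_gt0|move=> u; rewrite /ball/= distrC].
have d2 : 0 < d / 2 by rewrite divr_gt0.
have [x [h1 [h2 h3]]] := filter_ex (filterI (fu _ e2) (near_nbh0 u d2)).
have h4 : nc (f x - g t) < e / 2.
  case: x h1 h2 h3 => x1 x2 /= _ h2 /andP[h3 h4]; apply: hd.
    by have := ler_normD (x1 - u) (u - t); rewrite subrKA; lra.
  by rewrite h3 /=; lra.
by apply: nc_lt2 h4; rewrite ncBC.
Unshelve. all: by end_near. Qed.

Lemma omega_pE (omega : R[i] -> R[i]) (t : R) (Om : R[i]) :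
  tends (0 : R)^'+ (fun e => omega (cexp_mt t e)) Om -> omega_p omega t = Om.
Proof.
move=> h; rewrite /omega_p; apply: (@cvg_lim R[i]^o); first exact: norm_hausdorff.
by apply/tendsP.
Qed.

Lemma omega_mE (omega : R[i] -> R[i]) (t : R) (Om : R[i]) :
  tends (0 : R)^'- (fun e => omega (cexp_mt t e)) Om -> omega_m omega t = Om.
Proof.
move=> h; rewrite /omega_m; apply: (@cvg_lim R[i]^o); first exact: norm_hausdorff.
by apply/tendsP.
Qed.

End BoundaryContinuity.

Section DiagonalContinuity.
Context {R : realType}.

Lemma tends_sum (T : Type) (F : set_system T) {FF : Filter F} (I : Type) (r : seq I)
    (f : I -> T -> R[i]) (a : I -> R[i]) : (forall i, tends F (f i) (a i)) ->
  tends F (fun t => \sum_(i <- r) f i t) (\sum_(i <- r) a i).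
Proof.
move=> fa; elim: r => [|i r IH].
  by rewrite big_nil; apply: tends_eq (tends_cst 0); apply: nearW => t; rewrite big_nil.
rewrite big_cons; apply: tends_eq (tendsD (fa i) IH).
by apply: nearW => t; rewrite big_cons.
Qed.

(** The path from [divdiff 1 u u] to [divdiff 1 w w] passes through [divdiff 1 u w = divdiff 1 w u],
    and each half is [u - w] times a divided difference of the next order. *)
Lemma tends_divdiff_diag (rho : probability R R) (w : R[i]) : cut_plane w ->
  ccont (fun u => divdiff rho 1 u u) w.
Proof.
move=> cw; have [B B0 hB] := near_divdiff_bounded rho 2 cw.
have [D D0 hD] := near_ker_bound cw.
have w0 : 0 < nc w by rewrite nc_gt0 cut_plane_neq0.
have w2 : 0 < nc w / 2 by rewrite divr_gt0.
pose C := 2 * (((D + 1) / (nc w / 2)) ^+ 2 * D).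
apply: (@tends_squeeze _ _ _ _ _ _ (fun u => nc (u - w) * (B + C))).
  apply: filterS (filterI (filterI hB hD) (near_nbc_ball w w2)) => u [[h1 [cu h2]] h3].
  have E1 := divdiffS rho 1 cw cu; have E2 := divdiffS rho 1 cu cw.
  rewrite [LHS](divdiffC rho cu cw) E1 in E2.
  have -> : divdiff rho 1 u u - divdiff rho 1 w w =
      (u - w) * (divdiff rho 2 w u + divdiff rho 2 u w).
    by move/eqP: E2; rewrite -subr_eq => /eqP <-; ring.
  rewrite (ncM (u - w)) ler_wpM2l ?nc_ge0// (le_trans (ncD _ _))// lerD//.
  apply: nc_cexpect_le => [|x]; first exact: cbounded_divdiff.
  rewrite (ncM (_ ^+ 2)) ncX ler_pM ?exprn_ge0 ?nc_ge0//.
    have q : nc (stieltjes_ker u x) <= (D + 1) / (nc w / 2).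
      rewrite stieltjes_kerE// (ncM (_ - 1)) ncV; apply: ler_pM.
      - exact: nc_ge0.
      - by rewrite invr_ge0 nc_ge0.
      - by rewrite (le_trans (ncB _ _))// nc1 lerD2r.
      rewrite lef_pV2 ?posrE// ?nc_gt0 ?cut_plane_neq0//.
      by have := ncB_ge w u; rewrite ncBC; lra.
    by apply: lerXn2r q; rewrite nnegrE ?nc_ge0// divr_ge0 ?addr_ge0 ?(ltW D0) ?(ltW w2).
  by have [_] := nbc_singleton hD; exact.
have BC : 0 < B + C.
  by rewrite ltr_wpDr// mulr_ge0// mulr_ge0 ?(ltW D0)// sqr_ge0.
move=> e e0; have eB : 0 < e / (B + C) by rewrite divr_gt0.
by apply: filterS (near_nbc_ball w eB) => u; rewrite ltr_pdivlMr.
Qed.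

End DiagonalContinuity.

(** * The spectral variable in terms of one subordination function *)

Section SpectralExpansion.
Context {R : realType} (M : nat) (rho_ : 'I_M -> probability R R) (i0 : 'I_M) (n : nat).
Implicit Types (Om : 'I_M -> R[i]) (m : R[i]).

Let Q Om i := divdiff (rho_ i) 1 (Om i) (Om i).

(* The derivative of [z = \prod_i omega_i * (1 + 1 / m) ^ n] with respect to
   [omega_i0], where [m = Mtr (rho_ i) omega_i] for every [i]. *)
Definition spectral_coef Om m : R[i] :=
  (\prod_(i < M) Om i * \sum_(i < M) (if i == i0 then 1 else Q Om i0 / Q Om i) / Om i)
    * (1 + m^-1) ^+ n
  + \prod_(i < M) Om i * ((0 + - Q Om i0 / m ^+ 2) * n%:R * (1 + m^-1) ^+ n.-1).

(** The parameter is the increment of [omega_i0]: [m] is expanded by composition, and every other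
    [omega_i] by inverting its own transform, with derivative [Q Om i0 / Q Om i]. Later [n] is
    [M.-1], and [1 + m^-1] is the inverse of [eta]. *)
Lemma taylor2_spectral Om m (T : Type) (F : set_system T) {FF : Filter F}
    (f : 'I_M -> T -> R[i]) (mm : T -> R[i]) :
  (forall i, cut_plane (Om i)) -> (forall i, Mtr (rho_ i) (Om i) = m) -> m != 0 ->
  (forall i, i != i0 -> Q Om i != 0) ->
  (forall i, tends F (f i) (Om i)) ->
  (\forall x \near F, forall i, Mtr (rho_ i) (f i x) = mm x) ->
  taylor2 F (fun x => f i0 x - Om i0)
    (fun x => \prod_(i < M) f i x * (1 + (mm x)^-1) ^+ n)
    (\prod_(i < M) Om i * (1 + m^-1) ^+ n) (spectral_coef Om m).
Proof.
move=> cO OE m0 Q0 fO fE.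
pose y x := f i0 x - Om i0.
have y0 : tends F y 0.
  by rewrite -(subrr (Om i0)); apply: tendsB => //; exact: tends_cst.
have T0 : taylor2 F y (f i0) (Om i0) 1.
  apply: taylor2_eq (taylor2_shift y (Om i0)); apply: nearW => x.
  by rewrite /y addrC subrK.
have Tm : taylor2 F y mm m (Q Om i0).
  pose proof (taylor2_comp y0 (taylor2_Mtr (rho_ i0) (cO i0)) T0) as h.
  rewrite mulr1 OE in h.
  by apply: taylor2_eq h; apply: filterS fE => x hx; exact: hx.
have Ti i : taylor2 F y (f i) (Om i) (if i == i0 then 1 else Q Om i0 / Q Om i).
  have [->//|ii0] := eqVneq i i0.
  apply: (taylor2_implicit y0 (taylor2_Mtr (rho_ i) (cO i)) (Q0 i ii0) (fO i)).
  by rewrite OE; apply: taylor2_eq Tm; apply: filterS fE => x ->.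
pose proof (taylor2_prod y0 (index_enum 'I_M) Ti (fun i => cut_plane_neq0 (cO i))) as TP.
pose proof (taylor2X y0 n (taylor2D (taylor2_cst y 1) (taylor2V y0 Tm m0))) as TG.
exact (taylor2M y0 TP TG).
Qed.

(** At a critical value of [omega_i0] both [m] and the other [omega_i] are stationary, so only the
    factor [omega_i0] of the product varies at first order. *)
Lemma spectral_coef_critical Om m : (forall i, cut_plane (Om i)) -> m != 0 -> m + 1 != 0 ->
  Q Om i0 = 0 -> spectral_coef Om m != 0.
Proof.
move=> cO m0 m1 Q0; rewrite /spectral_coef Q0 oppr0 mul0r add0r !mul0r mulr0 addr0.
have P0 : \prod_(i < M) Om i != 0.
  by apply/prodf_neq0 => i _; exact: cut_plane_neq0.
rewrite !mulf_neq0 ?expf_neq0//; last first.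
  have -> : 1 + m^-1 = (m + 1) / m by rewrite mulrDl divff// mul1r.
  by rewrite mulf_neq0// invr_neq0.
rewrite (bigD1 i0)//= eqxx big1 => [|i /negbTE ->]; last by rewrite !mul0r.
by rewrite addr0 mul1r invr_neq0// cut_plane_neq0.
Qed.

Lemma spectral_coef_cont (T : Type) (F : set_system T) {FF : Filter F}
    (f : T -> 'I_M -> R[i]) (mm : T -> R[i]) Om m :
  (forall i, cut_plane (Om i)) -> m != 0 -> (forall i, i != i0 -> Q Om i != 0) ->
  (forall i, tends F (fun x => f x i) (Om i)) -> tends F mm m ->
  tends F (fun x => spectral_coef (f x) (mm x)) (spectral_coef Om m).
Proof.
move=> cO m0 Q0 fO mmm.
have TQ i : tends F (fun x => Q (f x) i) (Q Om i).
  exact (tends_comp (fO i) (tends_divdiff_diag (rho_ i) (cO i))).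
have TP : tends F (fun x => \prod_(i < M) f x i) (\prod_(i < M) Om i).
  exact: tends_prod.
have TG k : tends F (fun x => (1 + (mm x)^-1) ^+ k) ((1 + m^-1) ^+ k).
  by apply: tendsX; apply: tendsD; [exact: tends_cst|exact: tendsV].
apply: tendsD.
  apply: tendsM => //; apply: tendsM => //; apply: tends_sum => i.
  apply: tendsM; last by apply: tendsV => //; exact: cut_plane_neq0.
  have [_|ii0] := eqVneq i i0; first exact: tends_cst.
  by apply: tendsM => //; apply: tendsV => //; exact: Q0.
apply: tendsM => //; apply: tendsM => //; apply: tendsM; last exact: tends_cst.
apply: tendsD; first exact: tends_cst.
apply: tendsM; first exact: tendsN.
by apply: tendsV; [exact: tendsX|rewrite expf_neq0].
Qed.

End SpectralExpansion.

Section RealDerivative.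
Context {R : realType}.

Lemma tendsR (T : Type) (F : set_system T) {FF : Filter F} (f : T -> R) (a : R) :
  f @ F --> a -> tends F (fun x => (f x)%:C) a%:C.
Proof.
move=> /cvgrPdist_lt fa e e0; apply: filterS (fa e e0) => x.
by rewrite -rmorphB ncR distrC.
Qed.

Lemma derive1_slope (f : R -> R) (t a : R) :
  (f u - f t) / (u - t) @[u --> t^'] --> a -> derive1 f t = a.
Proof.
move=> /cvgrPdist_lt H; rewrite /derive1; apply: cvg_lim => //.
apply/cvgrPdist_lt => e /H; rewrite !near_withinE => /nbhs_ballP[d /= d0 hd].
apply/nbhs_ballP; exists d => //= h; rewrite /ball/= sub0r normrN => hh h0.
have := hd (h + t); rewrite /ball/= opprD addrCA subrr addr0 normrN => /(_ hh).
rewrite addrK mulrC; apply; first by rewrite -subr_eq0 addrK.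
Qed.

Lemma tends_slope (T : Type) (F : set_system T) {FF : Filter F} (f : T -> R[i])
    (g : T -> R) (a : R[i]) : tends F (fun x => f x / (g x)%:C) a ->
  (fun x => complex.Re (f x) / g x) @ F --> complex.Re a /\
  (fun x => complex.Im (f x) / g x) @ F --> complex.Im a.
Proof.
move=> fa.
have E x : (g x)%:C^-1 = ((g x)^-1)%:C by rewrite fmorphV.
have h1 := tends_Re fa; have h2 := tends_Im fa; split.
  have -> : (fun x => complex.Re (f x) / g x) = (fun x => complex.Re (f x / (g x)%:C)).
    by apply/funext => x; rewrite E ReM/= mulr0 subr0.
  exact: h1.
have -> : (fun x => complex.Im (f x) / g x) = (fun x => complex.Im (f x / (g x)%:C)).
  by apply/funext => x; rewrite E ImM/= mulr0 add0r.
exact: h2.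
Qed.

Lemma expR_slope (t : R) : (expR (- u) - expR (- t)) / (u - t) @[u --> t^'] --> - expR (- t).
Proof.
have dN : is_derive t 1 (fun u : R => - u) (-1).
  by apply: is_derive_eq.
have [df dE] := @is_derive1_comp _ expR (fun u => - u) t _ _ (is_derive_expR (- t)) dN.
rewrite mulrN1 in dE.
have H (e : R) : 0 < e -> exists2 d : R, 0 < d & forall h, h != 0 -> `|h| < d ->
    `|- expR (- t) - h^-1 * (expR (- (h + t)) - expR (- t))| < e.
  move=> e0; have [d d0 hd] := @derivable_regular R (fun u => expR (- u)) t df e e0.
  by exists d => // h h0 hh; rewrite -[X in `|X - _|]dE; exact: hd.
apply/cvgrPdist_lt => e /H[d d0 hd]; rewrite near_withinE; apply/nbhs_ballP.
exists d => //= u; rewrite /ball/= distrC => uu; rewrite -subr_eq0 => ut.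
by have := hd (u - t) ut uu; rewrite subrK [(u - t)^-1 * _]mulrC.
Qed.

Lemma sin_ger (x : R) : 0 <= x -> x <= 1 -> x / 2 <= sin x.
Proof.
rewrite le_eqVlt => /predU1P[<-|x0 x1]; first by rewrite sin0 mul0r.
have [|y] := @MVT R sin cos 0 x x0 (fun z _ => is_derive_sin z).
  by apply: continuous_subspaceT => z; exact: continuous_sin.
rewrite in_itv/= sin0 !subr0 => /andP[y0 yx] ->.
have := cos_ger (ltW y0) => h.
have : 2^-1 <= cos y by nra.
by rewrite [x / 2]mulrC => ?; rewrite ler_pM2r.
Qed.

End RealDerivative.

Section Boundary.
Context {R : realType} (M : nat) (rho_ : 'I_M -> probability R R) (rho : probability R R).
Context (p : R -> R) (omega : 'I_M -> R[i] -> R[i]).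
Hypothesis M_gt1 : (1 < M)%N.
Hypothesis rho_conv : is_free_mul_conv rho rho_.
Hypothesis omega_sub : forall i, is_subordination (rho_ i) rho (omega i).
Hypothesis rho_p : has_density rho p.
Hypothesis rho_diffuse : forall i, diffuse (rho_ i).
Context (s d L : R).
Hypotheses (d0 : 0 < d) (L0 : 0 <= L) (ps0 : 0 < p s).
Hypothesis lip : forall x y, `|x - s| < d -> `|y - s| < d -> `|p x - p y| <= L * `|x - y|.

Local Notation m := (Mbd rho p).

Definition Om (t : R) (i : 'I_M) : R[i] := omega_p (omega i) t.

(** The limits are joint in [t] and the height, so that regularity around a point gives continuity
    of the boundary values there. *)
Definition regular_at t := [/\ 0 < complex.Im (m t),
  tends (nbh0 t) (fun x => Mtr rho (cexp_mt x.1 x.2)) (m t),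
  forall i, 0 < complex.Im (Om t i),
  forall i, Mtr (rho_ i) (Om t i) = m t &
  forall i, tends (nbh0 t) (fun x => omega i (cexp_mt x.1 x.2)) (Om t i)].

Lemma near_regular : \forall t \near s, regular_at t.
Proof.
have [r [r0 rd bd]] := Mtr_tends_boundary rho_p d0 L0 lip.
have q0 : 0 < p s / (L + 1) by rewrite divr_gt0// ltr_wpDl.
pose q := Num.min r (p s / (L + 1)).
have qq0 : 0 < q by rewrite lt_min r0.
apply/nbhs_ballP; exists q => //= t; rewrite /ball/= distrC lt_min => /andP[tr tq].
have pt0 : 0 < p t.
  have ss : `|s - s| < d by rewrite subrr normr0.
  have := lip (lt_trans tr rd) ss; rewrite ler_norml => /andP[h _].
  move: tq; rewrite ltr_pdivlMr; last by rewrite ltr_wpDl.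
  by rewrite mulrDr mulr1 [_ * L]mulrC; have := normr_ge0 (t - s); lra.
have [Mt _] := bd t tr.
have m0 : 0 < complex.Im (m t) by rewrite /= mulr_gt0// pi_gt0.
have [c [c0 c1 sec]] :=
  subordination_sector M_gt1 rho_conv omega_sub rho_diffuse m0 Mt.
have H i : [/\ 0 < complex.Im (Om t i), Mtr (rho_ i) (Om t i) = m t &
    tends (nbh0 t) (fun x => omega i (cexp_mt x.1 x.2)) (Om t i)].
  have seci : \forall x \near nbh0 t, 0 < complex.Im (omega i (cexp_mt x.1 x.2)) /\
      c * nc (omega i (cexp_mt x.1 x.2)) <= complex.Im (omega i (cexp_mt x.1 x.2)).
    by apply: filterS sec => x; exact.
  have [w [w0 wE wt]] := subordination_joint_limit (omega_sub i) m0 Mt c0 c1 seci.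
  by rewrite /Om (omega_pE (tends_nbh0_right wt)).
by split=> // i; have [] := H i.
Qed.

Lemma product_upper (z : R[i]) : 0 < complex.Im z ->
  \prod_(i < M) omega i z * (1 + (Mtr rho z)^-1) ^+ M.-1 = z.
Proof.
move=> z0; have M0 := Im_Mtr_gt0 rho z0.
rewrite (subordination_product (ltnW M_gt1) rho_conv omega_sub z0) -mulrA -exprMn.
have n0 : Mtr rho z != 0 by exact/cut_plane_neq0/cut_plane_Im.
have n1 : Mtr rho z + 1 != 0 by exact/Mtr1_neq0/cut_plane_Im.
have -> : eta rho z * (1 + (Mtr rho z)^-1) = 1.
  by rewrite /eta; field; rewrite n0 n1.
by rewrite expr1n mulr1.
Qed.

Lemma product_boundary t : regular_at t ->
  \prod_(i < M) Om t i * (1 + (m t)^-1) ^+ M.-1 = (expR (- t))%:C.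
Proof.
move=> [m0 Mt _ _ Ot].
have m_neq0 : m t != 0 by exact/cut_plane_neq0/cut_plane_Im.
have nbh0_cexp : tends (nbh0 t) (fun x => cexp_mt x.1 x.2) (expR (- t))%:C.
  have -> : (expR (- t))%:C = cexp_mt t 0 by rewrite /cexp_mt cos0 sin0 mulr1.
  by apply: cexp_mt_cont; apply/cvgrPdist_lt => e e0; exists e => // u v h1 h2;
    rewrite distrC// subr0 ger0_norm; move/andP: h2 => [? ?] //; exact: ltW.
have h : tends (nbh0 t) (fun x => \prod_(i < M) omega i (cexp_mt x.1 x.2) *
    (1 + (Mtr rho (cexp_mt x.1 x.2))^-1) ^+ M.-1)
    (\prod_(i < M) Om t i * (1 + (m t)^-1) ^+ M.-1).
  apply: tendsM; first exact: tends_prod.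
  by apply: tendsX; apply: tendsD; [exact: tends_cst|exact: tendsV].
apply: (tends_uniq h); apply: tends_eq nbh0_cexp.
apply: filterS (near_nbh0 t (pi_gt0 R)) => x [_ hx].
by rewrite product_upper//; exact: Im_cexp_mt.
Qed.

Section RegularPoint.
Context (t : R) (reg : \forall u \near t, regular_at u).

Let regt : regular_at t. Proof. exact: nbhs_singleton reg. Qed.

Let cut_Om i : cut_plane (Om t i).
Proof. by case: regt => _ _ h _ _; exact: cut_plane_Im. Qed.

Let m_neq0 : m t != 0.
Proof. by case: regt => h _ _ _ _; exact/cut_plane_neq0/cut_plane_Im. Qed.

Let m1_neq0 : m t + 1 != 0.
Proof. by case: regt => h _ _ _ _; rewrite -nc_gt0 nc_add1_gt0. Qed.

Lemma Om_cont i : tends (nbhs t) (fun u => Om u i) (Om t i).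
Proof.
apply: (@nbh0_limit_continuous _ (fun x => omega i (cexp_mt x.1 x.2)) (fun u => Om u i)).
by apply: filterS reg => u [].
Qed.

Lemma Mbd_cont : tends (nbhs t) m (m t).
Proof.
apply: (@nbh0_limit_continuous _ (fun x => Mtr rho (cexp_mt x.1 x.2))).
by apply: filterS reg => u [].
Qed.

Let T := carg (m t / (m t + 1)).

Let carg_sum_boundary : T * M.-1%:R <= \sum_(i < M) carg (Om t i).
Proof.
case: regt => m0 Mt _ _ Ot.
have te : tends (nbh0 t) (fun x => eta rho (cexp_mt x.1 x.2)) (m t / (m t + 1)).
  apply: tendsM => //; apply: tendsV => //.
  by apply: tendsD => //; exact: tends_cst.
have h1 : (fun x => carg (eta rho (cexp_mt x.1 x.2)) * M.-1%:R) @ nbh0 t --> T * M.-1%:R.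
  by apply: cvgM; [exact (carg_cont (cut_plane_Im (Im_ratio m0)) te)|exact: cvg_cst].
have h2 (r : seq 'I_M) : (fun x => \sum_(i <- r) carg (omega i (cexp_mt x.1 x.2))) @ nbh0 t
    --> \sum_(i <- r) carg (Om t i).
  elim: r => [|i r IH].
    rewrite big_nil (_ : (fun _ => _) = (fun=> 0)); first exact: cvg_cst.
    by apply/funext => x; rewrite big_nil.
  rewrite big_cons (_ : (fun x => _) = (fun x => carg (omega i (cexp_mt x.1 x.2)) +
      \sum_(j <- r) carg (omega j (cexp_mt x.1 x.2)))).
    by apply: cvgD => //; exact (carg_cont (cut_Om i) (Ot i)).
  by apply/funext => x; rewrite big_cons.
apply: (ler_cvg_to h1 (h2 _)); apply: filterS (near_nbh0 t (pi_gt0 R)) => x [_ hx].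
exact: carg_sum_ge (ltnW M_gt1) rho_conv omega_sub x.1 x.2 hx.
Qed.

(* Two critical points would make the sum of the [T - carg (Om t i)] exceed
   [T / 2 + T / 2]. *)
Lemma at_most_one_critical : exists i0, forall i, i != i0 ->
  divdiff (rho_ i) 1 (Om t i) (Om t i) != 0.
Proof.
case: (regt) => m0 _ O0 OE _.
have lt i : carg (Om t i) < T by have := carg_lt_ratio (rho_diffuse i) (O0 i); rewrite OE.
case: (pselect (exists i, divdiff (rho_ i) 1 (Om t i) (Om t i) = 0)) => [[i0 c0]|nc0]; last first.
  exists (Ordinal (ltnW M_gt1)) => i _; apply/eqP => c0; apply: nc0; by exists i.
exists i0 => j ji; apply/eqP => cj.
have hi := carg_critical (rho_diffuse i0) (O0 i0) c0.
have hj := carg_critical (rho_diffuse j) (O0 j) cj.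
rewrite !OE -/T in hi hj.
have : \sum_(k < M) (T - carg (Om t k)) <= T.
  rewrite sumrB sumr_const card_ord.
  have := carg_sum_boundary.
  by rewrite -[X in T *+ X](prednK (ltnW M_gt1)) mulrS -[T *+ _]mulr_natr; lra.
rewrite (bigD1 i0)//= (bigD1 j)//=.
have : 0 <= \sum_(k < M | (k != i0) && (k != j)) (T - carg (Om t k)).
  by apply: sumr_ge0 => k _; rewrite subr_ge0 ltW.
by lra.
Qed.

Context (i0 : 'I_M).
Hypothesis noncrit : forall i, i != i0 -> divdiff (rho_ i) 1 (Om t i) (Om t i) != 0.

Let A := spectral_coef rho_ i0 M.-1 (Om t) (m t).

Let Q0 := divdiff (rho_ i0) 1 (Om t i0) (Om t i0).

(** The cases [Q0 = 0] and [Q0 != 0] need different arguments. In the second one the increment of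
    [omega_i0] is at most [2 * C / nc Q0] times [tau ^+ 2], because [Mtr (rho_ i0)] is not
    stationary there; if [A] were 0, the increment of [z] would be quadratic in it. *)
Lemma spectral_coef_neq0 (r C : R) : 0 < r -> 0 < C ->
  (forall tau, 0 < tau -> tau < r ->
    nc (Mtr rho (cexp_mt t (tau ^+ 3)) - m t) <= C * tau ^+ 2) -> A != 0.
Proof.
move=> r0 C0 est; case: (regt) => m0 Mt O0 OE Ot.
have [Q00|Q00] := eqVneq Q0 0; first exact: spectral_coef_critical.
apply/eqP => A0.
pose f i (tau : R) := omega i (cexp_mt t (tau ^+ 3)).
have right_nbh0 (g : R * R -> R[i]) a : tends (nbh0 t) g a ->
    tends (0 : R)^'+ (fun tau => g (t, tau ^+ 3)) a.
  move=> ga e e0; have [b b0 hb] := ga e e0.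
  have c0 : 0 < Num.min b 1 by rewrite lt_min b0 ltr01.
  near=> tau; apply: (hb t (tau ^+ 3)); first by rewrite subrr normr0.
  have tau0 : 0 < tau by near: tau; exact: nbhs_right_gt.
  have : tau < Num.min b 1 by near: tau; exact: nbhs_right_lt.
  rewrite lt_min exprn_gt0//= => /andP[h1 h2]; apply: le_lt_trans h1.
  by rewrite exprS ler_piMr ?(ltW tau0)// exprn_ile1// ltW.
have fO i : tends (0 : R)^'+ (f i) (Om t i).
  exact: (right_nbh0 _ _ (Ot i)).
have up : \forall tau \near (0 : R)^'+, 0 < complex.Im (cexp_mt t (tau ^+ 3)) /\ 0 < tau < r /\ tau < 1.
  near=> tau.
  have tau0 : 0 < tau by near: tau; exact: nbhs_right_gt.
  have tau1 : tau < 1 by near: tau; exact: nbhs_right_lt.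
  split; last by rewrite tau0 tau1; split => //; near: tau; exact: nbhs_right_lt.
  apply: Im_cexp_mt; rewrite exprn_gt0//=.
  have : tau ^+ 3 < 1 by rewrite exprn_ilt1// ltW.
  by have := pi_ge2 R; lra.
have fE : \forall tau \near (0 : R)^'+, forall i, Mtr (rho_ i) (f i tau) = Mtr rho (cexp_mt t (tau ^+ 3)).
  by apply: filterS up => tau [z0 _] i; exact: subordinationE (omega_sub i) _ (cut_plane_Im z0).
have := taylor2_spectral M.-1 cut_Om OE m_neq0 noncrit fO fE.
rewrite -/A A0 (product_boundary regt) => -[b [rr [rb zE]]].
pose proof (tends_near_bounded rb) as rB.
pose proof (tends_comp (fO i0) (tends_divdiff (rho_ i0) 1 (cut_Om i0))) as qO.
pose proof (tends_near_neq0 qO Q00) as qN.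
have nQ : 0 < nc Q0 by rewrite nc_gt0.
(* The increment of [z] has modulus at least [expR (- t) * tau ^+ 3 / 2], from its imaginary part,
   and would be at most [expR (- t) * D * tau ^+ 4]; this fails for [tau < 1 / (2 * D)]. *)
pose D := (nc b + 1) * (2 * C / nc Q0) ^+ 2 / expR (- t).
have D0 : 0 < D.
  rewrite divr_gt0 ?expR_gt0// mulr_gt0 ?exprn_gt0 ?divr_gt0 ?mulr_gt0//.
  by rewrite ltr_wpDl// nc_ge0.
have small : \forall tau \near (0 : R)^'+, tau < (2 * D)^-1.
  by apply: nbhs_right_lt; rewrite invr_gt0 mulr_gt0.
have [tau [[[h1 h2] [h3 h4]] [h5 [h6 [/andP[tau0 taur] tau1]]]]] :=
  filter_ex (filterI (filterI (filterI zE rB) (filterI qN small)) (filterI fE up)).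
have cf : cut_plane (f i0 tau) by exact: subordination_cut (omega_sub i0) _ (cut_plane_Im h6).
have E := Mtr_divdiff (rho_ i0) (cut_Om i0) cf; rewrite h5 OE in E.
have y2 : nc (f i0 tau - Om t i0) <= 2 * C / nc Q0 * tau ^+ 2.
  have := est tau tau0 taur; rewrite E (ncM (_ - _)) => h.
  rewrite -(ler_pM2r (x := nc Q0 / 2)) ?divr_gt0//.
  have -> : 2 * C / nc Q0 * tau ^+ 2 * (nc Q0 / 2) = C * tau ^+ 2 by field; rewrite gt_eqF.
  by apply: le_trans h; rewrite ler_wpM2l ?nc_ge0// ltW.
have zz : cexp_mt t (tau ^+ 3) - (expR (- t))%:C = rr tau * (f i0 tau - Om t i0) ^+ 2.
  by rewrite -{1}(product_upper h6) h1 mul0r addr0 addrC addKr.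
have lo : expR (- t) * (tau ^+ 3 / 2) <= nc (cexp_mt t (tau ^+ 3) - (expR (- t))%:C).
  apply: le_trans (nc_Im _); rewrite ImB /cexp_mt ImM/= mul0r addr0 subr0.
  rewrite ger0_norm; last first.
    apply: mulr_ge0; first exact: expR_ge0.
    apply: le_trans (sin_ger _ _); rewrite ?divr_ge0 ?exprn_ge0 ?(ltW tau0)//.
    by rewrite exprn_ile1// ltW.
  by rewrite ler_pM2l ?expR_gt0// sin_ger ?exprn_ge0 ?exprn_ile1 ?(ltW tau0) ?(ltW tau1).
have hi : nc (rr tau * (f i0 tau - Om t i0) ^+ 2) <= (nc b + 1) * (2 * C / nc Q0 * tau ^+ 2) ^+ 2.
  rewrite (ncM (rr tau)) ncX ler_pM ?nc_ge0 ?exprn_ge0 ?nc_ge0//.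
  have q0 : 0 <= 2 * C / nc Q0 * tau ^+ 2 by apply: le_trans y2; exact: nc_ge0.
  by apply: lerXn2r y2; rewrite nnegrE ?nc_ge0.
rewrite zz in lo; have {lo hi} := le_trans lo hi.
have -> : (nc b + 1) * (2 * C / nc Q0 * tau ^+ 2) ^+ 2 = expR (- t) * (D * tau ^+ 4).
  by rewrite /D; field; rewrite !gt_eqF// expR_gt0.
rewrite ler_pM2l ?expR_gt0// => h.
have : tau ^+ 3 * 2^-1 <= tau ^+ 3 * (D * tau)
  by have -> : tau ^+ 3 * (D * tau) = D * tau ^+ 4 by ring.
rewrite ler_pM2l ?exprn_gt0// leNgt; apply/negP; rewrite negbK.
by move: h4; rewrite invfM mulrC -ltr_pdivrMl ?invr_gt0// invrK.
Unshelve. all: by end_near. Qed.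

Lemma Om_spectral : taylor2 (nbhs t) (fun u => Om u i0 - Om t i0)
  (fun u => (expR (- u))%:C) (expR (- t))%:C A.
Proof.
case: (regt) => m0 Mt O0 OE Ot.
have fE : \forall u \near t, forall i, Mtr (rho_ i) (Om u i) = m u.
  by apply: filterS reg => u [].
pose proof (taylor2_spectral M.-1 cut_Om OE m_neq0 noncrit Om_cont fE) as h.
rewrite (product_boundary regt) in h; apply: taylor2_eq h.
by apply: filterS reg => u; exact: product_boundary.
Qed.

End RegularPoint.

End Boundary.

(** * Boundary values from the lower half-plane *)

Section Conjugation.
Context {R : realType}.

Lemma conjcM (x y : R[i]) : conjc (x * y) = conjc x * conjc y.
Proof. by case: x y => a b [c e]; apply: complex_ext => /=; ring. Qed.

Lemma conjcD (x y : R[i]) : conjc (x + y) = conjc x + conjc y.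
Proof. by case: x y => a b [c e]; apply: complex_ext => /=; ring. Qed.

Lemma conjcB (x y : R[i]) : conjc (x - y) = conjc x - conjc y.
Proof. by case: x y => a b [c e]; apply: complex_ext => /=; ring. Qed.

Lemma conj_lt0 (z : R[i]) : z < 0 -> conjc z = z.
Proof. by move=> /lt0_ReIm[_]; case: z => a b /= ->; rewrite oppr0. Qed.

Lemma regular_derivable (K : numFieldType) (f : K -> K) (z a : K) :
  (forall e : K, 0 < e -> exists2 d : K, 0 < d & forall h, h != 0 -> `|h| < d ->
     `|a - h^-1 * (f (h + z) - f z)| < e) -> derivable (f : K^o -> K^o) z 1.
Proof.
move=> H; apply/cvg_ex; exists a; apply/cvgrPdist_lt => e /H[d d0 hd].
rewrite near_withinE; apply/nbhs_ballP; exists d => //= h.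
rewrite /ball/= sub0r normrN => hh h0; rewrite /GRing.scale/= mulr1.
exact: hd.
Qed.

Lemma tends_conj (T : Type) (F : set_system T) {FF : Filter F} (f : T -> R[i]) (a : R[i]) :
  tends F f a -> tends F (fun x => conjc (f x)) (conjc a).
Proof. by move=> fa e /fa; apply: filterS => x; rewrite -conjcB nc_conj. Qed.

Definition conj_fun (f : R[i] -> R[i]) (z : R[i]) : R[i] := conjc (f (conjc z)).

(** [conj_fun f] is treated as a subordination function in its own right; its boundary values from
    above, already under control, are the conjugates of those of [f] from below. *)
Lemma conj_subordination (rhoi rho : probability R R) (f : R[i] -> R[i]) :
  is_subordination rhoi rho f -> is_subordination rhoi rho (conj_fun f).
Proof.
move=> sub; have [df cf invf] := sub; split.
- move=> z cz; have cz' := cut_plane_conj cz.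
  apply: (@regular_derivable R[i] _ z (conjc (derive (f : R[i]^o -> R[i]^o) (conjc z) 1))).
  move=> e e0; have [d d0 hd] := @derivable_regular R[i] _ _ (df _ cz') e e0.
  exists d => // h h0 hh; have h0' : conjc h != 0 by rewrite -nc_eq0 nc_conj nc_eq0.
  have hh' : `|conjc h| < d by rewrite normE nc_conj -normE.
  have := hd (conjc h) h0' hh'; rewrite !normE -nc_conj conjcB conjcM conjc_inv conjcB conjcK.
  rewrite /conj_fun; congr (_%:C < _); congr (nc (_ - _ * (conjc (f _) - _))).
  by rewrite conjcD.
- move=> z cz; have cz' := cut_plane_conj cz; have [c1 c2] := cf _ cz'.
  split; first exact: cut_plane_conj.
  by rewrite /conj_fun Mtr_conj// c2 Mtr_conj// conjcK.
move=> z z0; rewrite /conj_fun (conj_lt0 z0) (conj_lt0 (subordination_lt0 sub z0)).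
exact: invf.
Qed.

Lemma omega_m_conj (f : R[i] -> R[i]) (t : R) (a : R[i]) :
  tends (nbh0 t) (fun x => conj_fun f (cexp_mt x.1 x.2)) a -> omega_m f t = conjc a.
Proof.
move=> H; apply: omega_mE => e e0; have [d d0 hd] := H e e0.
near=> x.
have x0 : x < 0 by near: x; exact: nbhs_left_lt.
have xd : - d < x by near: x; apply: nbhs_left_gt; rewrite oppr_lt0.
have tt : `|t - t| < d by rewrite subrr normr0.
have := hd t (- x) tt; rewrite oppr_gt0 x0/= ltrNl => /(_ xd).
rewrite /conj_fun/= -nc_conj conjcB conjcK; congr (nc (f _ - _) < _).
by apply: complex_ext; rewrite /cexp_mt ?ReM ?ImM/= cosN sinN; ring.
Unshelve. all: by end_near. Qed.

End Conjugation.

Section BoundaryDerivative.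
Context {R : realType} (M : nat) (rho_ : 'I_M -> probability R R) (rho : probability R R).
Context (p : R -> R) (omega : 'I_M -> R[i] -> R[i]).
Hypothesis M_gt1 : (1 < M)%N.
Hypothesis rho_conv : is_free_mul_conv rho rho_.
Hypothesis omega_sub : forall i, is_subordination (rho_ i) rho (omega i).
Context (t : R) (reg : \forall u \near t, regular_at rho_ rho p omega u) (i0 : 'I_M).
Hypothesis noncrit : forall i, i != i0 ->
  divdiff (rho_ i) 1 (Om omega t i) (Om omega t i) != 0.

Local Notation m := (Mbd rho p).
Let O := Om omega.
Let A := spectral_coef rho_ i0 M.-1 (O t) (m t).
Hypothesis A0 : A != 0.

Let near_dnbhs (P : R -> Prop) : (\forall u \near t, P u) -> \forall u \near t^', P u.
Proof. by move=> H; rewrite near_withinE; apply: filterS H. Qed.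

Let sub_dnbhs (f : R -> R[i]) (a : R[i]) : tends (nbhs t) f a -> tends t^' f a.
Proof. by move=> h e e0; apply: near_dnbhs; exact: h. Qed.

(** [Om_spectral] expands [e^(-u)] in the increment of [O u i0] with first coefficient [A]; since
    [A] is nonzero, the difference quotient of [e^(-u)] can be divided by it. *)
Lemma Om_slope : tends t^' (fun u => (O u i0 - O t i0) / (u - t)%:C) (- (expR (- t))%:C / A).
Proof.
have [b [r [rb zE]]] := Om_spectral M_gt1 rho_conv omega_sub reg noncrit.
pose proof (tendsB (Om_cont reg i0) (@tends_cst _ _ (nbhs t) _ (O t i0))) as y0.
rewrite subrr in y0.
pose proof (tendsM rb y0) as ry; rewrite mulr0 in ry.
pose proof (tendsD (@tends_cst _ _ (nbhs t) _ A) ry) as h; rewrite addr0 in h.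
have hN := tends_near_neq0 (FF := nbhs_filter t) h A0.
pose proof (tendsM (tendsR (@expR_slope R t)) (tendsV (sub_dnbhs h) A0)) as H.
rewrite rmorphN in H; apply: tends_eq H.
have zN : \forall u \near t^', (expR (- u))%:C = (expR (- t))%:C + A * (O u i0 - O t i0) +
   r u * (O u i0 - O t i0) ^+ 2 /\ nc A / 2 < nc (A + r u * (O u i0 - O t i0)).
  by apply: near_dnbhs; exact: filterI zE hN.
have ne : \forall u \near t^', u != t by exact: nbhs_dnbhs_neq.
apply: filterS (filterI zN ne) => u [[E N] ut].
have N0 : A + r u * (O u i0 - O t i0) != 0.
  by rewrite -nc_gt0 (le_lt_trans _ N)// divr_ge0// nc_ge0.
have ut0 : (u - t)%:C != 0 by apply: contraNneq ut => /complexI/subr0_eq ->.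
have -> : ((expR (- u) - expR (- t)) / (u - t))%:C =
   (O u i0 - O t i0) * (A + r u * (O u i0 - O t i0)) / (u - t)%:C.
  by rewrite rmorphM fmorphV rmorphB/= E; congr (_ / _); ring.
by rewrite mulrAC mulfK.
Qed.

Lemma Mbd_slope : tends t^' (fun u => (m u - m t) / (u - t)%:C)
  (divdiff (rho_ i0) 1 (O t i0) (O t i0) * (- (expR (- t))%:C / A)).
Proof.
have [_ _ O0 OE _] := nbhs_singleton reg.
have cO := cut_plane_Im (O0 i0).
pose proof (sub_dnbhs (tends_comp (Om_cont reg i0) (tends_divdiff (rho_ i0) 1 cO))) as h.
apply: tends_eq (tendsM h Om_slope).
apply: near_dnbhs; apply: filterS reg => u [_ _ O0' OE' _].
rewrite -(OE' i0) -(OE i0) (Mtr_divdiff (rho_ i0) cO (cut_plane_Im (O0' i0))).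
by rewrite /= -!mulrA mulrCA.
Qed.

Lemma derive1_Mbd : derive1 (Mpv rho) t +i* (pi * derive1 p t) =
  divdiff (rho_ i0) 1 (O t i0) (O t i0) * (- (expR (- t))%:C / A).
Proof.
have [h1 h2] := tends_slope Mbd_slope; set D := _ * _ in h1 h2 *.
have pi0 : pi != 0 :> R by rewrite gt_eqF// pi_gt0.
apply: complex_ext => /=.
  apply: derive1_slope.
  have -> : (fun u => (Mpv rho u - Mpv rho t) / (u - t)) =
      (fun u => complex.Re (m u - m t) / (u - t)) by apply/funext => u; rewrite ReB.
  exact: h1.
rewrite (_ : derive1 p t = complex.Im D / pi); first by rewrite mulrC divfK.
apply: derive1_slope.
have -> : (fun u => (p u - p t) / (u - t)) = (fun u => complex.Im (m u - m t) / (u - t) / pi).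
  by apply/funext => u; rewrite ImB [complex.Im (m u)]/= [complex.Im (m t)]/= -mulrBr;
    rewrite mulrAC [pi * _]mulrC mulfK.
by apply: cvgM => //; exact: cvg_cst.
Qed.

End BoundaryDerivative.

(** * The covariance along the diagonal *)

Section LogModulus.
Context {R : realType}.

Lemma tends_neq0 (T : Type) (F : set_system T) {FF : Filter F} (f : T -> R[i]) (a : R[i]) :
  tends F f a -> a != 0 -> \forall x \near F, f x != 0.
Proof.
move=> fa a0; apply: filterS (tends_near_neq0 (FF := FF) fa a0) => x h.
by rewrite -nc_gt0 (le_lt_trans _ h)// divr_ge0// nc_ge0.
Qed.

Lemma lnabsM (x y : R[i]) : x != 0 -> y != 0 -> lnabs (x * y) = lnabs x + lnabs y.
Proof. by move=> x0 y0; rewrite /lnabs -!/(nc _) (ncM x) lnM// posrE nc_gt0. Qed.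

Lemma lnabsV (x : R[i]) : x != 0 -> lnabs x^-1 = - lnabs x.
Proof. by move=> x0; rewrite /lnabs -!/(nc _) ncV lnV// posrE nc_gt0. Qed.

Lemma lnabs_div (x y : R[i]) : x != 0 -> y != 0 -> lnabs (x / y) = lnabs x - lnabs y.
Proof. by move=> x0 y0; rewrite lnabsM ?invr_neq0// lnabsV. Qed.

Lemma lnabs_tends (T : Type) (F : set_system T) {FF : Filter F} (f : T -> R[i]) (a : R[i]) :
  tends F f a -> a != 0 -> (fun x => lnabs (f x)) @ F --> lnabs a.
Proof.
move=> fa a0; have n0 : 0 < nc a by rewrite nc_gt0.
exact (cvg_comp _ (@ln R) (tends_nc fa) (continuous_ln n0)).
Qed.

Lemma LkerE (rho : probability R R) (p : R -> R) (t s : R) : Lker rho p t s =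
  lnabs ((Mbd rho p t - Mbd rho p s) / (Mbd rho p t - conjc (Mbd rho p s))).
Proof.
rewrite /Lker /Mbd; move: (Mpv rho t) (Mpv rho s) (p t) (p s) => a b c e.
by congr (lnabs (_ / _)); apply: complex_ext => /=; ring.
Qed.

Lemma cvg_sum0 (T : Type) (F : set_system T) {FF : Filter F} (I : Type) (r : seq I)
    (P : pred I) (f : I -> T -> R) : (forall i, P i -> f i @ F --> (0 : R)) ->
  (fun x => \sum_(i <- r | P i) f i x) @ F --> (0 : R).
Proof.
move=> f0; elim: r => [|i r IH].
  rewrite (_ : (fun _ => _) = (fun=> 0)); first exact: cvg_cst.
  by apply/funext => x; rewrite big_nil.
have [Pi|nPi] := boolP (P i).
  rewrite (_ : (fun _ => _) = (fun x => f i x + \sum_(j <- r | P j) f j x)).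
    rewrite -[X in _ --> X]addr0; apply: cvgD; [exact (f0 i Pi)|exact IH].
  by apply/funext => x; rewrite big_cons Pi.
by rewrite (_ : (fun _ => _) = (fun x => \sum_(j <- r | P j) f j x))//;
  apply/funext => x; rewrite big_cons (negbTE nPi).
Qed.

End LogModulus.

Section Diagonal.
Context {R : realType} (M : nat) (rho_ : 'I_M -> probability R R) (rho : probability R R).
Context (p : R -> R) (omega : 'I_M -> R[i] -> R[i]).
Hypothesis M_gt1 : (1 < M)%N.
Hypothesis rho_conv : is_free_mul_conv rho rho_.
Hypothesis omega_sub : forall i, is_subordination (rho_ i) rho (omega i).
Hypothesis rho_p : has_density rho p.
Hypothesis rho_diffuse : forall i, diffuse (rho_ i).
Context (s d L : R).
Hypotheses (d0 : 0 < d) (L0 : 0 <= L) (ps0 : 0 < p s).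
Hypothesis lip : forall x y, `|x - s| < d -> `|y - s| < d -> `|p x - p y| <= L * `|x - y|.

Local Notation m := (Mbd rho p).
Let O := Om omega.
Let W t i := omega_m (omega i) t.
Let Q t i := divdiff (rho_ i) 1 (O t i) (O t i).
(** The increments of the boundary values satisfy [m t - m s = (O t i - O s i) * B t i] for every
    [i]. *)
Let B t i := divdiff (rho_ i) 1 (O s i) (O t i).

Let regs : \forall t \near s, regular_at rho_ rho p omega t.
Proof. exact (near_regular M_gt1 rho_conv omega_sub rho_p rho_diffuse d0 L0 ps0 lip). Qed.

Let regt : regular_at rho_ rho p omega s. Proof. exact: nbhs_singleton regs. Qed.

Let cO i : cut_plane (O s i).
Proof. by case: regt => _ _ h _ _; exact: cut_plane_Im. Qed.

Let ms0 : 0 < complex.Im (m s). Proof. by case: regt. Qed.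

Let tO i : tends (nbhs s) (fun t => O t i) (O s i). Proof. exact (Om_cont regs i). Qed.

Let tm : tends (nbhs s) m (m s). Proof. exact (Mbd_cont regs). Qed.

Let W_spec i : complex.Im (W s i) < 0 /\ tends (nbhs s) (fun t => W t i) (W s i).
Proof.
pose om' i := conj_fun (omega i).
have sub' j : is_subordination (rho_ j) rho (om' j) by exact: conj_subordination (omega_sub j).
have regs' := near_regular M_gt1 rho_conv sub' rho_p rho_diffuse d0 L0 ps0 lip.
have WE t : regular_at rho_ rho p om' t -> conjc (Om om' t i) = W t i.
  by move=> [_ _ _ _ h]; rewrite /W (omega_m_conj (h i)).
have reg' := nbhs_singleton regs'; rewrite -(WE s reg'); split.
  by case: reg' => _ _ h _ _; have := h i; case: (Om om' s i) => a b /=; rewrite oppr_lt0.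
apply: tends_eq (tends_conj (Om_cont regs' i)).
by apply: filterS regs' => t; exact: WE.
Qed.

Let near_dnbhs (P : R -> Prop) : (\forall u \near s, P u) -> \forall u \near s^', P u.
Proof. by move=> H; rewrite near_withinE; apply: filterS H. Qed.

Let sub_dnbhs (f : R -> R[i]) (a : R[i]) : tends (nbhs s) f a -> tends s^' f a.
Proof. by move=> h e e0; apply: near_dnbhs; exact: h. Qed.

Let OW_neq0 t i : 0 < complex.Im (O t i) -> complex.Im (W s i) < 0 -> O t i - W s i != 0.
Proof.
move=> h1 h2; apply/eqP => /(congr1 (@complex.Im R)); rewrite ImB [complex.Im 0]/=.
by lra.
Qed.

Let tB i : tends s^' (fun t => B t i) (Q s i).
Proof. by apply: sub_dnbhs; exact (tends_comp (tO i) (tends_divdiff (rho_ i) 1 (cO i))). Qed.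

Let tQ i : tends s^' (fun t => Q t i) (Q s i).
Proof. by apply: sub_dnbhs; exact (tends_comp (tO i) (tends_divdiff_diag (rho_ i) (cO i))). Qed.

Let lim_OW i : lnabs (O t i - W t i) - lnabs (O t i - W s i) @[t --> s^'] --> (0 : R).
Proof.
have [W0 tW] := W_spec i.
have n0 : O s i - W s i != 0 by apply: OW_neq0 => //; case: regt.
pose proof (tendsB (sub_dnbhs (tO i)) (sub_dnbhs tW)) as h1.
pose proof (tendsB (sub_dnbhs (tO i)) (@tends_cst _ _ s^' _ (W s i))) as h2.
rewrite -(subrr (lnabs (O s i - W s i))); apply: cvgB.
  exact (lnabs_tends h1 n0).
exact (lnabs_tends h2 n0).
Qed.

Let lim_QB i : Q s i != 0 -> lnabs (Q t i) - lnabs (B t i) @[t --> s^'] --> (0 : R).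
Proof.
move=> n0; rewrite -(subrr (lnabs (Q s i))).
by apply: cvgB; [exact (lnabs_tends (tQ i) n0)|exact (lnabs_tends (tB i) n0)].
Qed.

Let lim_mp : lnabs (m t - conjc (m s)) - lnabs (2 * pi * p t)%:C @[t --> s^'] --> (0 : R).
Proof.
have n0 : m s - conjc (m s) != 0.
  by apply/eqP => /(congr1 (@complex.Im R)); rewrite ImB/= opprK; move: ms0 => /=; lra.
have n1 : (2 * pi * p s)%:C != 0.
  apply/eqP => /complexI /eqP; apply/negP; rewrite gt_eqF// mulr_gt0// mulr_gt0//.
  exact: pi_gt0.
have -> : 0 = lnabs (m s - conjc (m s)) - lnabs (2 * pi * p s)%:C.
  apply/esym/eqP; rewrite subr_eq0; apply/eqP; rewrite /lnabs; congr ln.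
  have -> : m s - conjc (m s) = 0 +i* (2 * pi * p s).
    by apply: complex_ext => /=; ring.
  by rewrite -!/(nc _) ncR ncE/= expr0n add0r sqrtr_sqr.
pose proof (tendsB (sub_dnbhs tm) (@tends_cst _ _ s^' _ (conjc (m s)))) as h1.
apply: cvgB; first exact (lnabs_tends h1 n0).
have h2 : 2 * pi * p t @[t --> s^'] --> 2 * pi * p s.
  have := cvgM (@cvg_cst _ (2 : R) _ s^' _) (tends_Im (sub_dnbhs tm)).
  rewrite [complex.Im (m s)]/= mulrA.
  have -> : (fun t => 2 * pi * p t) = (fun=> 2) \* (fun t => complex.Im (m t)).
    by apply/funext => t /=; rewrite mulrA.
  exact.
exact (lnabs_tends (tendsR h2) n1).
Qed.

(** For [i = i0] the ratio of [Q t i0] and [B t i0] is not controlled, as [Q s i0] may be 0. But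
    [derive1_Mbd] writes the derivative of [m] as [Q t i0] times the slope of [omega_i0], and
    [m t - m s] is [B t i0] times its increment: both factors cancel, and the ratio of the
    difference quotient of [omega_i0] to its derivative takes their place. *)
Lemma covariance_diagonal :
  Kker rho p omega t s - Kdiag rho_ rho p omega t s @[t --> s^'] --> (0 : R).
Proof.
have [i0 noncrit] := at_most_one_critical M_gt1 rho_conv omega_sub rho_diffuse regs.
pose A t := spectral_coef rho_ i0 M.-1 (O t) (m t).
have As0 : A s != 0.
  have [r [C [r0 _ C0 est]]] := Mtr_boundary_estimate rho_p d0 L0 lip.
  apply: (spectral_coef_neq0 M_gt1 rho_conv omega_sub regs noncrit r0 C0) => tau t0 tr.
  by apply: est => //; rewrite subrr normr0.
have ms_neq0 : m s != 0 by exact/cut_plane_neq0/cut_plane_Im.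
pose proof (spectral_coef_cont M.-1 cO ms_neq0 noncrit tO tm) as tA.
pose E t := \sum_(i < M) (lnabs (O t i - W t i) - lnabs (O t i - W s i)) +
  \sum_(i < M | i != i0) (lnabs (Q t i) - lnabs (B t i)) +
  (lnabs (m t - conjc (m s)) - lnabs (2 * pi * p t)%:C) * M.-1%:R +
  (lnabs ((O t i0 - O s i0) / (t - s)%:C) - lnabs (- (expR (- t))%:C / A t)).
have E0 : E t @[t --> s^'] --> (0 : R).
  have -> : (0 : R) = 0 + 0 + 0 * M.-1%:R +
    (lnabs (- (expR (- s))%:C / A s) - lnabs (- (expR (- s))%:C / A s)).
    by rewrite mul0r subrr !addr0.
  have n0 : - (expR (- s))%:C / A s != 0.
    rewrite mulf_neq0 ?invr_neq0// oppr_eq0.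
    by apply/eqP => /complexI /eqP; rewrite gt_eqF// expR_gt0.
  apply: cvgD; first apply: cvgD; first apply: cvgD.
  - exact: cvg_sum0.
  - by apply: cvg_sum0 => i ii0; apply: lim_QB; exact: noncrit.
  - by apply: cvgM => //; exact: cvg_cst.
  have eN : expR (- t) @[t --> s^'] --> expR (- s).
    apply: cvg_within_filter.
    exact (cvg_comp (fun u : R => - u) expR (@cvgN _ _ _ _ _ id s cvg_id) (@continuous_expR R (- s))).
  pose proof (tendsM (tendsN (tendsR eN)) (tendsV (sub_dnbhs tA) As0)) as h2.
  apply: cvgB; last exact (lnabs_tends h2 n0).
  exact (lnabs_tends (Om_slope M_gt1 rho_conv omega_sub regs noncrit As0) n0).
rewrite -[0](mulr0 (- (2 * pi ^+ 2)^-1 : R)).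
have cE : - (2 * pi ^+ 2)^-1 * E t @[t --> s^'] --> - (2 * pi ^+ 2)^-1 * (0 : R).
  by apply: cvgM => //; exact: cvg_cst.
(* Near [s] the difference equals [- (2 * pi ^+ 2)^-1 * E t] exactly; the conditions of nonvanishing
   collected below keep every [ln] away from its default value at 0. *)
apply: cvg_trans cE; apply: near_eq_cvg.
have nQ i : \forall t \near s, i != i0 -> Q t i != 0.
  have [e|ii0] := boolP (i == i0); first by apply: filterE => t /negP[].
  pose proof (tends_comp (tO i) (tends_divdiff_diag (rho_ i) (cO i))) as h.
  exact (filterS (fun t ht _ => ht) (tends_neq0 h (noncrit i ii0))).
have {}nQ := @filter_forall _ _ _ (nbhs s) (nbhs_filter s) nQ.
pose proof (tends_neq0 tA As0) as nA.
have iso i : \forall t \near s, O t i != O s i ->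
    Q t i != 0 /\ Mtr (rho_ i) (O t i) != Mtr (rho_ i) (O s i).
  exact (near_comp (FF := nbhs_filter s) (tO i) (critical_points_isolated (rho_ i) (cO i))).
have {}iso := @filter_forall _ _ _ (nbhs s) (nbhs_filter s) iso.
have nr : \forall t \near s, \forall u \near t, regular_at rho_ rho p omega u.
  exact: near_join regs.
have nOW i : \forall t \near s, O t i - W t i != 0.
  have [W0 tW] := W_spec i.
  by apply: (tends_neq0 (tendsB (tO i) tW)); apply: OW_neq0 => //; case: regt.
have {}nOW := @filter_forall _ _ _ (nbhs s) (nbhs_filter s) nOW.
have ne : \forall t \near s^', t != s by exact: nbhs_dnbhs_neq.
apply: filterS (filterI ne (near_dnbhs (filterI (filterI nQ nA) (filterI nOW (filterI iso nr))))).
move=> t [ts [[nQt nAt] [OWt [isot rt]]]].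
have [m0 _ Ot0 OE _] := nbhs_singleton rt.
have [_ _ Os0 OsE _] := regt.
(* If [m t = m s], isolation of the solutions gives [O t i = O s i] for every [i], and the product
   identity then gives [e^(-t) = e^(-s)]. *)
have mm : m t - m s != 0.
  rewrite subr_eq0; apply/eqP => mts.
  have OO i : O t i = O s i.
    apply/eqP/negPn/negP => /isot[_]; rewrite OE OsE mts.
    by rewrite eqxx.
  have := product_boundary M_gt1 rho_conv omega_sub regt.
  rewrite -(eq_bigr _ (fun i _ => OO i)) -mts.
  rewrite (product_boundary M_gt1 rho_conv omega_sub (nbhs_singleton rt)).
  by move=> /complexI /expR_inj /oppr_inj; exact/eqP.
have OOn i : O t i != O s i.
  by apply: contraNneq mm => e; rewrite -(OE i) -(OsE i) -/O e subrr.
(* This includes [i0]: even if [Q s i0 = 0], the critical points are isolated and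
   [O t i0 != O s i0]. *)
have Qn i : Q t i != 0 by have [] := isot i (OOn i).
have dE i : m t - m s = (O t i - O s i) * B t i.
  by rewrite -(OE i) -(OsE i); apply: Mtr_divdiff => //; exact: cut_plane_Im (Ot0 i).
have dn i : O t i - O s i != 0 by rewrite subr_eq0.
have Bn i : B t i != 0 by apply: contraNneq mm => e; rewrite (dE i) e mulr0.
have tsn : (t - s)%:C != 0 by apply: contraNneq ts => /complexI/subr0_eq ->.
have mc : m t - conjc (m s) != 0.
  apply/eqP => /(congr1 (@complex.Im R)); rewrite ImB/= opprK.
  by move: m0 ms0 => /=; lra.
have OWs i : O t i - W s i != 0 by apply: OW_neq0 => //; have [] := W_spec i.
have pt0 : (2 * pi * p t)%:C != 0.
  apply/eqP => /complexI /eqP; apply/negP; rewrite gt_eqF// -mulrA mulr_gt0//.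
have LE : Lker rho p t s = lnabs (m t - m s) - lnabs (m t - conjc (m s)).
  by rewrite LkerE (lnabs_div mm mc).
have dME i : dMtr (rho_ i) (O t i) = Q t i.
  exact (taylor2_derive1 (taylor2_Mtr (rho_ i) (cut_plane_Im (Ot0 i)))).
have nct i (it : i != i0) : Q t i != 0 by exact: nQt.
have mE := derive1_Mbd M_gt1 rho_conv omega_sub rt nct nAt.
have eAn : - (expR (- t))%:C / A t != 0.
  rewrite mulf_neq0 ?invr_neq0// oppr_eq0.
  by apply/eqP => /complexI /eqP; rewrite gt_eqF// expR_gt0.
have tauE : ln `|t - s| = lnabs (t - s)%:C by rewrite /lnabs -/(nc _) ncR.
rewrite /E /Kker /Kdiag LE tauE mE (lnabs_div (dn i0) tsn).
rewrite (lnabs_div (mulf_neq0 (Qn i0) eAn) pt0) (lnabsM (Qn i0) eAn).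
set D := lnabs (m t - m s); set G := lnabs (m t - conjc (m s)).
set P := lnabs (2 * pi * p t)%:C; set tau := lnabs (t - s)%:C.
have DE i : D = lnabs (O t i - O s i) + lnabs (B t i) by rewrite /D (dE i) (lnabsM (dn i) (Bn i)).
clearbody D G tau.
have -> : \sum_(i < M) (lnabs ((omega_p (omega i) t - omega_p (omega i) s) /
      (omega_p (omega i) t - omega_m (omega i) s)) - (D - G)) =
    \sum_(i < M) (G - lnabs (B t i) - lnabs (O t i - W s i)).
  apply: eq_bigr => i _; rewrite -!/(O _ i) -/(W s i) (lnabs_div (dn i) (OWs i)) (DE i).
  by ring.
have -> : \sum_(i < M) lnabs ((omega_p (omega i) t - omega_m (omega i) t) *
      dMtr (rho_ i) (omega_p (omega i) t) / (2 * pi * p t)%:C) =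
    \sum_(i < M) (lnabs (O t i - W t i) + lnabs (Q t i) - P).
  apply: eq_bigr => i _; rewrite -!/(O _ i) -/(W t i) dME.
  by rewrite (lnabs_div (mulf_neq0 (OWt i) (Qn i)) pt0) (lnabsM (OWt i) (Qn i)).
clearbody P.
set SK := \sum_(i < M) (G - _ - _); set SD := \sum_(i < M) (_ + _ - P).
set S1 := \sum_(i < M) _; set S2 := \sum_(i < M | _) _.
(* The sums contain [G - P] once for each of the [M] factors; the terms of [Kker] and [Kdiag]
   outside the sums take one back, which leaves the [M.-1] of [E]. *)
have SS : SK + SD = S1 + S2 + (lnabs (Q t i0) - lnabs (B t i0)) + (G - P) * (M.-1%:R + 1).
  have -> : (G - P) * (M.-1%:R + 1) = \sum_(i < M) (G - P).
    by rewrite sumr_const card_ord natr1 (prednK (ltnW M_gt1)) mulr_natr.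
  have S2E : S2 + (lnabs (Q t i0) - lnabs (B t i0)) =
      \sum_(i < M) (lnabs (Q t i) - lnabs (B t i)).
    by rewrite (bigD1 i0)//= addrC.
  rewrite -[S1 + S2 + _]addrA S2E /SK /SD /S1 -!big_split.
  apply: eq_bigr => i _.
  have alg (b x y q : R) : G - b - x + (y + q - P) = y - x + (q - b) + (G - P) by ring.
  exact (alg _ _ _ _).
have -> : SK = S1 + S2 + (lnabs (Q t i0) - lnabs (B t i0)) + (G - P) * (M.-1%:R + 1) - SD.
  by rewrite -SS addrK.
rewrite (DE i0); clearbody S1 S2 SD; clear SK SS.
have alg (c n x H b q : R) : - c * (S1 + S2 + (G - P) * n + (x - tau - H)) =
    - c * (x + b - G) - c * (S1 + S2 + (q - b) + (G - P) * (n + 1) - SD) -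
    (- c * tau - c * (q + H - P) + c * SD) by ring.
exact (alg _ _ _ _ _ _).
Qed.

End Diagonal.

Theorem corollary4p11 (R : realType) (M : nat)
    (rho_ : 'I_M -> probability R R) (rho : probability R R)
    (p : R -> R) (omega : 'I_M -> R[i] -> R[i])
    (M_gt1 : (1 < M)%N)
    (rho_compact : forall i, compact (msupport (rho_ i)))
    (rho_conv : is_free_mul_conv rho rho_)
    (omega_sub : forall i, is_subordination (rho_ i) rho (omega i))
    (rho_density : has_density rho p)
    (p_holder : holder_continuous p)
    (p_C1holder : exists2 alpha : R, 0 < alpha &
       C1_holder_on alpha ((msupport rho)°) p)
    (no_point_mass : forall i, exp_no_point_mass (rho_ i))
    (s : R) (s_int : ((msupport rho)°) s) (p_s_gt0 : 0 < p s) :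
  Kker rho p omega t s - Kdiag rho_ rho p omega t s @[t --> s^'] --> (0 : R).
Proof.
have [alpha a0 H] := p_C1holder.
have [d [L [d0 L0 lip]]] := C1_holder_locally_lipschitz a0 (@open_interior _ _) s_int H.
have na i : diffuse (rho_ i) by exact/exp_no_point_mass_diffuse/no_point_mass.
exact: (covariance_diagonal M_gt1 rho_conv omega_sub rho_density na d0 L0 p_s_gt0 lip).
Qed.
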